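(* Let $V=L_{\widehat{\mathfrak{sl}}_2}(16,0)$ be the simple affine vertex operator algebra of type $A_1$ at level $16$, with $W=M^{16}$ and $M=M^8$. There exist $\tilde v\in W$ and an intertwining operator $I\in I\binom{M}{W\;M}$ such that $$Z_I(\tilde v,\tau)=\Delta(\tau)=q\prod_{n=1}^\infty(1-q^n)^{24},\qquad q=e^{2\pi i\tau}.$$
   Context: The irreducible modules of $L_{\widehat{\mathfrak{sl}}_2}(k,0)$ ($k\in\mathbb Z_{>0}$) are $M^i=L_{\widehat{\mathfrak{sl}}_2}(k,i\frac\alpha2)$, $0\le i\le k$, the irreducible highest-weight $\widehat{\mathfrak{sl}}_2$-modules of level $k$ whose top space $M^i(0)$ is the irreducible $\mathfrak{sl}_2$-module $L(i)$ of highest weight $i$ (dimension $i+1$). With the Segal–Sugawara conformal vector the central charge is $c=\frac{3k}{k+2}$ and $M^i$ has conformal weight $h_{M^i}=\frac{i(i+2)}{4(k+2)}$, so $M^i=\bigoplus_{n\ge0}M^i(n)$ with $M^i(n)$ the $L(0)$-eigenspace of eigenvalue $h_{M^i}+n$. For $k=16$: $c=8/3$, $h_W=4$, $h_M=10/9$. $I\binom{M}{W\;M}$ is the space of intertwining operators: linear maps $I(\cdot,w):W\to\mathrm{End}(M)[[w^{\pm1}]]w^{-h_W}$, $I(v,w)=\sum_{n\in\mathbb Z} v_{(n)}w^{-n-1-h_W}$, satisfying truncation, $I(L(-1)v,w)=\frac d{dw}I(v,w)$ and the Jacobi identity. For $v\in W(n)$, $\deg v=n$ and $o_I(v)=v_{(\deg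 v-1)}$ (extended linearly), which preserves each $M(n)$. The trace function is $Z_I(v,\tau)=\mathrm{tr}|_Mo_I(v)q^{L(0)-c/24}=\sum_{n\ge0}\mathrm{tr}|_{M(n)}o_I(v)\,q^{n+h_M-c/24}$. *)

(* Defs.v *)
From HB Require Import structures.
From mathcomp Require Import all_boot all_order all_algebra.
From mathcomp Require Import all_classical all_reals all_analysis.
From mathcomp Require Export complex.
Set Implicit Arguments.
Unset Strict Implicit.
Unset Printing Implicit Defensive.
Import Order.TTheory GRing.Theory Num.Theory.
Import numFieldNormedType.Exports.

Local Open Scope classical_set_scope.
Local Open Scope ring_scope.
Local Open Scope complex_scope.

Section LinearAlgebra.
Variables (C : numFieldType) (M : lmodType C).
Implicit Type S : set M.

Definition eigenspace_of (T : M -> M) (lambda : C) : set M :=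
  [set v | T v = lambda *: v].

Definition finite_dim_space S : Prop :=
  exists d (b : 'I_d -> M),
    forall v, S v -> exists a : 'I_d -> C, v = \sum_i a i *: b i.

Definition basis_of_space S d (b : 'I_d -> M) : Prop :=
  (forall v, S v <-> exists a : 'I_d -> C, v = \sum_i a i *: b i) /\
  (forall a : 'I_d -> C, \sum_i a i *: b i = 0 -> forall i, a i = 0).

(* Junk value 0 when S is not a finite-dimensional subspace or is not
   preserved by T. *)
Definition trace_on S (T : M -> M) : C :=
  xget 0 [set t | exists d (b : 'I_d -> M) (A : 'M[C]_d),
    [/\ basis_of_space S b,
        forall j, T (b j) = \sum_i A i j *: b i
      & t = \tr A]].

End LinearAlgebra.

Section Jacobi.
Variable C : numFieldType.

Definition binz (m : int) (i : nat) : C :=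
  (\prod_(j < i) (m - j%:Z)%:~R) / i`!%:R.

Definition mode_linear (U M N : lmodType C) (Y : U -> int -> M -> N) : Prop :=
  (forall n x, linear (fun u => Y u n x)) /\ (forall u n, linear (Y u n)).

Definition mode_truncation (U M N : lmodType C) (Y : U -> int -> M -> N) :
    Prop :=
  forall u x, exists n0 : int, forall n, n0 <= n -> Y u n x = 0.

(* Coefficientwise form of
     z0^-1 d((z1 - z2)/z0) Y_N(u, z1) I(w, z2)
       - z0^-1 d((z2 - z1)/(-z0)) I(w, z2) Y_M(u, z1)
     = z2^-1 d((z1 - z0)/z2) I(Y_W(u, z0) w, z2).
   By truncation both sums are finite, which is what the bound K expresses.
   The identity involves I only through z2, so it is insensitive to
   multiplying I(w, z2) by a fixed power z2^h: the modes of I may be indexed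
   up to a common, possibly non-integral, shift. *)
Definition jacobi_identity (V W M N : lmodType C)
    (YW : V -> int -> W -> W) (YM : V -> int -> M -> M)
    (YN : V -> int -> N -> N) (I : W -> int -> M -> N) : Prop :=
  forall (u : V) (w : W) (x : M) (l m n : int),
  exists K0 : nat, forall K : nat, (K0 <= K)%N ->
    \sum_(i < K) binz m i *: I (YW u (l + i%:Z) w) (m + n - i%:Z) x =
    \sum_(i < K) ((-1) ^+ i * binz l i) *:
      (YN u (l + m - i%:Z) (I w (n + i%:Z) x)
       - (-1) ^ l *: I w (l + n - i%:Z) (YM u (m + i%:Z) x)).

End Jacobi.

(* Y u n is the mode u_(n), the coefficient of z^(-n-1) in Y(u, z). *)
Record voa (C : numFieldType) := VOA {
  voa_space :> lmodType C;
  voaY : voa_space -> int -> voa_space -> voa_space;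
  vacuum : voa_space;
  conformal_vector : voa_space;
  central_charge : C;
  voa_linear : mode_linear voaY;
  voa_truncation : mode_truncation voaY;
  voa_vacuum : forall n v, voaY vacuum n v = if n == -1 then v else 0;
  voa_creation : forall v, voaY v (-1) vacuum = v /\
    forall n : int, 0 <= n -> voaY v n vacuum = 0;
  voa_jacobi : jacobi_identity voaY voaY voaY voaY;
  voa_virasoro : forall (m n : int) v,
    let L p := voaY conformal_vector (p + 1) in
    L m (L n v) - L n (L m v) =
      (m - n)%:~R *: L (m + n) v +
      (if m + n == 0 then (m ^+ 3 - m)%:~R / 12%:R * central_charge else 0)
        *: v;
  voa_derivation : forall v n x,
    voaY (voaY conformal_vector 0 v) n x = - n%:~R *: voaY v (n - 1) x;
  voa_graded : forall v, exists N (d : 'I_N -> int) (vs : 'I_N -> voa_space),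
    v = \sum_j vs j /\
    forall j, eigenspace_of (voaY conformal_vector 1) (d j)%:~R (vs j);
  voa_finite_dim : forall d : int,
    finite_dim_space (eigenspace_of (voaY conformal_vector 1) d%:~R);
  voa_lower_bounded : exists d0 : int, forall d v, d < d0 ->
    eigenspace_of (voaY conformal_vector 1) d%:~R v -> v = 0
}.

Record voa_module (C : numFieldType) (V : voa C) := VOAModule {
  mod_space :> lmodType C;
  modY : V -> int -> mod_space -> mod_space;
  mod_linear : mode_linear modY;
  mod_truncation : mode_truncation modY;
  mod_vacuum : forall n x, modY (vacuum V) n x = if n == -1 then x else 0;
  mod_jacobi : jacobi_identity (@voaY C V) modY modY modY;
  mod_graded : forall x, exists N (d : 'I_N -> C) (xs : 'I_N -> mod_space),
    x = \sum_j xs j /\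
    forall j, eigenspace_of (modY (conformal_vector V) 1) (d j) (xs j);
  mod_finite_dim : forall d : C,
    finite_dim_space (eigenspace_of (modY (conformal_vector V) 1) d);
  mod_lower_bounded : forall d : C, exists n0 : nat, forall n x, (n0 <= n)%N ->
    eigenspace_of (modY (conformal_vector V) 1) (d - n%:R) x -> x = 0
}.

Definition virL (C : numFieldType) (V : voa C) (M : voa_module V) (n : int) :
    M -> M :=
  modY (conformal_vector V) (n + 1).

Section AffineSl2.
Variable C : numFieldType.

Definition sl2 : set 'M[C]_2 := [set x | \tr x = 0].

Definition sl2_e : 'M[C]_2 := delta_mx 0 1.
Definition sl2_f : 'M[C]_2 := delta_mx 1 0.
Definition sl2_h : 'M[C]_2 := delta_mx 0 0 - delta_mx 1 1.

(* a x n is the action of x (x) t^n; only x in sl2 matters. The invariant form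
   is tr(xy), normalized so that the long roots have square length 2. *)
Definition affine_rep (k : C) (M : lmodType C)
    (a : 'M[C]_2 -> int -> M -> M) : Prop :=
  [/\ forall x n, sl2 x -> linear (a x n),
      forall (s : C) x y n v, sl2 x -> sl2 y ->
        a (s *: x + y) n v = s *: a x n v + a y n v
    & forall x y m n v, sl2 x -> sl2 y ->
        a x m (a y n v) - a y n (a x m v) =
          a (x *m y - y *m x) (m + n) v +
          (if m + n == 0 then m%:~R * \tr (x *m y) * k else 0) *: v].

Definition affine_hw_vector (i : C) (M : lmodType C)
    (a : 'M[C]_2 -> int -> M -> M) (v : M) : Prop :=
  [/\ v <> 0,
      forall x n, sl2 x -> 0 < n -> a x n v = 0,
      a sl2_e 0 v = 0
    & a sl2_h 0 v = i *: v].

Definition affine_invariant (M : lmodType C) (a : 'M[C]_2 -> int -> M -> M)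
    (S : set M) : Prop :=
  [/\ S 0,
      forall (s : C) u v, S u -> S v -> S (s *: u + v)
    & forall x n v, sl2 x -> S v -> S (a x n v)].

Definition affine_irreducible (M : lmodType C)
    (a : 'M[C]_2 -> int -> M -> M) : Prop :=
  (exists v : M, v <> 0) /\
  forall S, affine_invariant a S -> S = [set 0] \/ S = setT.

(* M is the affine sl2-module L(k, i alpha/2). *)
Definition is_affine_L (k i : nat) (M : lmodType C)
    (a : 'M[C]_2 -> int -> M -> M) : Prop :=
  [/\ affine_rep k%:R a, affine_irreducible a
    & exists v, affine_hw_vector i%:R a v].

(* V is the vertex operator algebra L(k, 0): J x is x_(-1) 1, so that
   Y(J x, z) is the current of x, and the conformal vector is the
   Segal-Sugawara one. Only the restriction of J to sl2 matters. *)
Definition is_affine_voa (k : nat) (V : voa C) (J : {linear 'M[C]_2 -> V}) :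
    Prop :=
  let a x n : V -> V := voaY (J x) n in
  [/\ is_affine_L k 0 a,
      affine_hw_vector 0 a (vacuum V)
    & conformal_vector V = (2%:R * (k + 2)%N%:R)^-1 *:
        (a sl2_e (-1) (J sl2_f) + a sl2_f (-1) (J sl2_e)
         + 2%:R^-1 *: a sl2_h (-1) (J sl2_h))].

(* The irreducible V-module M^i. *)
Definition is_affine_module (k i : nat) (V : voa C)
    (J : {linear 'M[C]_2 -> V}) (M : voa_module V) : Prop :=
  is_affine_L k i (fun x n => @modY C V M (J x) n).

Definition conformal_weight (k i : nat) : C :=
  (i * (i + 2))%N%:R / (4 * (k + 2))%N%:R.

End AffineSl2.

Section Intertwining.
Variables (C : numFieldType) (V : voa C).

(* I v n is v_(n) where I(v, w) = \sum_n v_(n) w^(-n-1-h). *)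
Definition is_intertwining (W M N : voa_module V) (h : C)
    (I : W -> int -> M -> N) : Prop :=
  [/\ mode_linear I,
      mode_truncation I,
      forall v n x, I (virL (-1) v) n x = - (n%:~R + h) *: I v (n - 1) x
    & jacobi_identity (@modY C V W) (@modY C V M) (@modY C V N) I].

(* The summand M(n), for a module of conformal weight h. *)
Definition graded_piece (M : voa_module V) (h : C) (n : nat) : set M :=
  eigenspace_of (virL (M := M) 0) (h + n%:R).

(* The component of v in M(n), for v in the sum of the M(j). *)
Definition homogeneous_component (M : voa_module V) (h : C) (n : nat) (v : M) :
    M :=
  xget 0 [set x | exists N (vs : nat -> M),
    [/\ forall j, graded_piece h j (vs j),
        forall j, (N <= j)%N -> vs j = 0,
        v = \sum_(j < N) vs j
      & x = vs n]].

(* o_I(v); the sum has finite support. *)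
Definition zero_mode (W M : voa_module V) (hW : C) (I : W -> int -> M -> M)
    (v : W) (x : M) : M :=
  \sum_(n \in [set: nat]) I (homogeneous_component hW n v) (n%:Z - 1) x.

End Intertwining.

Section TraceFunction.
Variable R : realType.

Definition cexp (z : R[i]) : R[i] :=
  (expR (complex.Re z))%:C *
  (cos (complex.Im z) +i* sin (complex.Im z)).

(* q^s for q = e^(2 pi i tau). *)
Definition qpow (tau s : R[i]) : R[i] := cexp (2%:R * pi%:C * 'i * tau * s).

Definition trace_term (V : voa R[i]) (W M : voa_module V) (hW hM : R[i])
    (I : W -> int -> M -> M) (v : W) (tau : R[i]) : nat -> R[i]^o :=
  fun n => trace_on (graded_piece (M := M) hM n) (zero_mode hW I v) *
           qpow tau (n%:R + hM - central_charge V / 24%:R).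

Definition trace_function (V : voa R[i]) (W M : voa_module V) (hW hM : R[i])
    (I : W -> int -> M -> M) (v : W) (tau : R[i]) : R[i] :=
  limn (series (trace_term hW hM I v tau)).

Definition Delta_partial (tau : R[i]) : nat -> R[i]^o :=
  fun N => qpow tau 1 * \prod_(1 <= n < N.+1) (1 - qpow tau 1 ^+ n) ^+ 24.

Definition Delta (tau : R[i]) : R[i] := limn (Delta_partial tau).

End TraceFunction.

(* Main.v *)
(* Write x_n for the modes of a current x = e, f, h.  The shift e_n -> e_{n+1},
   f_n -> f_{n-1}, h_n -> h_n + 16 delta_{n,0} (spectral flow) is an automorphism
   of the affine algebra under which L(16,0) becomes L(16,16) and L(16,8) is
   preserved.  It is implemented by the vertex operator
   E^-(z) Y(u,z) E^+(z) z^{h_0/2}, with E^-(z), E^+(z) the exponentials of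
   sum_j h_{-j} z^j / 2j and of - sum_j h_j z^{-j} / 2j; composed with the
   identifications W = flow of V and M = flow of M it gives the intertwining
   operator I.  Its Jacobi identity is checked for e and f and propagates to V by
   Dong's lemma.

   Take v = f_{-1}^8 w_16 in W(8).  Traces of o(x_0 w) vanish by cyclicity, so only
   h_0-weight 0 counts: the trace functions vanish on W(n), n < 8, and those of
   W(8) are multiples of Z(v).  Cyclicity also expresses Z(x_{-m} w), for w of
   degree at most 8, by Z(x_{-1} w); with e_{-1} w_16 = 0 this makes every
   quadratic term of the Sugawara expression for L_{-2} v, hence Z(L_{-2} v), a
   multiple of Z(v).  On the other hand the associativity formula for the
   conformal vector gives
     Z_n(L_{-2} v) = (h_M + n + 12) Z_n(v) + 24 sum_{j,r >= 1} j Z_{n-jr}(v).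
   Since Z_0(v) = 1, comparing at n = 0 and n yields
     n Z_n(v) = - 24 sum_{j,r >= 1} j Z_{n-jr}(v),
   which is the recursion for the coefficients of prod (1 - q^n)^24. *)
From HB Require Import structures.
From mathcomp Require Import all_boot all_order all_algebra.
From mathcomp Require Import all_classical all_reals all_analysis.
From mathcomp Require Import zify ring lra.
Require Import Defs.
Set Implicit Arguments.
Unset Strict Implicit.
Unset Printing Implicit Defensive.
Import Order.TTheory GRing.Theory Num.Theory.
Local Open Scope classical_set_scope.
Local Open Scope ring_scope.

(** * Finitely supported sums and three-term recursions *)

(** The numbers are forced. Spectral flow sends L(k, i alpha/2) to L(k, (k - i) alpha/2), so M needs
    i = k/2, and W has conformal weight k/4; hence the construction is written for k = 4p, which
    makes the h_0-weights of M even and all powers of z integral. Degree 8 is where f_{-1}^n w_16,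
    of h_0-weight 16 - 2n, reaches weight 0. Then v has L_0-eigenvalue 4 + 8 = 12, which enters once
    from each half of the associativity formula, whence 24; and h_M - c/24 = 10/9 - 1/9 = 1 supplies
    the factor q. The main obstacle is the Jacobi identity. Delta functions are replaced by the
    recursion expressing multiplication by z0 = z1 - z2, which every term satisfies: two solutions
    are compared on one layer [l], plus a vanishing row or tail on each layer. Dong's lemma is
    needed for commutativity and for associativity; conjugation by exp(-z L(-1)) turns the second
    into a form of the first. The L(-1)-derivative property of I is deduced from the commutator with
    L_0, which propagates from the top vector of W. *)

Lemma subrBB (U : zmodType) (a b c d : U) : a - b - (c - d) = a - c - (b - d).
Proof.
rewrite opprB [X in _ + X]addrC addrACA; congr (_ + _).
by rewrite opprB addrC.
Qed.

Section FiniteSums.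
Variables (C : numFieldType) (N : lmodType C).
Implicit Types (s t : nat -> N).

Definition finsupp s := exists K, forall i, (K <= i)%N -> s i = 0.

(** A total operation, with value 0 when the partial sums never stabilize. It lets the sums of the
    Jacobi identity be manipulated without carrying a bound; the rules that depend on stabilization
    ask for [finsupp]. *)
Definition evsum s : N :=
  xget 0 [set v | exists K, forall k, (K <= k)%N -> \sum_(i < k) s i = v].

Lemma sum_stab s K k : (forall i, (K <= i)%N -> s i = 0) -> (K <= k)%N ->
  \sum_(i < k) s i = \sum_(i < K) s i.
Proof.
move=> sK; elim: k => [|k IHk] Kk; first by move: Kk; rewrite leqn0 => /eqP->.
move: Kk; rewrite leq_eqVlt => /orP[/eqP->//|]; rewrite ltnS => Kk.
by rewrite big_ord_recr /= IHk// sK// addr0.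
Qed.

Lemma evsumE s K k : (forall i, (K <= i)%N -> s i = 0) -> (K <= k)%N ->
  evsum s = \sum_(i < k) s i.
Proof.
move=> sK Kk; rewrite /evsum; case: xgetP => [v -> [K' K'v]|].
  rewrite -(K'v (maxn K' k)) ?leq_maxl//.
  by rewrite (sum_stab sK (leq_trans Kk (leq_maxr _ _))) (sum_stab sK Kk).
move=> /(_ (\sum_(i < k) s i)) []; exists k => k' kk'.
by rewrite (sum_stab sK (leq_trans Kk kk')) (sum_stab sK Kk).
Qed.

Lemma eq_evsum s t : s =1 t -> evsum s = evsum t.
Proof. by move=> /funext->. Qed.

Lemma finsuppD s t : finsupp s -> finsupp t -> finsupp (fun i => s i + t i).
Proof.
move=> [K sK] [L tL]; exists (maxn K L) => i; rewrite geq_max => /andP[Ki Li].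
by rewrite sK// tL// addr0.
Qed.

Lemma finsuppZ (c : nat -> C) s : finsupp s -> finsupp (fun i => c i *: s i).
Proof. by move=> [K sK]; exists K => i Ki; rewrite sK// scaler0. Qed.

Lemma finsuppcZ (c : C) s : finsupp s -> finsupp (fun i => c *: s i).
Proof. exact: finsuppZ. Qed.

Lemma finsuppS s : finsupp s -> finsupp (fun i => s i.+1).
Proof. by move=> [K sK]; exists K => i Ki; rewrite sK// ltnW. Qed.

Lemma evsumD s t : finsupp s -> finsupp t ->
  evsum (fun i => s i + t i) = evsum s + evsum t.
Proof.
move=> [K sK] [L tL]; have sKL i : (maxn K L <= i)%N -> s i = 0.
  by rewrite geq_max => /andP[Ki _]; exact: sK.
have tKL i : (maxn K L <= i)%N -> t i = 0.
  by rewrite geq_max => /andP[_]; exact: tL.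
rewrite (evsumE sKL (leqnn _)) (evsumE tKL (leqnn _)) -big_split/=.
by apply: (@evsumE _ (maxn K L)) => // i iKL; rewrite sKL// tKL// addr0.
Qed.

Lemma evsumZ (c : C) s : finsupp s -> evsum (fun i => c *: s i) = c *: evsum s.
Proof.
move=> [K sK]; rewrite (evsumE sK (leqnn _)) scaler_sumr.
by apply: (@evsumE _ K) => // i iK; rewrite sK// scaler0.
Qed.

Lemma evsumN s : finsupp s -> evsum (fun i => - s i) = - evsum s.
Proof.
move=> fs; rewrite -scaleN1r -evsumZ//.
by apply: eq_evsum => i; rewrite scaleN1r.
Qed.

Lemma evsum0 : evsum (fun=> 0) = 0.
Proof. by rewrite (@evsumE _ 0 0)// big_ord0. Qed.

Lemma evsum_recl s : finsupp s -> evsum s = s 0%N + evsum (fun i => s i.+1).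
Proof.
move=> [K sK]; rewrite (@evsumE s K K.+1)// big_ord_recl; congr (_ + _).
by rewrite (@evsumE (fun i => s i.+1) K K)// => i Ki; rewrite sK// ltnW.
Qed.

Lemma evsum1 s i0 : (forall i, i != i0 -> s i = 0) -> evsum s = s i0.
Proof.
move=> s0; rewrite (@evsumE s i0.+1 i0.+1)//; last first.
  by move=> i ii0; rewrite s0// gtn_eqF.
rewrite big_ord_recr/= big1 ?add0r// => i _.
by rewrite s0// ltn_eqF.
Qed.

End FiniteSums.

Section LinearProp.
Variables (C : numFieldType) (M N : lmodType C) (f : M -> N).
Hypothesis f_lin : linear f.

Lemma linD x y : f (x + y) = f x + f y.
Proof. by have := f_lin 1 x y; rewrite !scale1r. Qed.

Lemma lin0 : f 0 = 0.
Proof. by have := linD 0 0; rewrite addr0 => /esym/eqP; rewrite -subr_eq0 addrK => /eqP. Qed.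

Lemma linZ c x : f (c *: x) = c *: f x.
Proof. by have := f_lin c x 0; rewrite !addr0 lin0 addr0. Qed.

Lemma linN x : f (- x) = - f x.
Proof. by rewrite -scaleN1r linZ scaleN1r. Qed.

Lemma linB x y : f (x - y) = f x - f y.
Proof. by rewrite linD linN. Qed.

Lemma lin_sum I r (P : pred I) (F : I -> M) :
  f (\sum_(i <- r | P i) F i) = \sum_(i <- r | P i) f (F i).
Proof. by elim/big_rec2: _ => [|i y1 y2 _ <-]; rewrite ?lin0 ?linD. Qed.

Lemma evsum_lin s : finsupp s -> f (evsum s) = evsum (fun i => f (s i)).
Proof.
move=> [K sK]; rewrite (evsumE sK (leqnn _)) lin_sum; apply/esym.
by apply: (@evsumE _ _ _ K) => // i iK; rewrite sK// lin0.
Qed.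

End LinearProp.

Section Binomials.
Variable C : numFieldType.

Lemma binz0 m : binz C m 0 = 1.
Proof. by rewrite /binz big_ord0 fact0 divr1. Qed.

Lemma binzS (m : int) i :
  binz C (m + 1) i.+1 = binz C m i.+1 + binz C m i.
Proof.
have step (k : int) j :
    \prod_(t < j.+1) (k + 1 - t%:Z)%:~R =
    (k + 1)%:~R * \prod_(t < j) (k - t%:Z)%:~R :> C.
  rewrite big_ord_recl subr0; congr (_ * _); apply: eq_bigr => t _.
  by rewrite lift0 -addn1 PoszD opprD addrA addrAC addrK.
rewrite /binz step big_ord_recr/= factS natrM.
have f0 : (i`!)%:R != 0 :> C by rewrite pnatr_eq0 -lt0n fact_gt0.
have i0 : (i.+1)%:R != 0 :> C by rewrite pnatr_eq0.
have -> : (m - i%:Z)%:~R = (m + 1)%:~R - (i.+1)%:R :> C.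
  by rewrite -[(i.+1)%:R]/((i.+1)%:Z%:~R) -intrB; congr (_%:~R); lia.
by move: (i.+1%:R) i0 (i`!%:R) f0 => a a0 b b0; field; rewrite a0 b0.
Qed.

Lemma binz_absorb (l : int) j :
  j.+1%:R * binz C l j.+1 = l%:~R * binz C (l - 1) j.
Proof.
rewrite /binz big_ord_recl subr0 factS natrM.
rewrite [in LHS](eq_bigr (fun t : 'I_j => (l - 1 - t%:Z)%:~R)); last first.
  by move=> t _; congr (_%:~R); rewrite lift0; lia.
have f0 : (j`!)%:R != 0 :> C by rewrite pnatr_eq0 -lt0n fact_gt0.
have j0 : j.+1%:R != 0 :> C by rewrite pnatr_eq0.
by move: (j.+1%:R) j0 (j`!%:R) f0 => a a0 b b0; field; rewrite a0 b0.
Qed.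

Lemma binz0S i : binz C 0 i.+1 = 0.
Proof. by rewrite /binz big_ord_recl subrr mulr0z !mul0r. Qed.

Lemma binz1 i : binz C 1 i.+2 = 0.
Proof. by rewrite -[1]add0r binzS !binz0S addr0. Qed.

Lemma binz_1 (m : int) : binz C m 1 = m%:~R.
Proof. by rewrite /binz big_ord1 subr0 divr1. Qed.

Lemma binzN1 i : (-1) ^+ i * binz C (-1) i = 1.
Proof.
elim: i => [|i IHi]; first by rewrite expr0 binz0 mulr1.
have := binzS (-1) i; rewrite addNr binz0S => /esym/eqP.
rewrite addr_eq0 => /eqP ->.
by rewrite exprS mulN1r mulrNN.
Qed.

Lemma binzN2 i : (-1) ^+ i * binz C (-2) i = i.+1%:R.
Proof.
elim: i => [|i IHi]; first by rewrite expr0 binz0 mulr1.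
have := binzS (-2) i; rewrite (_ : -2 + 1 = -1 :> int)// => /eqP.
rewrite -subr_eq => /eqP <-.
by rewrite mulrBr binzN1 exprS -mulrA IHi mulN1r opprK [RHS]mulrSr addrC.
Qed.

End Binomials.

Lemma addz0 (n : int) : n + 0%:Z = n. Proof. exact: addr0. Qed.

Lemma subz0 (n : int) : n - 0%:Z = n. Proof. exact: subr0. Qed.

Section ThreeTerm.
Variables (C : numFieldType) (N : lmodType C).
Implicit Types (D : int -> int -> int -> N) (H K : int -> int -> N).

(** Coefficient form of z0 = z1 - z2: raising the exponent of z0 by one amounts to multiplying by z1
    - z2. Each of the three terms of the Jacobi identity satisfies it, by Pascal's rule. *)
Definition rec3 D := forall l m n : int, D (l + 1) m n = D l (m + 1) n - D l m (n + 1).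

(* The partial sums of (z1 - z2)^l H(z1, z2), expanded for |z1| > |z2|. *)
Definition half H l m n : N :=
  evsum (fun i : nat => ((-1) ^+ i * binz C l i) *: H (l + m - i%:Z) (n + i%:Z)).

(** The iterate side of the Jacobi identity, where z1^m is expanded as (z2 + z0)^m. *)
Definition lhs3 K l m n : N :=
  evsum (fun i : nat => binz C m i *: K (l + i%:Z) (m + n - i%:Z)).

Definition trunc_snd H := exists b0 : int, forall a b, b0 <= b -> H a b = 0.
Definition trunc_fst H := exists a0 : int, forall a b, a0 <= a -> H a b = 0.

Lemma int_absorb (b0 n : int) (i : nat) : (`|b0 - n| <= i)%N -> b0 <= n + i%:Z.
Proof. by lia. Qed.

Lemma half_supp H l m n : trunc_snd H ->
  finsupp (fun i : nat => H (l + m - i%:Z) (n + i%:Z)).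
Proof.
by move=> [b0 Hb]; exists `|b0 - n|%N => i ib; rewrite Hb// int_absorb.
Qed.

Lemma lhs3_supp K l m n : trunc_fst K ->
  finsupp (fun i : nat => K (l + i%:Z) (m + n - i%:Z)).
Proof.
by move=> [b0 Hb]; exists `|b0 - l|%N => i ib; rewrite Hb// int_absorb.
Qed.

Lemma half0 H m n : half H 0 m n = H m n.
Proof.
rewrite /half (@evsum1 _ _ _ 0%N); last by move=> [//|i] _; rewrite binz0S mulr0 scale0r.
by rewrite binz0 mulr1 scale1r add0r subr0 addr0.
Qed.

Lemma lhs30 K l n : lhs3 K l 0 n = K l n.
Proof.
rewrite /lhs3 (@evsum1 _ _ _ 0%N); last by move=> [//|i] _; rewrite binz0S scale0r.
by rewrite binz0 scale1r add0r subr0 addr0.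
Qed.

Lemma half_rec H : trunc_snd H -> rec3 (half H).
Proof.
move=> tH l m n; rewrite /half.
have fs l' m' n' := @finsuppZ _ _ (fun i => (-1) ^+ i * binz C l' i) _
  (half_supp l' m' n' tH).
rewrite evsum_recl; last exact: fs.
rewrite [X in _ = X - _]evsum_recl; last exact: fs.
rewrite !binz0 !mulr1 !subz0 ?addz0 (_ : l + 1 + m = l + (m + 1)); last by lia.
rewrite -[RHS]addrA; congr (_ + _).
rewrite -evsumN; last exact: fs.
rewrite -evsumD; [|exact: (finsuppS (fs l (m + 1) n))|]; last first.
  by have [K hK] := fs l m (n + 1); exists K => i /hK ->; rewrite oppr0.
apply: eq_evsum => i; rewrite binzS -scaleNr.
rewrite (_ : l + (m + 1) - i.+1%:Z = l + m - i%:Z); last by lia.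
rewrite (_ : n + i.+1%:Z = n + 1 + i%:Z); last by lia.
rewrite -scalerDl; congr (_ *: _).
by rewrite mulrDr exprS !mulN1r; congr (_ + _); rewrite mulNr.
Qed.

Lemma lhs3_rec K : trunc_fst K -> rec3 (lhs3 K).
Proof.
move=> tK l m n.
suff -> : lhs3 K l (m + 1) n = lhs3 K l m (n + 1) + lhs3 K (l + 1) m n.
  by rewrite addrAC subrr add0r.
rewrite /lhs3.
have fs l' m' n' := @finsuppZ _ _ (binz C m') _ (lhs3_supp l' m' n' tK).
rewrite evsum_recl; last exact: fs.
rewrite [X in _ = X + _]evsum_recl; last exact: fs.
rewrite !binz0 !subz0 ?addz0 (_ : m + 1 + n = m + (n + 1)); last by lia.
rewrite -[RHS]addrA; congr (_ + _).
rewrite -evsumD; [|exact: (finsuppS (fs l m (n + 1)))|exact: fs].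
apply: eq_evsum => i; rewrite binzS.
rewrite (_ : m + (n + 1) - i.+1%:Z = m + n - i%:Z); last by lia.
rewrite (_ : l + i.+1%:Z = l + 1 + i%:Z); last by lia.
by rewrite -scalerDl.
Qed.

Lemma rec3_snd D l m n : rec3 D -> D l (m + 1) n = D l m (n + 1) + D (l + 1) m n.
Proof. by move=> ->; rewrite [RHS]addrC subrK. Qed.

Lemma rec3B D D' : rec3 D -> rec3 D' -> rec3 (fun l m n => D l m n - D' l m n).
Proof.
by move=> rD rD' l m n; rewrite rD rD' subrBB.
Qed.

(* A solution vanishing on one layer is, on the layer below, a function of m + n. *)
Lemma rec3_eq0 D (l0 : int) : rec3 D -> (forall m n, D l0 m n = 0) ->
  (forall l, (exists m, forall n, D l m n = 0) \/
             (exists n0 : int, forall m n, n0 <= n -> D l m n = 0)) ->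
  forall l m n, D l m n = 0.
Proof.
move=> rD D0 hD.
have up (k : nat) m n : D (l0 + k%:Z) m n = 0.
  elim: k m n => [|k IHk] m n; first by rewrite addr0.
  by rewrite (_ : l0 + k.+1%:Z = l0 + k%:Z + 1) ?rD ?IHk ?subrr//; lia.
have step l : (forall m n, D (l + 1) m n = 0) -> forall m n, D l m n = 0.
  move=> D1.
  have shift m n : D l (m + 1) n = D l m (n + 1).
    by apply/eqP; rewrite -subr_eq0 -rD D1.
  have shiftn (k : nat) m n : D l (m + k%:Z) n = D l m (n + k%:Z).
    elim: k m n => [|k IHk] m n; first by rewrite !addr0.
    rewrite (_ : m + k.+1%:Z = m + 1 + k%:Z); last by lia.
    by rewrite IHk shift; congr D; lia.
  have shiftz (k : int) m n : D l (m + k) n = D l m (n + k).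
    case: (intP k) => [|j|j]; first by rewrite !addr0.
      exact: shiftn.
    by rewrite -[in LHS](subrK j.+1%:Z n) -shiftn; congr D; lia.
  move=> m n; case: (hD l) => [[m' m'0]|[n0 n00]].
    by rewrite (_ : m = m' + (m - m')) ?shiftz ?m'0//; lia.
  have := shiftz (n0 - n) (m + (n - n0)) n.
  rewrite (_ : m + (n - n0) + (n0 - n) = m) => [->|]; last by lia.
  by apply: n00; rewrite addrC subrK.
have down (k : nat) m n : D (l0 - k%:Z) m n = 0.
  elim: k m n => [|k IHk]; first by move=> m n; rewrite subr0.
  by apply: step => m n; rewrite (_ : _ + 1 = l0 - k%:Z) ?IHk//; lia.
move=> l m n; case: (lerP l0 l) => ll0.
  by rewrite (_ : l = l0 + `|l - l0|%N%:Z) ?up//; lia.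
by rewrite (_ : l = l0 - `|l - l0|%N%:Z) ?down//; lia.
Qed.

End ThreeTerm.

(** * The Jacobi identity and Dong's lemma *)

Section JacobiForm.
Variables (C : numFieldType) (V W M N : lmodType C).
Variables (YW : V -> int -> W -> W) (YM : V -> int -> M -> M).
Variables (YN : V -> int -> N -> N) (I : W -> int -> M -> N).

Definition jac_lhs u w x : int -> int -> int -> N :=
  lhs3 (fun a b => I (YW u a w) b x).

Definition jac_left u w x : int -> int -> int -> N :=
  half (fun a b => YN u a (I w b x)).

Definition jac_right u w x : int -> int -> int -> N :=
  fun l m n => (-1) ^ l *: half (fun a b => I w a (YM u b x)) l n m.

Definition jac u w x := forall l m n,
  jac_lhs u w x l m n = jac_left u w x l m n - jac_right u w x l m n.

Hypotheses (YWl : mode_linear YW) (YMl : mode_linear YM).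
Hypotheses (YNl : mode_linear YN) (Il : mode_linear I).
Hypotheses (YWt : mode_truncation YW) (YMt : mode_truncation YM).
Hypothesis It : mode_truncation I.

Lemma trunc_lhs u w x : trunc_fst (fun a b => I (YW u a w) b x).
Proof.
have [a0 h] := YWt u w; exists a0 => a b aa0; rewrite h//.
exact: (lin0 (Il.1 b x)).
Qed.

Lemma trunc_left u w x : trunc_snd (fun a b => YN u a (I w b x)).
Proof.
have [a0 h] := It w x; exists a0 => a b ba0; rewrite h//.
exact: (lin0 (YNl.2 u a)).
Qed.

Lemma trunc_right u w x : trunc_snd (fun a b => I w a (YM u b x)).
Proof.
have [a0 h] := YMt u x; exists a0 => a b ba0; rewrite h//.
exact: (lin0 (Il.2 w a)).
Qed.

Lemma jac_lhs_rec u w x : rec3 (jac_lhs u w x).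
Proof. exact/lhs3_rec/trunc_lhs. Qed.

Lemma jac_left_rec u w x : rec3 (jac_left u w x).
Proof. exact/half_rec/trunc_left. Qed.

Lemma jac_right_rec u w x : rec3 (jac_right u w x).
Proof.
move=> l m n; rewrite /jac_right (half_rec (trunc_right u w x)).
rewrite exprzDr ?expr1z ?unitrN1// mulrN1 scaleNr scalerBr opprB//.
Qed.

(** Truncation makes the three sums finite, so for fixed indices one bound past their supports turns
    each partial sum into the corresponding [evsum]; the same bound serves both directions. *)
Lemma jacobiP : jacobi_identity YW YM YN I <-> forall u w x, jac u w x.
Proof.
have stab (s : nat -> N) : finsupp s ->
    exists K, forall k, (K <= k)%N -> evsum s = \sum_(i < k) s i.
  by move=> [K sK]; exists K => k Kk; apply: evsumE Kk.
have st3 u w x l m n : exists K, forall k, (K <= k)%N ->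
    [/\ jac_lhs u w x l m n =
      \sum_(i < k) binz C m i *: I (YW u (l + i%:Z) w) (m + n - i%:Z) x &
    jac_left u w x l m n - jac_right u w x l m n =
    \sum_(i < k) ((-1) ^+ i * binz C l i) *:
      (YN u (l + m - i%:Z) (I w (n + i%:Z) x)
       - (-1) ^ l *: I w (l + n - i%:Z) (YM u (m + i%:Z) x))].
  have [K1 h1] := stab _ (finsuppZ (binz C m) (lhs3_supp l m n (trunc_lhs u w x))).
  have [K2 h2] := stab _ (finsuppZ (fun i => (-1) ^+ i * binz C l i)
    (half_supp l m n (trunc_left u w x))).
  have [K3 h3] := stab _ (finsuppZ (fun i => (-1) ^+ i * binz C l i)
    (half_supp l n m (trunc_right u w x))).
  exists (maxn K1 (maxn K2 K3)) => k; rewrite !geq_max => /and3P[k1 k2 k3].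
  split; first by rewrite /jac_lhs/lhs3 (h1 k k1).
  rewrite /jac_left /jac_right /half (h2 k k2) (h3 k k3) scaler_sumr -sumrB.
  by apply: eq_bigr => i _; rewrite scalerBr; congr (_ - _); rewrite !scalerA mulrC.
split=> [J u w x l m n|J u w x l m n].
  have [K h] := st3 u w x l m n; have [K0 h0] := J u w x l m n.
  have [-> ->] := h _ (leq_maxl K K0).
  exact: h0 (leq_maxr _ _).
have [K h] := st3 u w x l m n; exists K => k /h[<- <-].
exact: J.
Qed.

End JacobiForm.

Section Dong.
Variables (C : numFieldType) (V P Q : lmodType C) (eps : C).
Variables (YV : V -> int -> V -> V) (YP : V -> int -> P -> P).
Variables (YQ : V -> int -> Q -> Q) (Theta : int -> P -> Q).

(** Multiplication by z1 + eps z2. The value eps = -1 gives ordinary locality; eps = 1 gives the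
    locality that associativity becomes after conjugation by exp(-z L(-1)). One proof of Dong's
    lemma covers both. *)
Definition dif (f : int -> int -> Q) : int -> int -> Q :=
  fun a n => f (a + 1) n + eps *: f a (n + 1).

Definition defect u p : int -> int -> Q :=
  fun a n => Theta n (YP u a p) - YQ u a (Theta n p).

(** The exponent is uniform in [p]: in the product argument the condition on one vector is applied
    to [YP v b p], which varies with the mode [b] of the other. *)
Definition local_op u :=
  exists m, forall p a n, iter m dif (defect u p) a n = 0.

Definition dif1 (G : int -> int -> int -> Q) : int -> int -> int -> Q :=
  fun a b n => G (a + 1) b n + eps *: G a b (n + 1).

Definition dif2 (G : int -> int -> int -> Q) : int -> int -> int -> Q :=
  fun a b n => G a (b + 1) n + eps *: G a b (n + 1).

Definition swap3 (G : int -> int -> int -> Q) : int -> int -> int -> Q :=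
  fun a b n => G b a n.

Definition add3 (G H : int -> int -> int -> Q) : int -> int -> int -> Q :=
  fun a b n => G a b n + H a b n.

Definition zero3 : int -> int -> int -> Q := fun _ _ _ => 0.

Lemma fun3_eq (G H : int -> int -> int -> Q) :
  (forall a b n, G a b n = H a b n) -> G = H.
Proof. by move=> GH; apply/funext => a; apply/funext => b; apply/funext. Qed.

Lemma dif_zero m : iter m dif (fun _ _ => 0) = (fun _ _ => 0).
Proof.
elim: m => //= m ->; apply/funext => a; apply/funext => n.
by rewrite /dif scaler0 addr0.
Qed.

Lemma dif1_zero m : iter m dif1 zero3 = zero3.
Proof. by elim: m => //= m ->; apply: fun3_eq => a b n; rewrite /dif1 scaler0 addr0. Qed.

Lemma dif2_zero m : iter m dif2 zero3 = zero3.
Proof. by elim: m => //= m ->; apply: fun3_eq => a b n; rewrite /dif2 scaler0 addr0. Qed.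

Lemma dif12C G : dif1 (dif2 G) = dif2 (dif1 G).
Proof.
by apply: fun3_eq => a b n; rewrite /dif1 /dif2 !scalerDr addrACA.
Qed.

Lemma dif1_iter2 m G : dif1 (iter m dif2 G) = iter m dif2 (dif1 G).
Proof. by elim: m => //= m IHm; rewrite dif12C IHm. Qed.

Lemma iter_dif12 m1 m2 G :
  iter m1 dif1 (iter m2 dif2 G) = iter m2 dif2 (iter m1 dif1 G).
Proof. by elim: m1 => //= m1 ->; rewrite dif1_iter2. Qed.

Lemma dif1D G H : dif1 (add3 G H) = add3 (dif1 G) (dif1 H).
Proof. by apply: fun3_eq => a b n; rewrite /dif1 /add3 scalerDr addrACA. Qed.

Lemma dif2D G H : dif2 (add3 G H) = add3 (dif2 G) (dif2 H).
Proof. by apply: fun3_eq => a b n; rewrite /dif2 /add3 scalerDr addrACA. Qed.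

Lemma iter_dif1D m G H :
  iter m dif1 (add3 G H) = add3 (iter m dif1 G) (iter m dif1 H).
Proof. by elim: m => //= m ->; rewrite dif1D. Qed.

Lemma iter_dif2D m G H :
  iter m dif2 (add3 G H) = add3 (iter m dif2 G) (iter m dif2 H).
Proof. by elim: m => //= m ->; rewrite dif2D. Qed.

Lemma dif_swap m1 m2 G : iter m1 dif1 (iter m2 dif2 (swap3 G)) =
  swap3 (iter m1 dif2 (iter m2 dif1 G)).
Proof.
have -> : iter m2 dif2 (swap3 G) = swap3 (iter m2 dif1 G) by elim: m2 => //= m ->.
by elim: m1 => //= m ->.
Qed.

Definition trunc3 (E : int -> int -> int -> Q) :=
  forall n, trunc_snd (fun a b => E a b n).

Definition half3 (q : int) (E : int -> int -> int -> Q) : int -> int -> int -> Q :=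
  fun a b n => half (fun a b => E a b n) q a b.

Lemma trunc3_dif1 E : trunc3 E -> trunc3 (dif1 E).
Proof.
move=> tE n; have [b1 h1] := tE n; have [b2 h2] := tE (n + 1).
exists (Num.max b1 b2) => a b; rewrite ge_max => /andP[bb1 bb2].
by rewrite /dif1 h1// h2// scaler0 addr0.
Qed.

Lemma trunc3_dif2 E : trunc3 E -> trunc3 (dif2 E).
Proof.
move=> tE n; have [b1 h1] := tE n; have [b2 h2] := tE (n + 1).
exists (Num.max b1 b2) => a b; rewrite ge_max => /andP[bb1 bb2].
by rewrite /dif2 h1 ?h2// ?scaler0 ?addr0// (le_trans bb1)// lerDl.
Qed.

Lemma half_lin (c : C) (H H' : int -> int -> Q) (l m n : int) :
  trunc_snd H -> trunc_snd H' ->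
  half (fun a b => H a b + c *: H' a b) l m n = half H l m n + c *: half H' l m n.
Proof.
move=> tH tH'; rewrite /half.
have fs G : trunc_snd G -> finsupp (fun i : nat =>
    ((-1) ^+ i * binz C l i) *: (G (l + m - i%:Z) (n + i%:Z) : Q)).
  by move=> tG; exact: (finsuppZ _ (half_supp _ _ _ tG)).
rewrite -evsumZ; last exact: (fs _ tH').
rewrite -evsumD; [|exact: (fs _ tH)|exact: (finsuppcZ c (fs _ tH'))].
by apply: eq_evsum => i; rewrite scalerDr; congr (_ + _); rewrite !scalerA mulrC.
Qed.

Lemma half3_dif1 q E : trunc3 E -> half3 q (dif1 E) = dif1 (half3 q E).
Proof.
move=> tE; apply: fun3_eq => a b n; rewrite /half3 /dif1 half_lin//; last first.
  by have [b0 h] := tE n; exists b0 => a' b' /h ->.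
by rewrite /half; congr (_ + _); apply: eq_evsum => i; congr (_ *: E _ _ _); lia.
Qed.

Lemma half3_dif2 q E : trunc3 E -> half3 q (dif2 E) = dif2 (half3 q E).
Proof.
move=> tE; apply: fun3_eq => a b n; rewrite /half3 /dif2 half_lin//; last first.
  have [b0 h] := tE n; exists b0 => a' b' bb'.
  by rewrite h// (le_trans bb')// lerDl.
by rewrite /half; congr (_ + _); apply: eq_evsum => i; congr (_ *: E _ _ _); lia.
Qed.

Lemma half3_iter q m1 m2 E : trunc3 E ->
  iter m1 dif1 (iter m2 dif2 (half3 q E)) = half3 q (iter m1 dif1 (iter m2 dif2 E)).
Proof.
move=> tE; have t2 : trunc3 (iter m2 dif2 E) by elim: m2 => //= m; exact: trunc3_dif2.
have -> : iter m2 dif2 (half3 q E) = half3 q (iter m2 dif2 E).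
  elim: m2 t2 => //= m IHm t2; rewrite IHm ?half3_dif2//;
  by elim: m {IHm t2} => //= m; exact: trunc3_dif2.
move: (iter m2 dif2 E) t2 => {tE} E tE.
elim: m1 => //= m IHm; rewrite IHm half3_dif1//.
by elim: m {IHm} => //= m; exact: trunc3_dif1.
Qed.

Lemma half3_zero q : half3 q zero3 = zero3.
Proof.
apply: fun3_eq => a b n; rewrite /half3 /half.
by under eq_evsum do rewrite scaler0; rewrite evsum0.
Qed.

Hypotheses (YVl : mode_linear YV) (YPl : mode_linear YP) (YQl : mode_linear YQ).
Hypotheses (YVt : mode_truncation YV) (YPt : mode_truncation YP).
Hypothesis YQt : mode_truncation YQ.
Hypothesis YPj : forall u v p, jac YV YP YP YP u v p.
Hypothesis YQj : forall u v p, jac YV YQ YQ YQ u v p.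
Hypothesis Theta_lin : forall n, linear (Theta n).

Section Product.
Variables u1 u2 : V.

Definition comm_prod u v p : int -> int -> int -> Q :=
  fun a b n => Theta n (YP u a (YP v b p)) - YQ u a (YQ v b (Theta n p)).

Lemma comm_prod_trunc u v p : trunc3 (comm_prod u v p).
Proof.
move=> n; have [b1 h1] := YPt v p; have [b2 h2] := YQt v (Theta n p).
exists (Num.max b1 b2) => a b; rewrite ge_max => /andP[bb1 bb2].
rewrite /comm_prod h1// h2// (lin0 (YPl.2 u a)) (lin0 (YQl.2 u a)).
by rewrite (lin0 (Theta_lin n)) subrr.
Qed.

(** Leibniz rule: the defect of u_a v_b is the defect of u_a on v_b p plus u_a applied to the defect
    of v_b. Powers of z1 + eps z3 kill the first term and powers of z2 + eps z3 the second, and the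
    two multiplications commute. *)
Lemma comm_prod_kill u v p m1 m2 :
  (forall p a n, iter m1 dif (defect u p) a n = 0) ->
  (forall p a n, iter m2 dif (defect v p) a n = 0) ->
  iter m1 dif1 (iter m2 dif2 (comm_prod u v p)) = zero3.
Proof.
move=> h1 h2.
have -> : comm_prod u v p =
    add3 (fun a b n => defect u (YP v b p) a n) (fun a b n => YQ u a (defect v p b n)).
  apply: fun3_eq => a b n; rewrite /comm_prod /add3 /defect (linB (YQl.2 u a)).
  by rewrite addrA subrK.
rewrite iter_dif2D iter_dif1D.
have -> : iter m2 dif2 (fun a b n => YQ u a (defect v p b n)) = zero3.
  suff -> : iter m2 dif2 (fun a b n => YQ u a (defect v p b n)) =
      fun a b n => YQ u a (iter m2 dif (defect v p) b n).
    by apply: fun3_eq => a b n; rewrite h2 (lin0 (YQl.2 u a)).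
  elim: m2 {h2} => //= m ->; apply: fun3_eq => a b n.
  by rewrite /dif2 /dif (linD (YQl.2 u a)) (linZ (YQl.2 u a)).
rewrite dif1_zero iter_dif12.
have -> : iter m1 dif1 (fun a b n => defect u (YP v b p) a n) = zero3.
  suff -> : iter m1 dif1 (fun a b n => defect u (YP v b p) a n) =
      fun a b n => iter m1 dif (defect u (YP v b p)) a n.
    by apply: fun3_eq => a b n; rewrite h1.
  by elim: m1 {h1} => //= m ->.
by rewrite dif2_zero; apply: fun3_eq => a b n; rewrite /add3 addr0.
Qed.

(** For [a = 0] this is the defect of the product u1_(q) u2. The extra index [a] carries powers of
    z1 = z2 + z0, which gives the factors z1 + eps z3 something to act on. *)
Definition prod_defect p q : int -> int -> int -> Q := fun a b n =>
  Theta n (jac_lhs YV YP u1 u2 p q a b) - jac_lhs YV YQ u1 u2 (Theta n p) q a b.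

Lemma prod_defect0 p q b n :
  prod_defect p q 0 b n = defect (YV u1 q u2) p b n.
Proof. by rewrite /prod_defect /jac_lhs !lhs30. Qed.

(** This is z1 + eps z3 = (z2 + eps z3) + z0, where multiplication by z0 raises [q]. *)
Lemma prod_defect_rec p q :
  dif1 (prod_defect p q) = add3 (dif2 (prod_defect p q)) (prod_defect p (q + 1)).
Proof.
apply: fun3_eq => a b n; rewrite /dif1 /dif2 /add3.
rewrite [RHS]addrAC; congr (_ + _); rewrite /prod_defect.
rewrite (rec3_snd _ _ _ (jac_lhs_rec YPl YVt u1 u2 p)).
rewrite (rec3_snd _ _ _ (jac_lhs_rec YQl YVt u1 u2 (Theta n p))).
by rewrite (linD (Theta_lin n)) opprD addrACA.
Qed.

(** The Jacobi identities on P and on Q rewrite the product as the two expansions of (z1 - z2)^q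
    applied to u1 u2 and to u2 u1, to which [comm_prod_kill] applies. *)
Lemma prod_defect_half p q : prod_defect p q =
  add3 (half3 q (comm_prod u1 u2 p))
       (swap3 (fun a b n => - (-1) ^ q *: half3 q (comm_prod u2 u1 p) a b n)).
Proof.
apply: fun3_eq => a b n; rewrite /prod_defect YPj YQj /add3 /swap3.
have key u v a' b' : half3 q (comm_prod u v p) a' b' n =
    Theta n (half (fun a b => YP u a (YP v b p)) q a' b') -
    half (fun a b => YQ u a (YQ v b (Theta n p))) q a' b'.
  have t1 : trunc_snd (fun a b => YP u a (YP v b p)).
    exact: (trunc_left YPl YPt).
  have t2 : trunc_snd (fun a b => YQ u a (YQ v b (Theta n p))).
    exact: (trunc_left YQl YQt).
  have fs1 := finsuppZ (fun i => (-1) ^+ i * binz C q i) (half_supp q a' b' t1).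
  have fs2 := finsuppZ (fun i => (-1) ^+ i * binz C q i) (half_supp q a' b' t2).
  rewrite /half (evsum_lin (Theta_lin n) fs1) -(evsumN fs2) -evsumD.
  - by apply: eq_evsum => i; rewrite (linZ (Theta_lin n)) -scalerN -scalerDr.
  - by have [K h] := fs1; exists K => i /h ->; rewrite (lin0 (Theta_lin n)).
  - by have [K h] := fs2; exists K => i /h ->; rewrite oppr0.
rewrite !key /jac_left /jac_right (linB (Theta_lin n)) (linZ (Theta_lin n)).
by rewrite subrBB scaleNr scalerBr.
Qed.

(** Descending induction on [q] from the range where u1_(q) u2 = 0. Once a power of z2 + eps z3
    kills the coefficient [q + 1], the factors z1 + eps z3 and z2 + eps z3 act alike on what remains
    of coefficient [q]; the m1 factors of the first kind are traded for m1 of the second. *)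
Lemma local_op_prod q : local_op u1 -> local_op u2 -> local_op (YV u1 q u2).
Proof.
move=> [m1 h1] [m2 h2].
have kill p r : iter m1 dif1 (iter m2 dif2 (prod_defect p r)) = zero3.
  rewrite prod_defect_half iter_dif2D iter_dif1D half3_iter; last exact: comm_prod_trunc.
  rewrite comm_prod_kill// half3_zero dif_swap.
  have -> : iter m2 dif1 (fun a b n => - (-1) ^ r *: half3 r (comm_prod u2 u1 p) a b n) =
     fun a b n => - (-1) ^ r *: iter m2 dif1 (half3 r (comm_prod u2 u1 p)) a b n.
    elim: (m2) => //= m ->; apply: fun3_eq => a b n.
    by rewrite /dif1 scalerDr !scalerA mulrC.
  have -> (G : int -> int -> int -> Q) (c : C) :
     iter m1 dif2 (fun a b n => c *: G a b n) = fun a b n => c *: iter m1 dif2 G a b n.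
    elim: (m1) => //= m ->; apply: fun3_eq => a b n.
    by rewrite /dif2 scalerDr !scalerA mulrC.
  rewrite -iter_dif12 half3_iter; last exact: comm_prod_trunc.
  rewrite comm_prod_kill// half3_zero.
  by apply: fun3_eq => a b n; rewrite /add3 /swap3 scaler0 addr0.
have [q0 hq0] := YVt u1 u2.
have top r p : q0 <= r -> prod_defect p r = zero3.
  move=> q0r; apply: fun3_eq => a b n; rewrite /prod_defect /jac_lhs /lhs3.
  under eq_evsum => i.
    rewrite hq0; last by rewrite (le_trans q0r)// lerDl.
    rewrite (lin0 (YPl.1 _ _)) scaler0; over.
  under [X in _ - X]eq_evsum => i.
    rewrite hq0; last by rewrite (le_trans q0r)// lerDl.
    rewrite (lin0 (YQl.1 _ _)) scaler0; over.
  by rewrite !evsum0 (lin0 (Theta_lin n)) subr0.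
have main (k : nat) : exists m, forall p, iter m dif2 (prod_defect p (q0 - k%:Z)) = zero3.
  elim: k => [|k [m hm]]; first by exists 0%N => p; rewrite subr0/= top.
  exists (m1 + (m2 + m))%N => p; set r := q0 - k.+1%:Z.
  have r1 : r + 1 = q0 - k%:Z by rewrite /r; lia.
  have step j : iter j dif1 (iter (m2 + m) dif2 (prod_defect p r)) =
                iter (j + (m2 + m)) dif2 (prod_defect p r).
    elim: j => [//|j IHj]; rewrite iterS IHj dif1_iter2 prod_defect_rec iter_dif2D r1.
    rewrite -iterSr addSn addnA iterD hm dif2_zero.
    by apply: fun3_eq => a b n; rewrite /add3 addr0.
  by rewrite -step (addnC m2) iterD iter_dif12 kill dif2_zero.
have [m hm] : exists m, forall p, iter m dif2 (prod_defect p q) = zero3.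
  case: (lerP q0 q) => qq0; first by exists 0%N => p; rewrite /= top.
  have [m hm] := main `|q0 - q|%N; exists m => p; rewrite -[RHS](hm p).
  by congr (iter m dif2 (prod_defect p _)); lia.
exists m => p a n; have <- : iter m dif2 (prod_defect p q) 0 a n =
    iter m dif (defect (YV u1 q u2) p) a n.
  elim: m {hm} a n => [|m IHm] a n; first by rewrite /= prod_defect0.
  by rewrite /= /dif2 /dif !IHm.
by rewrite hm.
Qed.

End Product.
End Dong.

(** * Conjugation of modes by exp(-z L(-1)) *)

Section Exponential.
Variables (C : numFieldType) (N : lmodType C) (L : N -> N).
Hypothesis L_lin : linear L.

Definition divpow i (x : N) : N := (i`!%:R : C)^-1 *: iter i L x.

Lemma divpow_lin i : linear (divpow i).
Proof.
have it c x y : iter i L (c *: x + y) = c *: iter i L x + iter i L y.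
  by elim: i => //= i ->; rewrite L_lin.
by move=> c x y; rewrite /divpow it scalerDr !scalerA mulrC.
Qed.

Lemma divpow0 x : divpow 0 x = x.
Proof. by rewrite /divpow fact0 invr1 scale1r. Qed.

Lemma divpowS i x : i.+1%:R *: divpow i.+1 x = L (divpow i x).
Proof.
rewrite /divpow (linZ L_lin) scalerA factS natrM invfM mulrA mulfV ?mul1r//.
Qed.

Opaque divpow.

(* The coefficients of exp(- z L) applied to a series with coefficients f. *)
Definition expL (f : int -> N) (n : int) : N :=
  evsum (fun i : nat => (-1) ^+ i *: divpow i (f (n + i%:Z))).

Definition trunc_above (f : int -> N) := exists n0 : int, forall n, n0 <= n -> f n = 0.

Lemma expL_supp f n : trunc_above f ->
  finsupp (fun i : nat => (-1) ^+ i *: divpow i (f (n + i%:Z))).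
Proof.
move=> [n0 h]; exists `|n0 - n|%N => i ib.
by rewrite h ?int_absorb// (lin0 (divpow_lin i)) scaler0.
Qed.

Lemma expL_linear (c : C) f g n : trunc_above f -> trunc_above g ->
  expL (fun n => c *: f n + g n) n = c *: expL f n + expL g n.
Proof.
move=> tf tg; rewrite /expL -evsumZ; last exact: expL_supp.
rewrite -evsumD; [|exact: (finsuppcZ c (expL_supp n tf))|exact: expL_supp].
apply: eq_evsum => i; rewrite divpow_lin scalerDr.
by congr (_ + _); rewrite !scalerA (mulrC c).
Qed.

(** Triangularity: coefficient [n] of exp(-z L) f is [f n] plus images of higher coefficients, so
    vanishing descends from the range where [f] is already zero. *)
Lemma expL_inj f : trunc_above f -> (forall n, expL f n = 0) -> forall n, f n = 0.
Proof.
move=> tf f0; have [n0 h] := tf.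
have main (k : nat) n : n0 - k%:Z <= n -> f n = 0.
  elim: k n => [|k IHk] n; first by rewrite subr0; exact: h.
  move=> nk; have := f0 n; rewrite /expL (@evsum1 _ _ _ 0%N).
    by rewrite expr0 scale1r divpow0 addz0.
  case=> // i _; rewrite IHk ?(lin0 (divpow_lin _)) ?scaler0//.
  by move: nk; lia.
by move=> n; apply: (main `|n0 - n|%N); lia.
Qed.

Section Conjugation.
Variable V : lmodType C.
Variable YN : V -> int -> N -> N.
Hypothesis YNl : mode_linear YN.
Hypothesis YNt : mode_truncation YN.
Variable u : V.
Hypothesis L_mode : forall l x, YN u l (L x) = L (YN u l x) + l%:~R *: YN u (l - 1) x.

Lemma mode_divpow l i x : YN u l (divpow i x) =
  \sum_(j < i.+1) binz C l j *: divpow (i - j)%N (YN u (l - j%:Z) x).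
Proof.
elim: i l x => [|i IHi] l x.
  by rewrite big_ord1 /= subn0 !divpow0 binz0 scale1r subz0.
have i1 : i.+1%:R != 0 :> C by rewrite pnatr_eq0.
apply: (scalerI i1); rewrite -(linZ (YNl.2 u l)) divpowS L_mode !IHi.
rewrite (lin_sum L_lin) scaler_sumr.
under eq_bigr => j _.
  rewrite (linZ L_lin) -divpowS scalerA (_ : (i - j).+1 = (i.+1 - j)%N); last first.
    by rewrite subSn// -ltnS.
  over.
rewrite scaler_sumr [RHS]big_ord_recr/= subnn.
rewrite [X in _ + X = _](_ : _ = \sum_(j < i.+1)
  (j.+1%:R * binz C l j.+1) *: divpow (i - j)%N (YN u (l - j.+1%:Z) x)); last first.
  apply: eq_bigr => j _; rewrite scalerA; congr (_ *: divpow _ (YN u _ x)).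
    by rewrite binz_absorb.
  by lia.
rewrite [X in _ + X = _]big_ord_recr/= subnn.
rewrite addrA; congr (_ + _); last by rewrite -scalerA.
rewrite [X in X + _ = _]big_ord_recl/= [RHS]big_ord_recl/= -addrA; congr (_ + _).
  by rewrite subn0 [RHS]scalerA mulrC.
rewrite -big_split/=; apply: eq_bigr => j _.
rewrite /bump/= !add1n subSS [RHS]scalerA -scalerDl; congr (_ *: _).
rewrite mulrC -mulrDl; congr (_ * _).
by rewrite -natrD; congr (_%:R); have := ltn_ord j; lia.
Qed.

(** Since [u_l, L] = l u_{l-1}, moving u(z1) past exp(-z2 L) translates its variable: the weight
    z1^l of the mode u_l becomes (z1 - z2)^l, which is the expression computed by [half]. *)
Lemma mode_expL f l n : trunc_above f ->
  YN u l (expL f n) = expL (fun n => half (fun a b => YN u a (f b)) l 0 n) n.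
Proof.
move=> tf; have [n0 h] := tf.
pose K := `|n0 - n|%N.
have fz i : (K <= i)%N -> f (n + i%:Z) = 0 by move=> Ki; rewrite h ?int_absorb.
rewrite /expL (evsumE (K := K) (k := K))//; last first.
  by move=> i Ki; rewrite fz// (lin0 (divpow_lin i)) scaler0.
have fsK i l' : (K - i <= l')%N -> f (n + i%:Z + l'%:Z) = 0.
  by move=> hl; rewrite -addrA -PoszD fz//; lia.
rewrite (lin_sum (YNl.2 u l)) (evsumE (K := K) (k := K))//; last first.
  move=> i Ki; rewrite /half (_ : evsum _ = 0) ?(lin0 (divpow_lin _)) ?scaler0//.
  rewrite -[RHS](evsum0 N); apply: eq_evsum => j.
  by rewrite fsK ?(lin0 (YNl.2 u _)) ?scaler0//; lia.
under [RHS]eq_bigr => i _.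
  rewrite /half (evsumE (K := K) (k := K))//; last first.
    by move=> j Kj; rewrite fsK ?(lin0 (YNl.2 u _)) ?scaler0//; lia.
  rewrite (lin_sum (divpow_lin i)) scaler_sumr.
  over.
under [LHS]eq_bigr => i _.
  rewrite (linZ (YNl.2 u l)) mode_divpow scaler_sumr.
  over.
pose T (k j : nat) := ((-1) ^+ (k + j) * binz C l j) *:
   divpow k (YN u (l - j%:Z) (f (n + (k + j)%N%:Z))).
(* Both sides become sums of [T k j] with [k = i - j]. One runs over a triangle and the other over a
   square, whose additional terms vanish by truncation of [f]. *)
transitivity (\sum_(i < K) \sum_(j < K | (j <= i)%N) T (i - j)%N j).
  apply: eq_bigr => i _.
  rewrite (big_ord_widen_cond K predT (fun j => (-1) ^+ i *: (binz C l j *: divpow (i - j) (YN u (l - Posz j) (f (n + Posz i))))))//=.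
  apply: eq_big => [j|j ji]; first by rewrite ltnS.
  by rewrite /T scalerA subnK.
rewrite (exchange_big_dep predT)//= [RHS](exchange_big_dep predT)//=.
apply: eq_bigr => j _.
rewrite (big_mkcond (fun i : 'I_K => (j <= i)%N)).
have jK : (j <= K)%N by exact: ltnW.
rewrite -(big_mkord predT (fun i => if (j <= i)%N then T (i - j)%N j else 0)).
rewrite (big_cat_nat (leq0n j) jK)/= big_nat_cond big1 ?add0r; last first.
  by move=> i /andP[/andP[_ ij] _]; rewrite leqNgt ij.
rewrite -{1}[nat_of_ord j]add0n big_addn big_mkord.
rewrite [RHS](bigID (fun i : 'I_K => (i < K - j)%N))/= [X in _ = _ + X]big1 ?addr0; last first.
  move=> i; rewrite -leqNgt => hi.
  by rewrite fsK ?(lin0 (YNl.2 u _)) ?scaler0 ?(lin0 (divpow_lin _)) ?scaler0//; lia.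
rewrite -(@big_ord_widen _ _ _ (K - j)%N K (fun i : nat => (-1) ^+ i *: divpow i (((-1) ^+ j * binz C l j) *:
   YN u (l - j%:Z) (f (n + i%:Z + j%:Z))))); last by rewrite leq_subr.
apply: eq_bigr => i _; rewrite leq_addl addnK /T (linZ (divpow_lin i)).
by rewrite [RHS]scalerA exprD -mulrA PoszD addrA.
Qed.

End Conjugation.
End Exponential.
Transparent divpow.

(** * The Jacobi identity from commutativity and associativity *)

Section Generation.
Variables (C : numFieldType) (V W M N : lmodType C).
Variables (YV : V -> int -> V -> V) (YW : V -> int -> W -> W).
Variables (YM : V -> int -> M -> M) (YN : V -> int -> N -> N).
Variables (I : W -> int -> M -> N) (L : N -> N).
Hypotheses (YVl : mode_linear YV) (YWl : mode_linear YW) (YMl : mode_linear YM).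
Hypotheses (YNl : mode_linear YN) (Il : mode_linear I) (L_lin : linear L).
Hypotheses (YVt : mode_truncation YV) (YWt : mode_truncation YW).
Hypotheses (YMt : mode_truncation YM) (YNt : mode_truncation YN).
Hypothesis It : mode_truncation I.
Hypothesis YWj : forall u v x, jac YV YW YW YW u v x.
Hypothesis YMj : forall u v x, jac YV YM YM YM u v x.
Hypothesis YNj : forall u v x, jac YV YN YN YN u v x.
Hypothesis L_mode : forall u l x,
  YN u l (L x) = L (YN u l x) + l%:~R *: YN u (l - 1) x.

(** Skew symmetry: exp(-z L(-1)) I(w, z) x, viewed as an operator acting on [w] with [x] fixed.
    Associativity of [I] is locality of this operator. *)
Definition expI (x : M) (n : int) (w : W) : N := expL L (fun n => I w n x) n.

Lemma expI_lin x n : linear (expI x n).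
Proof.
move=> c w w'; rewrite /expI -(expL_linear L_lin); [|exact: It|exact: It].
by congr expL; apply/funext => k; rewrite (Il.1 k x).
Qed.

Definition diff3 u w x : int -> int -> int -> N := fun l m n =>
  jac_lhs YW I u w x l m n - jac_left YN I u w x l m n.

Lemma diff3_rec u w x : rec3 (diff3 u w x).
Proof.
by apply: rec3B; [exact: (jac_lhs_rec Il YWt)|exact: (jac_left_rec YNl It)].
Qed.

Lemma diff3_trunc u w x l m : trunc_above (diff3 u w x l m).
Proof.
have [n1 h1] := trunc_left YNl It u w x.
have [K hK] := lhs3_supp l m 0 (trunc_lhs Il YWt u w x).
have [a0 ha] := YWt u w.
have [n2 h2] : exists n2 : int, forall n (i : nat), n2 <= n ->
    I (YW u (l + i%:Z) w) (m + n - i%:Z) x = 0.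
  pose A := `|a0 - l|%N.
  have [n2 h2] : exists n2 : int, forall n (i : nat), (i < A)%N -> n2 <= n ->
      I (YW u (l + i%:Z) w) (m + n - i%:Z) x = 0.
    elim: A => [|A [n2 h2]]; first by exists 0.
    have [n3 h3] := It (YW u (l + A%:Z) w) x.
    exists (Num.max n2 (n3 - m + A%:Z)) => n i.
    rewrite ltnS leq_eqVlt ge_max => /orP[/eqP->|iA] /andP[n2n n3n].
      by apply: h3; move: n3n; lia.
    exact: h2.
  exists n2 => n i n2n; have [iA|iA] := ltnP i A; first exact: h2.
  by rewrite ha ?(lin0 (Il.1 _ _))// int_absorb.
exists (Num.max n1 n2) => n; rewrite ge_max => /andP[n1n n2n].
rewrite /diff3 /jac_lhs /jac_left /lhs3 /half.
under eq_evsum => i do rewrite h2// scaler0.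
under [X in _ - X]eq_evsum => i.
  rewrite h1; last by rewrite (le_trans n1n)// lerDl.
  rewrite scaler0; over.
by rewrite !evsum0 subr0.
Qed.

(** On the W side the variable of [u] is z0, so z0 + z2 is the variable z1 on the N side: each
    factor [dif 1] raises the exponent [m] of z1 by one. *)
Lemma iter_dif_diff3 u w x (m : nat) l n :
  iter m (dif 1) (defect YW YN (expI x) u w) l n = expL L (diff3 u w x l m%:Z) n.
Proof.
elim: m l n => [|m IHm] l n /=.
  rewrite /defect /expI (mode_expL L_lin YNl (L_mode u)); last exact: It.
  rewrite -scaleN1r addrC -(expL_linear L_lin); last 2 first.
  - have [n1 h1] := trunc_left YNl It u w x; exists n1 => k n1k.
    rewrite /half -[RHS](evsum0 N); apply: eq_evsum => i.
    by rewrite h1 ?scaler0// (le_trans n1k)// lerDl.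
  - exact: It.
  congr expL; apply/funext => k; rewrite /diff3 /jac_lhs lhs30 addrC.
  by rewrite scaleN1r.
rewrite /dif !IHm scale1r.
have -> : expL L (diff3 u w x l m%:Z) (n + 1) =
    expL L (fun n => diff3 u w x l m%:Z (n + 1)) n.
  by rewrite /expL; apply: eq_evsum => i; congr (_ *: divpow L i (diff3 _ _ _ _ _ _)); lia.
rewrite -[X in X + _]scale1r -(expL_linear L_lin); last 2 first.
- exact: diff3_trunc.
- by have [n0 h] := diff3_trunc u w x l m%:Z; exists n0 => k nk; rewrite h// (le_trans nk)// lerDl.
congr expL; apply/funext => k.
rewrite scale1r addrC -(rec3_snd _ _ _ (@diff3_rec u w x)).
by congr diff3; lia.
Qed.

Definition comm3 u w x : int -> int -> int -> N := fun l m n =>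
  jac_left YN I u w x l m n - jac_right YM I u w x l m n.

Lemma comm3_rec u w x : rec3 (comm3 u w x).
Proof.
by apply: rec3B; [exact: (jac_left_rec YNl It)|exact: (jac_right_rec Il YMt)].
Qed.

Lemma iter_dif_comm3 u w x (l : nat) m n :
  iter l (dif (-1)) (defect YM YN (I w) u x) m n = - comm3 u w x l%:Z m n.
Proof.
elim: l m n => [|l IHl] m n /=.
  by rewrite /comm3 /jac_left /jac_right !half0 expr0z scale1r opprB.
rewrite /dif !IHl scaleN1r opprK (_ : l.+1%:Z = l%:Z + 1); last by lia.
by rewrite [in RHS](@comm3_rec u w x) [RHS]opprD [in RHS]opprK.
Qed.

Definition jac_at u := forall w x, jac YW YM YN I u w x.

Lemma jac_local_left u w : jac_at u -> local_op (-1) YM YN (I w) u.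
Proof.
move=> J; have [l0 hl] := YWt u w; exists `|l0|%N => x m n.
rewrite iter_dif_comm3 /comm3 -J /jac_lhs /lhs3.
under eq_evsum => i.
  rewrite hl ?(lin0 (Il.1 _ _)) ?scaler0; last by lia.
  over.
by rewrite evsum0 oppr0.
Qed.

Lemma jac_local_right u x : jac_at u -> local_op 1 YW YN (expI x) u.
Proof.
move=> J; have [m0 hm] := YMt u x; exists `|m0|%N => w l n.
rewrite iter_dif_diff3 -[RHS](evsum0 N); apply: eq_evsum => i.
suff -> : diff3 u w x l `|m0|%N (n + i%:Z) = 0 by rewrite (lin0 (divpow_lin L_lin i)) scaler0.
rewrite /diff3 J addrAC subrr add0r /jac_right /half.
under eq_evsum => j.
  rewrite hm ?(lin0 (Il.2 _ _)) ?scaler0; last by lia.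
  over.
by rewrite evsum0 scaler0 oppr0.
Qed.

(** Commutativity annihilates the whole layer [l1 + |l2|] of the difference of the two sides.
    Associativity, after [expL_inj], annihilates on every layer the row [m1 + |m2|], where the right
    term also vanishes. [rec3_eq0] then gives all coefficients. *)
Lemma local_jac u : (forall w, local_op (-1) YM YN (I w) u) ->
  (forall x, local_op 1 YW YN (expI x) u) -> jac_at u.
Proof.
move=> locM locW w x l m n; apply/eqP; rewrite -subr_eq0; apply/eqP.
pose D l m n := jac_lhs YW I u w x l m n - comm3 u w x l m n.
rewrite -[LHS]/(D l m n).
have recD : rec3 D.
  by apply: rec3B; [exact: (jac_lhs_rec Il YWt)|exact: comm3_rec].
have [l1 hl1] := locM w; have [l2 hl2] := YWt u w.
apply: (@rec3_eq0 _ _ D (l1 + `|l2|)%N%:Z) => // [m' n'|l'].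
  rewrite /D -[X in _ - X]opprK -iter_dif_comm3 addnC iterD.
  have -> : iter l1 (dif (-1)) (defect YM YN (I w) u x) = (fun _ _ => 0).
    by apply/funext => a; apply/funext => b; exact: hl1.
  rewrite dif_zero oppr0 subr0 /jac_lhs /lhs3.
  under eq_evsum => i.
    rewrite hl2 ?(lin0 (Il.1 _ _)) ?scaler0; last by lia.
    over.
  by rewrite evsum0.
left; have [m1 hm1] := locW x; have [m2 hm2] := YMt u x.
exists (m1 + `|m2|)%N%:Z => n'.
have := (@expL_inj _ _ L L_lin _ (@diff3_trunc u w x l' (m1 + `|m2|)%N%:Z)).
move=> /(_ _ n'); rewrite /diff3 /D /comm3 => h.
have -> : jac_right YM I u w x l' (m1 + `|m2|)%N%:Z n' = 0.
  rewrite /jac_right /half.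
  under eq_evsum => j.
    rewrite hm2 ?(lin0 (Il.2 _ _)) ?scaler0; last by lia.
    over.
  by rewrite evsum0 scaler0.
rewrite subr0; apply: h => k; rewrite -iter_dif_diff3 addnC iterD.
have -> : iter m1 (dif 1) (defect YW YN (expI x) u w) = (fun _ _ => 0).
  by apply/funext => a; apply/funext => b; exact: hm1.
by rewrite dif_zero.
Qed.

(** The Jacobi identity for [u] is equivalent to two locality statements, and Dong's lemma carries
    each of them to products. *)
Lemma jac_at_prod u1 u2 p : jac_at u1 -> jac_at u2 -> jac_at (YV u1 p u2).
Proof.
move=> J1 J2; apply: local_jac => [w|x].
  by apply: local_op_prod => //; [exact: (Il.2 w)|exact: jac_local_left..].
by apply: local_op_prod => //; [exact: expI_lin|exact: jac_local_right..].
Qed.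

Lemma jac_at_linear (c : C) u1 u2 : jac_at u1 -> jac_at u2 -> jac_at (c *: u1 + u2).
Proof.
move=> J1 J2 w x l m n.
have fs1 u := finsuppZ (binz C m) (lhs3_supp l m n (trunc_lhs Il YWt u w x)).
have fs2 u := finsuppZ (fun i => (-1) ^+ i * binz C l i)
  (half_supp l m n (trunc_left YNl It u w x)).
have fs3 u := finsuppZ (fun i => (-1) ^+ i * binz C l i)
  (half_supp l n m (trunc_right Il YMt u w x)).
have -> : jac_lhs YW I (c *: u1 + u2) w x l m n =
    c *: jac_lhs YW I u1 w x l m n + jac_lhs YW I u2 w x l m n.
  rewrite /jac_lhs /lhs3 -(evsumZ c (fs1 u1)) -(evsumD (finsuppcZ c (fs1 u1)) (fs1 u2)).
  apply: eq_evsum => i; rewrite (YWl.1 _ w) (Il.1 _ x) scalerDr.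
  by congr (_ + _); rewrite !scalerA mulrC.
have -> : jac_left YN I (c *: u1 + u2) w x l m n =
    c *: jac_left YN I u1 w x l m n + jac_left YN I u2 w x l m n.
  rewrite /jac_left /half -(evsumZ c (fs2 u1)) -(evsumD (finsuppcZ c (fs2 u1)) (fs2 u2)).
  apply: eq_evsum => i; rewrite (YNl.1 _ _) scalerDr.
  by congr (_ + _); rewrite !scalerA mulrC.
have -> : jac_right YM I (c *: u1 + u2) w x l m n =
    c *: jac_right YM I u1 w x l m n + jac_right YM I u2 w x l m n.
  rewrite /jac_right scalerA mulrC -scalerA -scalerDr /half.
  rewrite -(evsumZ c (fs3 u1)) -(evsumD (finsuppcZ c (fs3 u1)) (fs3 u2)); congr (_ *: _).
  apply: eq_evsum => i; rewrite (YMl.1 _ _) (Il.2 w) scalerDr.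
  by congr (_ + _); rewrite !scalerA mulrC.
by rewrite J1 J2 scalerBr opprD addrACA.
Qed.

Lemma jac_at_vacuum vac :
  (forall n w, YW vac n w = if n == -1 then w else 0) ->
  (forall n x, YM vac n x = if n == -1 then x else 0) ->
  (forall n y, YN vac n y = if n == -1 then y else 0) -> jac_at vac.
Proof.
move=> vW vM vN w x l m n; apply/eqP; rewrite -subr_eq0; apply/eqP.
pose D l m n := jac_lhs YW I vac w x l m n - comm3 vac w x l m n.
rewrite -[LHS]/(D l m n).
have recD : rec3 D.
  by apply: rec3B; [exact: (jac_lhs_rec Il YWt)|exact: comm3_rec].
have vW0 (k : int) v : k != -1 -> YW vac k v = 0 by rewrite vW => /negbTE ->.
have vM0 (k : int) v : k != -1 -> YM vac k v = 0 by rewrite vM => /negbTE ->.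
have vN0 (k : int) v : k != -1 -> YN vac k v = 0 by rewrite vN => /negbTE ->.
have comm0 a b : I w b (YM vac a x) = YN vac a (I w b x).
  by rewrite vM vN; case: eqP => // _; rewrite (lin0 (Il.2 w b)).
apply: (@rec3_eq0 _ _ D 0) => // [m' n'|l'].
  rewrite /D /comm3 /jac_left /jac_right !half0 expr0z scale1r comm0 subrr subr0.
  rewrite /jac_lhs /lhs3 -[RHS](evsum0 N); apply: eq_evsum => i.
  by rewrite vW0 ?(lin0 (Il.1 _ x)) ?scaler0//; lia.
left; exists 0 => n'.
have -> : D l' 0 n' = diff3 vac w x l' 0 n'.
  rewrite /D /comm3 /diff3 /jac_right /half.
  under [X in _ - (_ - _ *: X)]eq_evsum => i.
    rewrite vM0 ?(lin0 (Il.2 w _)) ?scaler0; last by lia.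
    over.
  by rewrite evsum0 scaler0 subr0.
rewrite /diff3 /jac_lhs lhs30 /jac_left /half.
case: (ltrP l' (-1)) => hl.
  rewrite vW0 ?(lin0 (Il.1 _ x)) ?sub0r; last by lia.
  rewrite (_ : evsum _ = 0) ?oppr0//.
  rewrite -[RHS](evsum0 N); apply: eq_evsum => i.
  by rewrite vN0 ?scaler0//; lia.
case: (eqVneq l' (-1)) => [->|ln1].
  rewrite (@evsum1 _ _ _ 0%N).
    by rewrite binz0 mulr1 scale1r vN vW addz0 addr0 subz0/= subrr.
  by case=> // i _; rewrite vN0 ?scaler0//; lia.
rewrite vW0//.
rewrite (lin0 (Il.1 _ x)) sub0r (_ : evsum _ = 0) ?oppr0//.
rewrite -[RHS](evsum0 N); apply: eq_evsum => i.
(* Here l' >= 0, and the only index with a nonzero vacuum mode is i = l' + 1, where the binomial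
   coefficient of l' over i vanishes. *)
rewrite vN; case: eqP => [il|]; last by rewrite scaler0.
rewrite /binz (_ : \prod_(j < i) _ = 0) ?mul0r ?mulr0 ?scale0r//.
have lti : (`|l'|%N < i)%N by move: il hl ln1; lia.
rewrite (bigD1 (Ordinal lti))//= (_ : l' - `|l'|%N%:Z = 0) ?mulr0z ?mul0r//.
by move: hl ln1; lia.
Qed.

End Generation.

(** * Highest-weight modules of affine sl2 *)

Section Annihilation.
Variables (C : numFieldType) (M : lmodType C).
Implicit Types (T X : M -> M) (S : M -> Prop).

Definition submod S := S 0 /\ forall (c : C) u v, S u -> S v -> S (c *: u + v).

Lemma submodD S u v : submod S -> S u -> S v -> S (u + v).
Proof. by move=> [_ h] Su Sv; rewrite -[u]scale1r; exact: h. Qed.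

Lemma submodZ S c u : submod S -> S u -> S (c *: u).
Proof. by move=> [S0 h] Su; rewrite -[_ *: u]addr0; exact: h. Qed.

Lemma submodN S u : submod S -> S u -> S (- u).
Proof. by move=> Ss Su; rewrite -scaleN1r; exact: submodZ. Qed.

Lemma submodB S u v : submod S -> S u -> S v -> S (u - v).
Proof. by move=> Ss Su Sv; apply: submodD => //; exact: submodN. Qed.

Lemma submod_sum S (I : Type) (r : seq I) (P : pred I) (F : I -> M) :
  submod S -> (forall i, P i -> S (F i)) -> S (\sum_(i <- r | P i) F i).
Proof.
move=> Ss SF; elim/big_ind: _ => [|u v|i]; [exact: Ss.1|exact: submodD|exact: SF].
Qed.

Definition polyop T (s : seq C) (y : M) : M :=
  foldr (fun c z => T z - c *: z) y s.

Section Fixed.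
Variable T : M -> M.
Hypothesis T_lin : linear T.

Lemma polyop_lin s : linear (polyop T s).
Proof.
move=> c u v; elim: s => //= a s ->.
by rewrite T_lin scalerDr opprD addrACA scalerBr !scalerA (mulrC a).
Qed.

Lemma polyop_comm1 a s y :
  polyop T s (T y - a *: y) = T (polyop T s y) - a *: polyop T s y.
Proof.
elim: s => //= b s ->; rewrite !(linB T_lin) !(linZ T_lin) !scalerBr !scalerA.
by rewrite subrBB (mulrC a).
Qed.

Lemma polyop_cat s t y : polyop T (s ++ t) y = polyop T s (polyop T t y).
Proof. by rewrite /polyop foldr_cat. Qed.

Lemma polyop_comm s t y : polyop T s (polyop T t y) = polyop T t (polyop T s y).
Proof. by elim: t => //= a t <-; rewrite polyop_comm1. Qed.

Lemma polyop_eig s y (mu : C) : T y = mu *: y ->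
  polyop T s y = (\prod_(c <- s) (mu - c)) *: y.
Proof.
move=> Ty; elim: s => [|a s IHs]; first by rewrite big_nil scale1r.
by rewrite /= IHs big_cons (linZ T_lin) Ty !scalerA -scalerBl (mulrC a) -mulrBr mulrC.
Qed.

(** Membership in the sum of the generalized eigenspaces of [T] with eigenvalues in [Lambda],
    phrased without exhibiting components. This makes closure under sums and under operators
    shifting eigenvalues immediate. *)
Definition killed (Lambda : C -> Prop) y :=
  exists s, (forall c, c \in s -> Lambda c) /\ polyop T s y = 0.

Lemma killed_submod Lambda : submod (killed Lambda).
Proof.
split; first by exists [::].
move=> c u v [s [hs su]] [t [ht tv]]; exists (s ++ t); split.
  by move=> a; rewrite mem_cat => /orP[/hs|/ht].
rewrite polyop_lin polyop_cat polyop_comm su polyop_cat tv.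
by rewrite !(lin0 (polyop_lin _)) scaler0 addr0.
Qed.

Lemma killed_eig (Lambda : C -> Prop) y mu :
  T y = mu *: y -> Lambda mu -> killed Lambda y.
Proof.
move=> Ty Lmu; exists [:: mu]; split; first by move=> c; rewrite inE => /eqP ->.
by rewrite /= Ty subrr.
Qed.

Lemma killed_eig0 (Lambda : C -> Prop) y mu :
  T y = mu *: y -> killed Lambda y -> ~ Lambda mu -> y = 0.
Proof.
move=> Ty [s [hs sy]] Lmu; move: sy; rewrite (polyop_eig _ Ty) => /eqP.
rewrite scaler_eq0 => /orP[|/eqP//]; rewrite prodf_seq_eq0 => /hasP[c cs].
by rewrite subr_eq0 => /eqP emu; case: Lmu; rewrite emu; exact: hs.
Qed.

Lemma killed_shift (Lambda Lambda' : C -> Prop) X (delta : C) y :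
  linear X -> (forall z, T (X z) = X (T z) + delta *: X z) ->
  (forall c, Lambda c -> Lambda' (c + delta)) ->
  killed Lambda y -> killed Lambda' (X y).
Proof.
move=> Xl TX LL' [s [hs sy]]; exists [seq c + delta | c <- s]; split.
  by move=> c /mapP[b /hs Lb ->]; exact: LL'.
suff -> : polyop T [seq c + delta | c <- s] (X y) = X (polyop T s y).
  by rewrite sy (lin0 Xl).
elim: s {hs sy} => //= a s ->.
by rewrite TX (linB Xl) (linZ Xl) scalerDl opprD addrACA subrr addr0.
Qed.

End Fixed.
End Annihilation.

Inductive letter := LE | LF | LH.

Section HatRep.
Variable C : numFieldType.

(** In the basis e, f, h every bracket is a multiple of a basis element, so it is encoded by a
    letter [br] and a coefficient [brc]; relations between modes become finite case checks. *)
Definition br a b := match a, b with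
  | LE, LF | LF, LE => LH
  | LE, _ | _, LE => LE
  | LF, _ | _, LF => LF
  | LH, LH => LH end.

Definition brc a b : C := match a, b with
  | LE, LF => 1 | LF, LE => -1
  | LH, LE => 2 | LE, LH => -2
  | LH, LF => -2 | LF, LH => 2
  | _, _ => 0 end.

Definition frm a b : C := match a, b with
  | LE, LF | LF, LE => 1 | LH, LH => 2 | _, _ => 0 end.

Definition wt a : int := match a with LE => 2 | LF => -2 | LH => 0 end.

Definition hat_rep (k : C) (M : lmodType C) (A : letter -> int -> M -> M) :=
  (forall a n, linear (A a n)) /\
  (forall a b m n x, A a m (A b n x) = A b n (A a m x) +
     brc a b *: A (br a b) (m + n) x +
     (if m + n == 0 then m%:~R * frm a b * k else 0) *: x).

Definition flow (k : C) (M : lmodType C) (A : letter -> int -> M -> M) a n x :=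
  match a with
  | LE => A LE (n + 1) x
  | LF => A LF (n - 1) x
  | LH => A LH n x + (if n == 0 then k else 0) *: x
  end.

Section OneModule.
Variables (k : C) (M : lmodType C) (A : letter -> int -> M -> M).
Hypothesis repA : hat_rep k A.

Definition op_closed (S : M -> Prop) := forall a n u, S u -> S (A a n u).

Definition generated v y := forall S, submod S -> op_closed S -> S v -> S y.

Definition lowering a (n : int) := n < 0 \/ n = 0 /\ a = LF.

Definition low_generated v y := forall S, submod S ->
  (forall a n u, lowering a n -> S u -> S (A a n u)) -> S v -> S y.

Definition hw_vector (i : C) v :=
  [/\ forall a n, 0 < n -> A a n v = 0, A LE 0 v = 0 & A LH 0 v = i *: v].

Definition irreducible := forall S, submod S -> op_closed S ->
  (forall u, S u -> u = 0) \/ (forall u, S u).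

Lemma generated_submod v : submod (generated v).
Proof.
split=> [S Ss _ _|c x y gx gy S Ss Sc Sv]; first exact: Ss.1.
by apply: Ss.2; [exact: gx|exact: gy].
Qed.

Lemma generated_closed v : op_closed (generated v).
Proof. by move=> a n u gu S Ss Sc Sv; apply: (Sc); exact: gu. Qed.

Lemma generated_self v : generated v v.
Proof. by []. Qed.

Lemma irr_generated v y : irreducible -> v <> 0 -> generated v y.
Proof.
move=> irrA v0.
have [h|h] := irrA _ (generated_submod v) (@generated_closed v); last exact: h.
by case: v0; apply: h; exact: generated_self.
Qed.

Lemma low_submod v : submod (low_generated v).
Proof.
split=> [S Ss _ _|c x y gx gy S Ss Sc Sv]; first exact: Ss.1.
by apply: Ss.2; [exact: gx|exact: gy].
Qed.

(** A weak form of Poincare-Birkhoff-Witt: the vectors whose images under all modes lie in the span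
    of lowering words are stable under lowering operators, because commutators only produce single
    modes and scalars; the highest-weight vector is one of them. *)
Lemma generated_low i v y : hw_vector i v -> generated v y -> low_generated v y.
Proof.
move=> [v_pos vE vH] gy.
have lowS := low_submod v.
have low_low a n u : lowering a n -> low_generated v u -> low_generated v (A a n u).
  by move=> an lu S Ss Sl Sv; apply: (Sl) => //; exact: lu.
have key u : low_generated v u ->
    low_generated v u /\ forall a n, low_generated v (A a n u).
  move=> lu; apply: (lu (fun u => low_generated v u /\ forall a n, low_generated v (A a n u))).
  - split; first by split=> [|a n]; [exact: lowS.1|rewrite (lin0 (repA.1 a n)); exact: lowS.1].
    move=> c x z [lx hx] [lz hz]; split; first exact: lowS.2.
    by move=> a n; rewrite repA.1; exact: lowS.2.
  - move=> b m z bm [lz hz]; split; first exact: hz.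
    move=> a n; rewrite repA.2; apply: (submodD lowS); last exact: (submodZ _ lowS).
    by apply: (submodD lowS); [exact: low_low|exact: (submodZ _ lowS)].
  - have lv : low_generated v v by move=> S.
    split=> // a n; have [n0|n0|->] := ltrgtP n 0.
    + by apply: low_low => //; left.
    + by rewrite v_pos//; exact: lowS.1.
    + case: a; first by rewrite vE; exact: lowS.1.
      * by apply: low_low => //; right.
      * by rewrite vH; exact: (submodZ _ lowS).
apply: gy; [exact: lowS| |by move=> S].
by move=> a n u /key[_].
Qed.

Section Grading.
Variables (i c : C) (d : M -> M).
Hypothesis d_lin : linear d.
Hypothesis d_op : forall a n x, d (A a n x) = A a n (d x) - n%:~R *: A a n x.

(** The factor 4 makes every lowering operator raise the height strictly: for n < 0 the term -4n >=
    4 outweighs the weight, which is at most 2, and f_0 raises it by 2. Thus the highest-weight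
    vector is alone at its height. *)
Definition height x := 4 *: d x - A LH 0 x.

Lemma height_lin : linear height.
Proof.
move=> b x y; rewrite /height d_lin repA.1 scalerDr opprD addrACA scalerBr.
by rewrite !scalerA (mulrC b).
Qed.

Lemma H0_op a n x : A LH 0 (A a n x) = A a n (A LH 0 x) + (wt a)%:~R *: A a n x.
Proof.
rewrite repA.2 add0r mulr0z !mul0r if_same scale0r addr0.
by congr (_ + _); case: a => /=; rewrite // scale0r mulr0z scale0r.
Qed.

Lemma height_op a n x : height (A a n x) =
  A a n (height x) + (- 4 * n - wt a)%:~R *: A a n x.
Proof.
rewrite /height d_op H0_op (linB (repA.1 a n)) (linZ (repA.1 a n)) scalerBr scalerA.
rewrite opprD addrACA; congr (_ + _).
by rewrite -opprD -scalerDl -scaleNr; congr (_ *: _); rewrite intrB intrM; ring.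
Qed.

Definition above (mu b : C) := exists t : nat, b = mu + t.+1%:R.

Lemma above_irrefl mu : ~ above mu mu.
Proof.
by move=> [t /eqP]; rewrite -subr_eq0 opprD addNKr oppr_eq0 pnatr_eq0.
Qed.

Lemma lowering_height a n : lowering a n ->
  exists t : nat, (- 4 * n - wt a)%:~R = t.+1%:R :> C.
Proof.
move=> h; exists (`|(- 4 * n - wt a)%R|.-1)%N.
have : 0 < - 4 * n - wt a by case: h => [|[-> ->]]//; case: a => /=; lia.
by case: (_ - _) => // -[|m].
Qed.

Lemma low_decomp v y : height v = (4 * c - i) *: v -> low_generated v y ->
  exists b, killed height (above (4 * c - i)) (y - b *: v).
Proof.
move=> hv ly; set mu := 4 * c - i in hv *.
have ksub := killed_submod height_lin (above mu).
apply: (ly (fun y => exists b, killed height (above mu) (y - b *: v))).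
- split; first by exists 0; rewrite scale0r subr0; exact: ksub.1.
  move=> b x z [bx hx] [bz hz]; exists (b * bx + bz).
  rewrite scalerDl -scalerA opprD addrACA -scalerBr.
  exact: ksub.2.
- move=> a n u an [b hb]; have [t ht] := lowering_height an.
  exists 0; rewrite scale0r subr0 -[u](subrK (b *: v)) (linD (repA.1 a n)).
  apply: (submodD ksub).
    apply: (killed_shift (repA.1 a n) _ _ hb (delta := t.+1%:R)).
      by move=> z; rewrite height_op ht.
    by move=> _ [t' ->]; exists (t' + t.+1)%N; rewrite -addrA -natrD addSn.
  rewrite (linZ (repA.1 a n)); apply: (submodZ _ ksub).
  apply: (killed_eig (mu := mu + t.+1%:R)); last by exists t.
  by rewrite height_op ht hv (linZ (repA.1 a n)) [RHS]scalerDl.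
- by exists 1; rewrite scale1r subrr; exact: ksub.1.
Qed.

Lemma hw_height v : hw_vector i v -> d v = c *: v -> height v = (4 * c - i) *: v.
Proof. by move=> [_ _ vH] dv; rewrite /height dv vH scalerA -scalerBl. Qed.

End Grading.
End OneModule.

Lemma hat_comm0 k (M : lmodType C) (A : letter -> int -> M -> M) a b m n x :
  hat_rep k A -> frm a b = 0 ->
  A a m (A b n x) = A b n (A a m x) + brc a b *: A (br a b) (m + n) x.
Proof. by move=> [_ Ac] f0; rewrite Ac f0 mulr0 mul0r if_same scale0r addr0. Qed.

Lemma flow_rep k (M : lmodType C) (A : letter -> int -> M -> M) :
  hat_rep k A -> hat_rep k (flow k A).
Proof.
move=> repA; have [Al Ac] := repA; split.
  case=> n c x y /=; rewrite Al// [X in _ + X]scalerDr addrACA; congr (_ + _).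
  by rewrite scalerDr !scalerA mulrC.
pose e (j : int) : C := if j == 0 then k else 0.
have e_case (m n : int) (b : C) : (if m + n == 0 then b * k else 0) = b * e (m + n).
  by rewrite /e; case: eqP => //; rewrite mulr0.
case=> [] [] m n x; rewrite ?e_case /= -?/(e m) -?/(e n) -?/(e (m + n)).
- by rewrite (hat_comm0 _ _ _ repA)//= !scale0r mulr0 mul0r scale0r !addr0.
- rewrite Ac /= (_ : m + 1 + (n - 1) = m + n); last by lia.
  rewrite e_case !scale1r !mulr1 -!addrA -scalerDl; do 2!congr (_ + _).
  by congr (_ *: _); rewrite intrD mulrDl mul1r addrC.
- rewrite (linD (Al _ _)) (linZ (Al _ _)) (hat_comm0 _ _ _ repA)//=.
  rewrite mulr0 mul0r scale0r addr0.
  by rewrite (_ : m + 1 + n = m + n + 1) 1?addrAC//; lia.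
- rewrite Ac /= (_ : m - 1 + (n + 1) = m + n); last by lia.
  rewrite e_case !mulr1 -!addrA scalerDr -!addrA; do 2!congr (_ + _).
  rewrite scalerA -scalerDl; congr (_ *: _).
  by rewrite -mulrDl intrB addrC.
- by rewrite (hat_comm0 _ _ _ repA)//= !scale0r mulr0 mul0r scale0r !addr0.
- rewrite (linD (Al _ _)) (linZ (Al _ _)) (hat_comm0 _ _ _ repA)//=.
  rewrite mulr0 mul0r scale0r addr0.
  by rewrite (_ : m - 1 + n = m + n - 1) 1?addrAC//; lia.
- rewrite (hat_comm0 _ _ _ repA)//= mulr0 mul0r scale0r addr0.
  rewrite (linD (Al _ _)) (linZ (Al _ _)).
  by rewrite (_ : m + (n + 1) = m + n + 1) 1?addrAC//; lia.
- rewrite (hat_comm0 _ _ _ repA)//= mulr0 mul0r scale0r addr0.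
  rewrite (linD (Al _ _)) (linZ (Al _ _)).
  by rewrite (_ : m + (n - 1) = m + n - 1) 1?addrAC//; lia.
- rewrite !(linD (Al _ _)) !(linZ (Al _ _)) Ac /= !scale0r addr0 e_case.
  rewrite !scalerDr addr0 !scalerA (mulrC (e m)).
  by rewrite (AC (3*2) ((1*4)*(3*5)*2)).
Qed.

End HatRep.

(** * Uniqueness of irreducible highest-weight modules *)

Section ProductModule.
Variables (C : numFieldType) (k : C) (M1 M2 : lmodType C).
Variables (A1 : letter -> int -> M1 -> M1) (A2 : letter -> int -> M2 -> M2).
Hypotheses (rep1 : hat_rep k A1) (rep2 : hat_rep k A2).

Definition prod_op a n (x : M1 * M2) : M1 * M2 := (A1 a n x.1, A2 a n x.2).

Lemma pair_scale (c : C) (x : M1 * M2) : c *: x = (c *: x.1, c *: x.2).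
Proof. by case: x. Qed.

Lemma pair_add (x y : M1 * M2) : x + y = (x.1 + y.1, x.2 + y.2).
Proof. by case: x; case: y. Qed.

Lemma prod_rep : hat_rep k prod_op.
Proof.
split=> [a n c x y|a b m n x].
  by rewrite /prod_op !pair_scale !pair_add/= rep1.1 rep2.1.
by rewrite /prod_op !pair_scale !pair_add/= rep1.2 rep2.2.
Qed.

Variables (i c : C) (d1 : M1 -> M1) (d2 : M2 -> M2) (v1 : M1) (v2 : M2).
Hypotheses (d1_lin : linear d1) (d2_lin : linear d2).
Hypothesis d1_op : forall a n x, d1 (A1 a n x) = A1 a n (d1 x) - n%:~R *: A1 a n x.
Hypothesis d2_op : forall a n x, d2 (A2 a n x) = A2 a n (d2 x) - n%:~R *: A2 a n x.
Hypotheses (hw1 : hw_vector A1 i v1) (hw2 : hw_vector A2 i v2).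
Hypotheses (v1_neq0 : v1 <> 0) (v2_neq0 : v2 <> 0).
Hypotheses (dv1 : d1 v1 = c *: v1) (dv2 : d2 v2 = c *: v2).
Hypotheses (irr1 : irreducible A1) (irr2 : irreducible A2).

Let rel x y := generated prod_op (v1, v2) (x, y).

Lemma rel_submod : rel 0 0 /\
  forall b x y x' y', rel x y -> rel x' y' -> rel (b *: x + x') (b *: y + y').
Proof.
have gs := generated_submod prod_op (v1, v2).
split; first exact: gs.1.
move=> b x y x' y' h h'; have := gs.2 b _ _ h h'.
by rewrite pair_scale pair_add.
Qed.

Lemma rel_op a n x y : rel x y -> rel (A1 a n x) (A2 a n y).
Proof. by move=> h; exact: (generated_closed a n h). Qed.

Lemma rel_total x : exists y, rel x y.
Proof.
have [r0 r1] := rel_submod.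
case: (irr1 (S := fun x => exists y, rel x y)) => [||h|h].
- split; first by exists 0.
  by move=> b u v [y ry] [z rz]; exists (b *: y + z); exact: r1.
- by move=> a n u [y ry]; exists (A2 a n y); exact: rel_op.
- by case: v1_neq0; apply: h; exists v2; exact: generated_self.
- exact: h.
Qed.

(** The vectors related to 0 form a submodule of the irreducible M2. If it were everything, (0, v2)
    would lie in the submodule generated by (v1, v2), whose part of lowest height is the line
    through (v1, v2). *)
Lemma rel_fun y : rel 0 y -> y = 0.
Proof.
have [r0 r1] := rel_submod.
case: (irr2 (S := fun y => rel 0 y)) => [||h|h].
- split=> // b u v ru rv; have := r1 b _ _ _ _ ru rv.
  by rewrite scaler0 addr0.
- by move=> a n u /(rel_op a n); rewrite (lin0 (rep1.1 a n)).
- exact: h.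
exfalso; move: (h v2).
pose d (x : M1 * M2) : M1 * M2 := (d1 x.1, d2 x.2).
have d_lin : linear d.
  by move=> b x z; rewrite /d !pair_scale !pair_add/= d1_lin d2_lin.
have d_op a n x : d (prod_op a n x) = prod_op a n (d x) - n%:~R *: prod_op a n x.
  by rewrite /d /prod_op -scaleNr !pair_scale !pair_add/= d1_op d2_op !scaleNr.
have hw : hw_vector prod_op i (v1, v2).
  case: hw1 => p1 e1 h1; case: hw2 => p2 e2 h2; split.
  - by move=> a n n0; rewrite /prod_op/= p1// p2.
  - by rewrite /prod_op/= e1 e2.
  - by rewrite /prod_op/= h1 h2 pair_scale.
have dv : d (v1, v2) = c *: (v1, v2) by rewrite /d/= dv1 dv2 pair_scale.
move=> /(generated_low prod_rep hw).
have hv := hw_height hw dv.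
move=> /(low_decomp prod_rep d_lin d_op hv)[b kb].
have H0 := killed_eig0 (height_lin prod_rep d_lin) _ kb (@above_irrefl _ _).
have eig : height prod_op d (0, v2) = (4 * c - i) *: (0, v2).
  rewrite /height /d /prod_op -scaleN1r !pair_scale !pair_add/=.
  case: hw2 => _ _ ->; rewrite (lin0 d1_lin) (lin0 (rep1.1 _ _)) dv2 !scaler0 addr0.
  by rewrite scaleN1r scalerA -scalerBl.
have : (0, v2) - b *: (v1, v2) = 0.
  apply: H0; rewrite (linB (height_lin prod_rep d_lin)) (linZ (height_lin prod_rep d_lin)).
  by rewrite eig hv scalerBr !scalerA (mulrC b).
rewrite -scaleNr pair_scale pair_add/= => -[/eqP + /eqP].
rewrite add0r scaler_eq0 oppr_eq0 => /orP[/eqP->|/eqP]; last by move/v1_neq0.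
by rewrite oppr0 scale0r addr0 => /eqP.
Qed.

(** The submodule of M1 x M2 generated by (v1, v2) is the graph of the morphism: its projection to
    M1 is onto by irreducibility of M1, and it is single-valued by [rel_fun]. *)
Lemma hw_morphism : exists psi : M1 -> M2, [/\ linear psi,
  forall a n x, psi (A1 a n x) = A2 a n (psi x) & psi v1 = v2].
Proof.
have [r0 r1] := rel_submod.
have [psi hpsi] := choice rel_total.
have uniq x y y' : rel x y -> rel x y' -> y = y'.
  move=> ry ry'; have := r1 (-1) _ _ _ _ ry' ry.
  by rewrite !scaleN1r addNr => /rel_fun/eqP; rewrite addrC subr_eq0 => /eqP.
exists psi; split.
- by move=> b x y; apply: (uniq (b *: x + y)) => //; exact: r1.
- by move=> a n x; apply: (uniq (A1 a n x)) => //; exact: rel_op.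
- by apply: (uniq v1) => //; exact: generated_self.
Qed.

End ProductModule.

Section FiniteString.
Variables (C : numFieldType) (k : C) (M : lmodType C) (A : letter -> int -> M -> M).
Hypothesis repA : hat_rep k A.
Variables (i : nat) (v : M).
Hypothesis hwv : hw_vector A i%:R v.

Lemma H_string j : A LH 0 (iter j (A LF 0) v) = (i%:R - j.*2%:R) *: iter j (A LF 0) v.
Proof.
case: hwv => _ _ vH; elim: j => [|j IHj]; first by rewrite subr0.
rewrite iterS (H0_op repA) IHj (linZ (repA.1 _ _)) -scalerDl; congr (_ *: _).
by rewrite doubleS -addn2 natrD opprD addrA; congr (_ + _).
Qed.

Lemma E_string j : A LE 0 (iter j.+1 (A LF 0) v) =
  (j.+1%:R * (i%:R - j%:R)) *: iter j (A LF 0) v.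
Proof.
case: hwv => _ vE vH; elim: j => [|j IHj].
  by rewrite /= repA.2 /= vE vH (lin0 (repA.1 _ _)) add0r scale1r mul0r mul0r scale0r addr0 mul1r subr0.
rewrite iterS repA.2 IHj /= (linZ (repA.1 _ _)) !mul0r scale0r addr0 scale1r.
rewrite addr0 -[A LF 0 (iter j _ _)]/(iter j.+1 _ _) H_string -scalerDl; congr (_ *: _).
by rewrite -mul2n natrM -[j.+2]addn1 -[j.+1]addn1 !natrD; ring.
Qed.

Lemma pos_string a n j : 0 < n -> A a n (iter j (A LF 0) v) = 0.
Proof.
case: hwv => vp _ _; elim: j a => [|j IHj] a n0; first exact: vp.
rewrite iterS repA.2 addr0 !IHj// (lin0 (repA.1 _ _)) scaler0 !add0r.
by rewrite gt_eqF// scale0r.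
Qed.

Lemma string_neq0 j : v <> 0 -> (j <= i)%N -> iter j (A LF 0) v <> 0.
Proof.
move=> v0; elim: j => // j IHj ji h; apply: (IHj (ltnW ji)).
have := E_string j; rewrite h (lin0 (repA.1 _ _)) => /esym/eqP.
rewrite scaler_eq0 mulf_eq0 pnatr_eq0/= subr_eq0 eqr_nat gtn_eqF//=.
by move/eqP.
Qed.

Variables (c : C) (d : M -> M).
Hypothesis d_lin : linear d.
Hypothesis d_op : forall a n x, d (A a n x) = A a n (d x) - n%:~R *: A a n x.
Hypothesis dv : d v = c *: v.
Hypothesis irr : irreducible A.

Lemma d_string j : d (iter j (A LF 0) v) = c *: iter j (A LF 0) v.
Proof.
by elim: j => // j IHj; rewrite iterS d_op IHj mulr0z scale0r subr0 (linZ (repA.1 _ _)).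
Qed.

(* Otherwise it would be a singular vector, generating a submodule without v. *)
Lemma string_top : v <> 0 -> iter i.+1 (A LF 0) v = 0.
Proof.
move=> v0; apply/eqP/negP => /negP/eqP s0; set s := iter _ _ _ in s0.
have hws : hw_vector A (i%:R - i.+1.*2%:R) s.
  split; [by move=> a n; exact: pos_string| |exact: H_string].
  by rewrite /s E_string subrr mulr0 scale0r.
have hs := hw_height hws (d_string i.+1).
have := irr_generated v irr s0 => /(generated_low repA hws).
move=> /(low_decomp repA d_lin d_op hs)[b kb].
apply: v0; set mu := (4 * c - _) in hs kb.
have hv := hw_height hwv dv.
have mu_neq (t : nat) : mu + t%:R <> 4 * c - i%:R.
  move=> /eqP; rewrite -subr_eq0 (_ : _ - _ = (i.+1.*2 + t)%:R) ?pnatr_eq0//.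
  by rewrite natrD /mu; move: (i.+1.*2%:R) (i%:R) (t%:R) => x y z; ring.
have hl := height_lin repA d_lin.
have ks := killed_submod hl (fun e => e <> 4 * c - i%:R).
apply: (killed_eig0 hl hv (Lambda := fun e => e <> 4 * c - i%:R)); last by apply.
rewrite -[v](subrK (b *: s)); apply: (submodD ks); last first.
  apply: (submodZ _ ks); apply: (killed_eig hs).
  by have := mu_neq 0; rewrite addr0.
case: kb => r [hr sr]; exists r; split=> // e /hr[t ->]; exact: mu_neq.
Qed.

End FiniteString.

(** * The Sugawara vector *)

Section JacobiConsequences.
Variables (C : numFieldType) (V W M N : lmodType C).
Variables (YW : V -> int -> W -> W) (YM : V -> int -> M -> M).
Variables (YN : V -> int -> N -> N) (I : W -> int -> M -> N).
Hypotheses (YNl : mode_linear YN) (Il : mode_linear I).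
Hypotheses (YMt : mode_truncation YM) (It : mode_truncation I).
Variables (u : V) (w : W) (x : M).
Hypothesis J : jac YW YM YN I u w x.

Lemma jac_comm m n : YN u m (I w n x) = I w n (YM u m x) +
  evsum (fun i : nat => binz C m i *: I (YW u i%:Z w) (m + n - i%:Z) x).
Proof.
have := J 0 m n; rewrite /jac_left /jac_right !half0 expr0z scale1r.
rewrite /jac_lhs /lhs3 => /eqP; rewrite eq_sym subr_eq addrC => /eqP ->.
by congr (_ + _); apply: eq_evsum => i; rewrite add0r.
Qed.

Lemma jac_iter l n : I (YW u l w) n x =
  evsum (fun i : nat => ((-1) ^+ i * binz C l i) *: YN u (l - i%:Z) (I w (n + i%:Z) x)) -
  (-1) ^ l *: evsum (fun i : nat => ((-1) ^+ i * binz C l i) *: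
    I w (l + n - i%:Z) (YM u i%:Z x)).
Proof.
have := J l 0 n; rewrite /jac_lhs lhs30 => ->.
by congr (_ - _ *: _); apply: eq_evsum => i; rewrite addr0.
Qed.

Lemma jac_iterN1 n : I (YW u (-1) w) n x =
  evsum (fun i : nat => YN u (-1 - i%:Z) (I w (n + i%:Z) x)) +
  evsum (fun i : nat => I w (n - 1 - i%:Z) (YM u i%:Z x)).
Proof.
rewrite jac_iter exprN1 invrN1 scaleN1r opprK; congr (_ + _); apply: eq_evsum => i;
  rewrite binzN1 scale1r//.
by rewrite [-1 + n]addrC.
Qed.

End JacobiConsequences.

Section AffineToHat.
Variables (C : numFieldType).

Definition lmat (a : letter) : 'M[C]_2 :=
  match a with LE => sl2_e C | LF => sl2_f C | LH => sl2_h C end.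

Lemma lmat_br a b : lmat a *m lmat b - lmat b *m lmat a = brc C a b *: lmat (br a b).
Proof.
case: a; case: b; rewrite /= /sl2_e /sl2_f /sl2_h ?subrr ?scale0r//;
  rewrite ?mulmxBl ?mulmxBr ?mul_delta_mx_cond/=;
  rewrite ?mulr0n ?mulr1n ?subr0 ?sub0r ?scale1r ?scaleN1r ?opprB ?opprK//.
- by rewrite -opprD -mulr2n -scaler_nat -scaleNr.
- by rewrite -mulr2n -scaler_nat.
- by rewrite -mulr2n -scaler_nat.
- by rewrite -opprD -mulr2n -scaler_nat -scaleNr.
Qed.

Lemma lmat_form a b : \tr (lmat a *m lmat b) = frm C a b.
Proof.
case: a; case: b; rewrite /= /sl2_e /sl2_f /sl2_h /mxtrace;
  rewrite !big_ord_recl !big_ord0 !mxE !big_ord_recl !big_ord0 !mxE /=; ring.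
Qed.

Lemma lmat_sl2 a : sl2 (lmat a).
Proof.
rewrite /sl2 /=; case: a; rewrite /= /sl2_e /sl2_f /sl2_h;
  rewrite /mxtrace !big_ord_recl big_ord0 !mxE/=; ring.
Qed.

Lemma sl2_decomp (x : 'M[C]_2) : sl2 x ->
  x = x 0 1 *: sl2_e C + (x 1 0 *: sl2_f C + x 0 0 *: sl2_h C).
Proof.
rewrite /sl2 /= /mxtrace !big_ord_recl big_ord0 addr0 => tr0.
have e1 : lift ord0 ord0 = 1 :> 'I_2 by apply: val_inj.
rewrite e1 in tr0; apply/matrixP => i j; rewrite !mxE.
have cases (t : 'I_2) : t = 0 \/ t = 1.
  by case: t => -[|[|//]] lt; [left|right]; apply: val_inj.
have x11 : x 1 1 = - x 0 0 by apply/eqP; rewrite -addr_eq0 addrC; apply/eqP.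
by case: (cases i) => ->; case: (cases j) => ->; rewrite /= ?x11; ring.
Qed.

Variables (k : C) (M : lmodType C) (act : 'M[C]_2 -> int -> M -> M).
Hypothesis rep : affine_rep k act.

Definition hat_of a n := act (lmat a) n.

Lemma act_scale (c : C) x n v : sl2 x -> act (c *: x) n v = c *: act x n v.
Proof.
case: rep => _ rl _ sx.
have s0 : sl2 (0 : 'M[C]_2) by rewrite /sl2 /= raddf0.
have a0 : act 0 n v = 0.
  have := rl 1 0 0 n v s0 s0; rewrite scaler0 addr0 scale1r => /esym/eqP.
  by rewrite -subr_eq0 addrK => /eqP.
by have := rl c x 0 n v sx s0; rewrite a0 !addr0.
Qed.

Lemma affine_hat : hat_rep k hat_of.
Proof.
case: rep => al rl ac; split=> [a n|a b m n x]; first exact/al/lmat_sl2.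
have := ac (lmat a) (lmat b) m n x (lmat_sl2 a) (lmat_sl2 b).
rewrite lmat_br lmat_form act_scale; last exact: lmat_sl2.
by move=> /eqP; rewrite subr_eq addrC addrA => /eqP.
Qed.

Lemma affine_irr : affine_irreducible act -> irreducible hat_of.
Proof.
case: rep => al rl ac [_ irr] S [S0 Sl] Sc.
have Ss : submod S by [].
have inv : affine_invariant act [set v | S v].
  split=> //= x n v sx Sv.
  have sE := lmat_sl2 LE; have sF := lmat_sl2 LF; have sH := lmat_sl2 LH.
  have sFH : sl2 (x 1 0 *: sl2_f C + x 0 0 *: sl2_h C).
    by rewrite /sl2 /= linearD !linearZ/= (sF : \tr _ = 0) (sH : \tr _ = 0) !mulr0 addr0.
  have s0H : sl2 (x 0 0 *: sl2_h C) by rewrite /sl2/= linearZ/= (sH : \tr _ = 0) mulr0.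
  rewrite (sl2_decomp sx) (rl _ _ _ _ _ sE sFH) (rl _ _ _ _ _ sF s0H) (act_scale _ _ _ sH).
  apply: (Sl); first exact: (Sc LE).
  by apply: (Sl); [exact: (Sc LF)|apply: (submodZ _ Ss); exact: (Sc LH)].
case: (irr _ inv) => [h|h]; [left|right] => u.
  by move=> Su; have : [set v | S v] u by []; rewrite h.
by have : setT u by []; rewrite -h.
Qed.

Lemma affine_hw i v : affine_hw_vector i act v -> hw_vector hat_of i v /\ v <> 0.
Proof.
move=> [v0 vp ve vh]; split=> //; split=> // a n n0.
exact/vp/n0/lmat_sl2.
Qed.

End AffineToHat.

Section Sugawara.
Variables (C : numFieldType) (k : nat) (V : voa C) (J : {linear 'M[C]_2 -> V}).
Hypothesis hV : is_affine_voa k J.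

(** Common to V acting on itself and to the modules, so that the Sugawara and twisting computations
    are made once for both. *)
Definition vmod (M : lmodType C) (Y : V -> int -> M -> M) : Prop :=
  [/\ mode_linear Y, mode_truncation Y,
      forall n x, Y (vacuum V) n x = if n == -1 then x else 0
    & jacobi_identity (@voaY C V) Y Y Y].

Lemma voa_vmod : vmod (@voaY C V).
Proof.
split; [exact: voa_linear|exact: voa_truncation|exact: voa_vacuum|exact: voa_jacobi].
Qed.

Lemma module_vmod (M : voa_module V) : vmod (@modY C V M).
Proof.
split; [exact: mod_linear|exact: mod_truncation|exact: mod_vacuum|exact: mod_jacobi].
Qed.

Definition current (M : lmodType C) (Y : V -> int -> M -> M) : letter -> int -> M -> M :=
  hat_of (fun x n => Y (J x) n).

Definition dual a := match a with LE => LF | LF => LE | LH => LH end.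

Definition cas_sum (M : lmodType C) (f : letter -> M) : M :=
  f LE + f LF + 2^-1 *: f LH.

Let AV := current (@voaY C V).
Let omega := conformal_vector V.
Let vac := vacuum V.
Let sg : C := (2%:R * (k + 2)%N%:R)^-1.

Lemma cas_sum_lin (M N : lmodType C) (g : M -> N) (f : letter -> M) :
  linear g -> g (cas_sum f) = cas_sum (fun a => g (f a)).
Proof. by move=> gl; rewrite /cas_sum !(linD gl) (linZ gl). Qed.

Lemma eq_cas_sum (M : lmodType C) (f g : letter -> M) : f =1 g -> cas_sum f = cas_sum g.
Proof. by move=> fg; rewrite /cas_sum !fg. Qed.

Lemma omegaE : omega = sg *: cas_sum (fun a => AV a (-1) (J (lmat C (dual a)))).
Proof. by case: hV. Qed.

Lemma vac_neq0 : vac <> 0.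
Proof. by case: hV => _ []. Qed.

Lemma two_neq0 : 2 != 0 :> C. Proof. by rewrite pnatr_eq0. Qed.

Lemma k2_neq0 : (k + 2)%N%:R != 0 :> C.
Proof. by rewrite pnatr_eq0 addn2. Qed.

Lemma currentV_rep : hat_rep k%:R AV.
Proof. by case: hV => -[rep _ _] _ _; exact: affine_hat. Qed.

Lemma currentV_irr : irreducible AV.
Proof. by case: hV => -[rep irr _] _ _; exact: affine_irr rep irr. Qed.

Lemma current_vac a n : 0 <= n -> AV a n vac = 0.
Proof. by move=> n0; case: (voa_creation (J (lmat C a))) => _; exact. Qed.

Lemma current_state a : AV a (-1) vac = J (lmat C a).
Proof. by case: (voa_creation (J (lmat C a))). Qed.

Lemma current0_state c a : AV c 0 (J (lmat C a)) = brc C c a *: J (lmat C (br c a)).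
Proof.
rewrite -current_state currentV_rep.2 (current_vac c)// (lin0 (currentV_rep.1 _ _)).
by rewrite add0r scale0r addr0 current_state.
Qed.

Lemma current1_state c a : AV c 1 (J (lmat C a)) = (k%:R * frm C c a) *: vac.
Proof.
rewrite -current_state currentV_rep.2 (current_vac c)// (lin0 (currentV_rep.1 _ _)).
by rewrite add0r current_vac// scaler0 add0r mul1r mulrC.
Qed.

Lemma current2_state c a n : 2 <= n -> AV c n (J (lmat C a)) = 0.
Proof.
move=> n2; rewrite -current_state currentV_rep.2 current_vac; last by lia.
rewrite (lin0 (currentV_rep.1 _ _)) add0r current_vac ?scaler0 ?add0r; last by lia.
by rewrite gt_eqF ?scale0r//; lia.
Qed.

Lemma current0_omega b : AV b 0 omega = 0.
Proof.
have Al := currentV_rep.1.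
have key a a' : AV b 0 (AV a (-1) (J (lmat C a'))) =
    brc C b a' *: AV a (-1) (J (lmat C (br b a'))) +
    brc C b a *: AV (br b a) (-1) (J (lmat C a')).
  by rewrite currentV_rep.2 current0_state (linZ (Al _ _)) scale0r addr0.
rewrite omegaE (linZ (Al _ _)) (cas_sum_lin _ (Al _ _)) /cas_sum !key.
rewrite [X in _ *: X](_ : _ = 0) ?scaler0//.
case: b key => _ /=; rewrite ?scale0r ?addr0 ?add0r ?scale1r ?scaler0 ?addr0.
- rewrite -scalerDr scalerA mulrN mulVf ?two_neq0// scaleN1r.
  by rewrite [X in _ - X]addrC subrr.
- by rewrite -!scalerDr scalerA mulVf ?two_neq0// scale1r scaleN1r addNr.
- by rewrite !scaleNr addNr subrr addr0.
Qed.

(** The invariant form contributes 2k and the Casimir operator of the adjoint representation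
    contributes 4; their sum cancels the normalization 2(k + 2). *)
Lemma current1_omega b : AV b 1 omega = J (lmat C b).
Proof.
have Al := currentV_rep.1.
have key a a' : AV b 1 (AV a (-1) (J (lmat C a'))) =
    (k%:R * frm C b a') *: J (lmat C a) +
    (brc C b a * brc C (br b a) a') *: J (lmat C (br (br b a) a')) +
    (k%:R * frm C b a) *: J (lmat C a').
  rewrite currentV_rep.2 current1_state (linZ (Al _ _)) current_state.
  by rewrite current0_state scalerA mul1r [frm C b a * _]mulrC.
rewrite omegaE (linZ (Al _ _)) (cas_sum_lin _ (Al _ _)) /cas_sum !key.
rewrite [X in _ *: X](_ : _ = (2%:R * (k + 2)%N%:R) *: J (lmat C b)).
  by rewrite scalerA mulVf ?scale1r// mulf_neq0 ?two_neq0 ?k2_neq0.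
case: b key => _ /=; rewrite ?(mulr0, mul0r, mulr1, mul1r, scale0r, addr0, add0r);
  rewrite -!scalerDl !scalerA -!scalerDl; congr (_ *: _); rewrite natrD;
  by field.
Qed.

Lemma current2_omega b n : 2 <= n -> AV b n omega = 0.
Proof.
move=> n2; have Al := currentV_rep.1.
have key a a' : AV b n (AV a (-1) (J (lmat C a'))) =
    brc C b a *: AV (br b a) (n - 1) (J (lmat C a')).
  rewrite currentV_rep.2 current2_state// (lin0 (Al _ _)) add0r.
  by rewrite gt_eqF ?scale0r ?addr0//; lia.
rewrite omegaE (linZ (Al _ _)) (cas_sum_lin _ (Al _ _)) /cas_sum !key.
rewrite [X in _ *: X](_ : _ = 0) ?scaler0//.
have [->|n3] := eqVneq n 2.
  rewrite (_ : 2 - 1 = 1 :> int)// !current1_state.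
  case: b key => _ /=; rewrite !(mulr0, scale0r, scaler0, addr0)//.
  by rewrite scaleNr subrr.
by rewrite !current2_state ?scaler0 ?addr0//; lia.
Qed.

Section OnModule.
Variables (M : lmodType C) (Y : V -> int -> M -> M).
Hypothesis hY : vmod Y.
Let A := current Y.

Lemma vmod_lin : mode_linear Y. Proof. by case: hY. Qed.
Lemma vmod_trunc : mode_truncation Y. Proof. by case: hY. Qed.
Lemma vmod_vac n x : Y vac n x = if n == -1 then x else 0.
Proof. by case: hY => _ _ ->. Qed.

Lemma vmod_jac u v x : jac (@voaY C V) Y Y Y u v x.
Proof.
case: hY => l t _ j; apply: ((jacobiP l l (@voa_truncation C V) t t).1 j).
Qed.

Lemma vmod_vac0 n x : n != -1 -> Y vac n x = 0.
Proof. by rewrite vmod_vac => /negbTE ->. Qed.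

(** In V one has L(-1)u = u_(-2) 1. In the iterate formula for this product the vacuum modes leave a
    single term, in the first sum for l < 0 and in the second for l > 0, with coefficient given by
    [binzN2]. *)
Lemma vmod_derivation u l x : Y (voaY omega 0 u) l x = - l%:~R *: Y u (l - 1) x.
Proof.
have -> : voaY omega 0 u = voaY u (-2) vac.
  have := voa_derivation u (-1) vac; rewrite (voa_creation (voaY omega 0 u)).1 => ->.
  by rewrite mulrNz opprK scale1r.
rewrite (jac_iter (vmod_jac u vac x)) (_ : (-1) ^ (-2 : int) = 1 :> C); last first.
  by rewrite -exprnN sqrrN expr1n invr1.
rewrite scale1r.
under eq_evsum => i do rewrite binzN2.
under [X in _ - X]eq_evsum => i do rewrite binzN2.
have Y0 m := lin0 (vmod_lin.2 u m).
case: (ltrgtP l 0) => [l0|l0|->].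
- rewrite [X in _ - X](_ : _ = 0) ?subr0; last first.
    rewrite -[RHS](evsum0 M); apply: eq_evsum => i.
    by rewrite vmod_vac0 ?scaler0//; lia.
  rewrite (@evsum1 _ _ _ (absz (l + 1))); last first.
    by move=> i il; rewrite vmod_vac0 ?Y0 ?scaler0//; lia.
  rewrite vmod_vac ifT; last by apply/eqP; lia.
  rewrite (_ : -2 - (absz (l + 1))%:Z = l - 1); last by lia.
  congr (_ *: _); rewrite -mulrNz -[LHS]/((absz (l + 1)).+1%:Z%:~R).
  by congr (_%:~R); lia.
- rewrite [X in X - _](_ : _ = 0) ?sub0r; last first.
    rewrite -[RHS](evsum0 M); apply: eq_evsum => i.
    by rewrite vmod_vac0 ?Y0 ?scaler0//; lia.
  rewrite (@evsum1 _ _ _ (absz (l - 1))); last first.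
    by move=> i il; rewrite vmod_vac0 ?scaler0//; lia.
  rewrite vmod_vac ifT; last by apply/eqP; lia.
  rewrite (_ : (absz (l - 1))%:Z = l - 1); last by lia.
  rewrite scaleNr; congr (- (_ *: _)); rewrite -[LHS]/((absz (l - 1)).+1%:Z%:~R).
  by congr (_%:~R); lia.
- rewrite mulr0z oppr0 scale0r -[RHS](subrr 0); congr (_ - _);
    rewrite -[RHS](evsum0 M); apply: eq_evsum => i.
    by rewrite vmod_vac0 ?Y0 ?scaler0//; lia.
  by rewrite vmod_vac0 ?scaler0//; lia.
Qed.

Lemma vmod_translation u l x :
  Y u l (Y omega 0 x) = Y omega 0 (Y u l x) + l%:~R *: Y u (l - 1) x.
Proof.
rewrite [X in _ = X + _](jac_comm (vmod_jac omega u x)).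
rewrite (@evsum1 _ _ _ 0%N); last by case=> // i _; rewrite binz0S scale0r.
by rewrite binz0 scale1r subz0 add0r vmod_derivation scaleNr addrNK.
Qed.

Hypothesis repA : hat_rep k%:R A.

Lemma omega_mode n x : Y omega n x = sg *: cas_sum (fun a =>
  evsum (fun i : nat => A a (-1 - i%:Z) (A (dual a) (n + i%:Z) x)) +
  evsum (fun i : nat => A (dual a) (n - 1 - i%:Z) (A a i%:Z x))).
Proof.
rewrite omegaE (linZ (vmod_lin.1 n x)) (cas_sum_lin _ (vmod_lin.1 n x)).
congr (_ *: _); apply: eq_cas_sum => a.
exact: (jac_iterN1 (vmod_jac _ _ x)).
Qed.

Lemma L0_current a n x : Y omega 1 (A a n x) = A a n (Y omega 1 x) - n%:~R *: A a n x.
Proof.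
rewrite [X in _ = X - _](jac_comm (vmod_jac (J (lmat C a)) omega x)).
have e0 : voaY (J (lmat C a)) 0 omega = 0 := current0_omega a.
have e1 : voaY (J (lmat C a)) 1 omega = J (lmat C a) := current1_omega a.
have e2 m : 2 <= m -> voaY (J (lmat C a)) m omega = 0 := @current2_omega a m.
rewrite (@evsum1 _ _ _ 1%N).
  by rewrite binz_1 (_ : n + 1 - 1%:Z = n) ?e1 ?addrK//; lia.
case=> [|[//|i]] _; first by rewrite e0 (lin0 (vmod_lin.1 _ _)) scaler0.
by rewrite e2 ?(lin0 (vmod_lin.1 _ _)) ?scaler0.
Qed.

Lemma L0_hw i v : hw_vector A i v ->
  Y omega 1 v = (i * (i + 2) / (4 * (k + 2)%N%:R)) *: v.
Proof.
move=> [vp ve vh]; rewrite omega_mode /cas_sum.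
have fst a : evsum (fun i : nat => A a (-1 - i%:Z) (A (dual a) (1 + i%:Z) v)) = 0.
  by rewrite -[RHS](evsum0 M); apply: eq_evsum => j; rewrite vp// (lin0 (repA.1 _ _)).
have snd a : evsum (fun i : nat => A (dual a) (1 - 1 - i%:Z) (A a i%:Z v)) =
    A (dual a) 0 (A a 0 v).
  rewrite (@evsum1 _ _ _ 0%N)//.
  by case=> // j _; rewrite vp// (lin0 (repA.1 _ _)).
rewrite !fst !snd /= !add0r ve (lin0 (repA.1 _ _)) add0r repA.2 ve (lin0 (repA.1 _ _)) add0r.
rewrite !vh (linZ (repA.1 _ _)) vh !scalerA -!scalerDl scalerA; congr (_ *: _).
rewrite /sg /= !mul0r; move: k2_neq0; rewrite addr0 natrD => K0; field.
by rewrite K0.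
Qed.

End OnModule.

(** Half the central charge is the coefficient of the vacuum in L_2 L_{-2} 1 = L_2 omega; only the
    terms with a_1 omega = a survive in the Sugawara expression for L_2. *)
Lemma central_chargeE : central_charge V = (3 * k)%N%:R / (k + 2)%N%:R.
Proof.
have Yl := @voa_linear C V.
have := voa_virasoro 2 (-2) vac; rewrite /= -/omega.
rewrite (_ : -2 + 1 = -1 :> int)// (_ : 2 + 1 = 3 :> int)// (_ : 2 + -2 = 0 :> int)//.
rewrite add0r (voa_creation omega).1 !((voa_creation omega).2)// (lin0 (Yl.2 _ _)) subr0.
rewrite scaler0 add0r /= (omega_mode voa_vmod) /cas_sum.
have fst a : evsum (fun i : nat => AV a (-1 - i%:Z) (AV (dual a) (3 + i%:Z) omega)) = 0.
  rewrite -[RHS](evsum0 V); apply: eq_evsum => j.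
  by rewrite current2_omega// (lin0 (currentV_rep.1 _ _)).
have snd a : evsum (fun i : nat => AV (dual a) (3 - 1 - i%:Z) (AV a i%:Z omega)) =
    (k%:R * frm C (dual a) a) *: vac.
  rewrite (@evsum1 _ _ _ 1%N).
    by rewrite current1_omega (_ : 3 - 1 - 1%:Z = 1)// current1_state.
  case=> [|[//|j]] _; first by rewrite current0_omega (lin0 (currentV_rep.1 _ _)).
  by rewrite current2_omega// (lin0 (currentV_rep.1 _ _)).
rewrite -/AV !fst !snd !add0r /= scalerA -!scalerDl scalerA => /eqP.
rewrite -subr_eq0 -scalerBl scaler_eq0 => /orP[|/eqP/vac_neq0//].
rewrite subr_eq0 /sg => /eqP e.
have six : (2 ^+ 3 - 2)%:~R / 12%:R * central_charge V = central_charge V / 2%:R.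
  by rewrite (_ : 2 ^+ 3 - 2 = 6%:Z)//; field.
have {}e : central_charge V / 2%:R = (2%:R * (k + 2)%N%:R)^-1 * (k%:R * 1 + k%:R * 1 + 2^-1 * (k%:R * 2)).
  by rewrite -six -e.
have -> : central_charge V = 2%:R * (central_charge V / 2%:R) by field.
rewrite e natrM; move: k2_neq0; rewrite !natrD => K0; field.
by rewrite K0.
Qed.

End Sugawara.

(** * The twisted vertex operator *)

Section ExpOperators.
Variables (C : numFieldType) (M : lmodType C) (g : nat -> M -> M).
Hypothesis g_lin : forall j, linear (g j).

(** Course-of-values recursion from z E' = (sum of g_j z^j) E, that is n E_n = g_1 E_{n-1} + ... +
    g_n E_0; the list stores the earlier coefficients. *)
Fixpoint expop_seq (n : nat) (x : M) : seq M :=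
  if n is n'.+1 then
    let s := expop_seq n' x in
    rcons s (if n' is m.+1 then
      n'%:R^-1 *: \sum_(j < n') g j.+1 (nth 0 s (m - j)%N) else x)
  else [::].

(* The coefficient of z^n in exp(\sum_(j > 0) g_j z^j / j). *)
Definition expop n x := nth 0 (expop_seq n.+1 x) n.

Lemma size_expop_seq n x : size (expop_seq n x) = n.
Proof. by elim: n => //= n IHn; rewrite size_rcons IHn. Qed.

Lemma nth_expop_seq n m x : (m < n)%N -> nth 0 (expop_seq n x) m = expop m x.
Proof.
elim: n => // n IHn; rewrite ltnS leq_eqVlt => /orP[/eqP->//|mn].
by rewrite [expop_seq _ _]/= nth_rcons size_expop_seq mn IHn.
Qed.

Lemma expop0 x : expop 0 x = x. Proof. by []. Qed.

Lemma expopS n x : n.+1%:R *: expop n.+1 x = \sum_(j < n.+1) g j.+1 (expop (n - j) x).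
Proof.
rewrite /expop; set s := expop_seq n.+1 x.
have -> : expop_seq n.+2 x =
    rcons s (n.+1%:R^-1 *: \sum_(j < n.+1) g j.+1 (nth 0 s (n - j)%N)) by [].
rewrite nth_rcons size_expop_seq ltnn eqxx scalerA mulfV ?scale1r ?pnatr_eq0//.
apply: eq_bigr => j _; congr (g _ _).
by apply: nth_expop_seq; rewrite ltnS leq_subr.
Qed.

Lemma expop_ind (P : nat -> Prop) :
  (forall n, (forall m, (m < n)%N -> P m) -> P n) -> forall n, P n.
Proof.
move=> h n; apply: (h); elim: n => // n IHn m; rewrite ltnS leq_eqVlt.
by move=> /orP[/eqP->|]; [exact: h|exact: IHn].
Qed.

Lemma expop_lin n : linear (expop n).
Proof.
elim/expop_ind: n => -[_ //|n] IHn c x y.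
have n1 : n.+1%:R != 0 :> C by rewrite pnatr_eq0.
apply: (scalerI n1); rewrite scalerDr scalerA mulrC -scalerA !expopS.
rewrite scaler_sumr -big_split; apply: eq_bigr => j _ /=.
have lt : (n - j < n.+1)%N by rewrite ltnS leq_subr.
by rewrite (IHn _ lt) g_lin.
Qed.

Definition expop_pred n x := if n is m.+1 then expop m x else 0.

Lemma expop_pred_sum n x : \sum_(j < n.+1) g j.+1 (expop_pred (n - j) x) = n%:R *: expop n x.
Proof.
rewrite big_ord_recr/= subnn/= (lin0 (g_lin _)) addr0.
case: n => [|n]; first by rewrite big_ord0 scale0r.
rewrite expopS; apply: eq_bigr => j _; rewrite subSn//.
by rewrite -ltnS.
Qed.

Lemma telescope_sub (t : nat -> M) n :
  \sum_(j < n.+1) (t j - (if j == n :> nat then 0 else t j.+1)) = t 0%N.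
Proof.
rewrite big_ord_recr/= eqxx subr0.
have -> : \sum_(j < n) (t j - (if j == n :> nat then 0 else t j.+1)) =
          \sum_(j < n) - (t j.+1 - t j).
  by apply: eq_bigr => j _; rewrite ltn_eqF// opprB.
by rewrite sumrN -(big_mkord predT (fun j => t j.+1 - t j)) telescope_sumr// opprB subrK.
Qed.

Variables (eta : int) (X : int -> M -> M).
Hypothesis X_lin : forall m, linear (X m).

(** Conjugation multiplies X by exp of the sum of t^j / j, which is 1 / (1 - t); clearing this
    denominator leaves two terms. At the level of coefficients the induction multiplies by [n.+1]
    and telescopes. *)
Lemma expop_plus :
  (forall j m x, g j.+1 (X m x) = X m (g j.+1 x) + X (m + eta * j.+1%:Z) x) ->
  forall n m x, X m (expop n x) = expop n (X m x) - expop_pred n (X (m + eta) x).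
Proof.
move=> gX; elim/expop_ind => -[_ m x|n IHn m x].
  by rewrite !expop0 subr0.
have n1 : n.+1%:R != 0 :> C by rewrite pnatr_eq0.
apply: (scalerI n1); rewrite -(linZ (X_lin m)) scalerBr !expopS /=.
rewrite (lin_sum (X_lin m)).
have -> : \sum_(j < n.+1) X m (g j.+1 (expop (n - j) x)) =
  \sum_(j < n.+1) (g j.+1 (expop (n - j) (X m x)) - g j.+1 (expop_pred (n - j) (X (m + eta) x))
   - X (m + eta * j.+1%:Z) (expop (n - j) x)).
  apply: eq_bigr => j _; apply/eqP; rewrite -(linB (g_lin _)) eq_sym subr_eq -gX.
  by rewrite IHn// ltnS leq_subr.
rewrite !sumrB expop_pred_sum -addrA; congr (_ + _).
rewrite -opprD -[in RHS](addn1 n) natrD scalerDl scale1r; congr (- (_ + _)).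
pose t j := expop (n - j) (X (m + eta * j.+1%:Z) x).
transitivity (t 0%N); last by rewrite /t subn0 mulr1.
rewrite -(telescope_sub t n).
apply: eq_bigr => j _; rewrite IHn ?ltnS ?leq_subr// /t; congr (_ - _).
have [->|jn] := eqVneq (j : nat) n; first by rewrite subnn.
have {}jn : (j < n)%N by rewrite ltn_neqAle jn -ltnS ltn_ord.
rewrite -(subnSK jn)/=; congr (expop _ (X _ _)).
by rewrite (_ : j.+2%:Z = j.+1%:Z + 1) ?mulrDr ?mulr1 ?addrA//; lia.
Qed.

Lemma expop_minus :
  (forall j m x, g j.+1 (X m x) = X m (g j.+1 x) - X (m + eta * j.+1%:Z) x) ->
  forall n m x, expop n (X m x) = X m (expop n x) - X (m + eta) (expop_pred n x).
Proof.
move=> gX; elim/expop_ind => -[_ m x|n IHn m x].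
  by rewrite !expop0 /= (lin0 (X_lin _)) subr0.
have n1 : n.+1%:R != 0 :> C by rewrite pnatr_eq0.
apply: (scalerI n1); rewrite scalerBr -!(linZ (X_lin _)) !expopS /=.
have -> : \sum_(j < n.+1) g j.+1 (expop (n - j) (X m x)) =
  \sum_(j < n.+1) (X m (g j.+1 (expop (n - j) x)) - X (m + eta) (g j.+1 (expop_pred (n - j) x))
   - (X (m + eta * j.+1%:Z) (expop (n - j) x)
      - X (m + eta * j.+2%:Z) (expop_pred (n - j) x))).
  apply: eq_bigr => j _; rewrite IHn ?ltnS ?leq_subr// (linB (g_lin _)) !gX.
  rewrite subrBB; congr (_ - (_ - X _ _)).
  by rewrite (_ : j.+2%:Z = j.+1%:Z + 1) ?mulrDr ?mulr1 1?addrAC ?addrA//; lia.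
rewrite sumrB [X in X - _]sumrB -!(lin_sum (X_lin _)) expop_pred_sum -addrA; congr (_ + _).
rewrite -opprD -[in RHS](addn1 n) natrD scalerDl scale1r (linD (X_lin _)); congr (- (_ + _)).
pose t j := X (m + eta * j.+1%:Z) (expop (n - j) x).
transitivity (t 0%N); last by rewrite /t subn0 mulr1.
rewrite -(telescope_sub t n).
apply: eq_bigr => j _; rewrite /t; congr (_ - _).
have [->|jn] := eqVneq (j : nat) n; first by rewrite subnn /= (lin0 (X_lin _)).
have {}jn : (j < n)%N by rewrite ltn_neqAle jn -ltnS ltn_ord.
by rewrite -(subnSK jn)/=.
Qed.

Lemma expop_shift (d : M -> M) (s : int) : linear d ->
  (forall j x, d (g j.+1 x) = g j.+1 (d x) + (s * j.+1%:Z)%:~R *: g j.+1 x) ->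
  forall n x, d (expop n x) = expop n (d x) + (s * n%:Z)%:~R *: expop n x.
Proof.
move=> dl dg; elim/expop_ind => -[_ x|n IHn x].
  by rewrite !expop0 mulr0 scale0r addr0.
have n1 : n.+1%:R != 0 :> C by rewrite pnatr_eq0.
apply: (scalerI n1); rewrite -(linZ dl) scalerDr scalerA [_%:R * _]mulrC -scalerA !expopS.
rewrite (lin_sum dl) scaler_sumr -big_split; apply: eq_bigr => j _ /=.
rewrite dg IHn ?ltnS ?leq_subr// (linD (g_lin _)) (linZ (g_lin _)) -addrA -scalerDl.
congr (_ + _ *: _); rewrite -intrD -mulrDr; congr ((s * _)%:~R).
by have := ltn_ord j; lia.
Qed.

End ExpOperators.

Section UniformTruncation.
Variables (C : numFieldType) (M : lmodType C).

Lemma trunc_unif (f : nat -> int -> M) (K : nat) :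
  (forall i n, (K <= i)%N -> f i n = 0) -> (forall i, trunc_above (f i)) ->
  exists n0 : int, forall i n, n0 <= n -> f i n = 0.
Proof.
move=> fK ft.
have [n0 h] : exists n0 : int, forall i n, (i < K)%N -> n0 <= n -> f i n = 0.
  elim: K {fK} => [|K [n1 h1]]; first by exists 0.
  have [n2 h2] := ft K; exists (Num.max n1 n2) => i n.
  rewrite ltnS leq_eqVlt ge_max => /orP[/eqP->|iK] /andP[? ?]; [exact: h2|exact: h1].
exists n0 => i n nn0; have [Ki|iK] := leqP K i; [exact: fK|exact: h].
Qed.

Lemma trunc_shift (f : int -> M) (s : int) : trunc_above f -> trunc_above (fun n => f (n + s)).
Proof. by move=> [n0 h]; exists (n0 - s) => n nn; apply: h; lia. Qed.

Lemma half_trunc_snd (H : int -> int -> M) l : trunc_snd H ->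
  exists n0 : int, forall m n, n0 <= n -> half H l m n = 0.
Proof.
move=> [n0 h]; exists n0 => m n nn; rewrite /half -[RHS](evsum0 M).
by apply: eq_evsum => i; rewrite h ?scaler0//; lia.
Qed.

Lemma half_trunc_fst (H : int -> int -> M) l n : trunc_snd H ->
  (forall b, trunc_above (fun a => H a b)) -> trunc_above (fun m => half H l m n).
Proof.
move=> tH hH; have [K hK] := half_supp l 0 n tH.
have [b0 hb] := tH.
have [m0 h] := @trunc_unif (fun i m => H (l + m - i%:Z) (n + i%:Z)) `|b0 - n|%N
  (fun i m ib => hb _ _ (int_absorb ib))
  (fun i => ltac:(have [a0 ha] := hH (n + i%:Z); exists (a0 - l + i%:Z) => m mm; apply: ha; lia)).
exists m0 => m mm; rewrite /half -[RHS](evsum0 M); apply: eq_evsum => i.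
by rewrite h// scaler0.
Qed.

Lemma lhs3_trunc (K : int -> int -> M) l m : trunc_fst K ->
  (forall a, trunc_above (K a)) -> trunc_above (fun n => lhs3 K l m n).
Proof.
move=> [a0 ha] hK.
have [n0 h] := @trunc_unif (fun i n => K (l + i%:Z) (m + n - i%:Z)) `|a0 - l|%N
  (fun i n ia => ha _ _ (int_absorb ia))
  (fun i => ltac:(have [b0 hb] := hK (l + i%:Z); exists (b0 - m + i%:Z) => n nn; apply: hb; lia)).
exists n0 => n nn; rewrite /lhs3 -[RHS](evsum0 M); apply: eq_evsum => i.
by rewrite h// scaler0.
Qed.

Lemma half1 (H : int -> int -> M) m n : trunc_snd H ->
  half H 1 m n = H (m + 1) n - H m (n + 1).
Proof. by move=> tH; rewrite -[1]add0r (half_rec tH) !half0. Qed.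

End UniformTruncation.

(** * Commutation of e and f with the twisting exponentials *)

Section TwistedJacobi.
Variables (C : numFieldType) (k : nat) (V : voa C) (J : {linear 'M[C]_2 -> V}).
Variables (M : lmodType C) (Y : V -> int -> M -> M).
Hypothesis hY : vmod Y.
Let A := current J Y.
Let AV := current J (@voaY C V).
Hypothesis repA : hat_rep k%:R A.

Let Yl := vmod_lin hY.
Let Yt := vmod_trunc hY.
Let Al := repA.1.

(** The factor 1/2 makes e and f have eigenvalues 1 and -1 under h/2, so that conjugation by the
    exponentials produces exactly a linear factor or its inverse. *)
Definition gminus (j : nat) (x : M) : M := 2^-1 *: A LH (- j%:Z) x.
Definition gplus (j : nat) (x : M) : M := - 2^-1 *: A LH j%:Z x.
Definition Eminus := expop gminus.
Definition Eplus := expop gplus.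

Lemma gminus_lin j : linear (gminus j).
Proof. by move=> c x y; rewrite /gminus Al scalerDr !scalerA mulrC. Qed.

Lemma gplus_lin j : linear (gplus j).
Proof. by move=> c x y; rewrite /gplus Al scalerDr !scalerA mulrC. Qed.

Lemma half_two : 2^-1 * 2 = 1 :> C.
Proof. by rewrite mulVf// pnatr_eq0. Qed.

Lemma gminus_op a j m x : a <> LH -> gminus j.+1 (A a m x) =
  A a m (gminus j.+1 x) + (2^-1 * brc C LH a) *: A a (m + -1 * j.+1%:Z) x.
Proof.
move=> aH; rewrite /gminus repA.2 (linZ (Al _ _)) !scalerDr scalerA.
rewrite (_ : frm C LH a = 0); last by case: a aH.
rewrite mulr0 mul0r if_same scale0r scaler0 addr0; congr (_ + _ *: _).
by rewrite (_ : br LH a = a) ?mulN1r 1?addrC//; case: a aH.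
Qed.

Lemma gplus_op a j m x : a <> LH -> gplus j.+1 (A a m x) =
  A a m (gplus j.+1 x) - (2^-1 * brc C LH a) *: A a (m + 1 * j.+1%:Z) x.
Proof.
move=> aH; rewrite /gplus repA.2 (linZ (Al _ _)) !scalerDr scalerA.
rewrite (_ : frm C LH a = 0); last by case: a aH.
rewrite mulr0 mul0r if_same scale0r scaler0 addr0 mulNr scaleNr; congr (_ - _ *: _).
by rewrite (_ : br LH a = a) ?mul1r 1?addrC//; case: a aH.
Qed.

Lemma Eminus_E n m x : A LE m (Eminus n x) =
  Eminus n (A LE m x) - expop_pred gminus n (A LE (m - 1) x).
Proof.
apply: (expop_plus gminus_lin (Al LE)) => j m' x'.
by rewrite gminus_op// half_two scale1r.
Qed.

Lemma Eminus_F n m x : Eminus n (A LF m x) =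
  A LF m (Eminus n x) - A LF (m - 1) (expop_pred gminus n x).
Proof.
apply: (expop_minus gminus_lin (Al LF)) => j m' x'.
by rewrite gminus_op//= mulrN half_two scaleN1r.
Qed.

Lemma Eplus_E n m x : Eplus n (A LE m x) =
  A LE m (Eplus n x) - A LE (m + 1) (expop_pred gplus n x).
Proof.
apply: (expop_minus gplus_lin (Al LE)) => j m' x'.
by rewrite gplus_op//= half_two scale1r.
Qed.

Lemma Eplus_F n m x : A LF m (Eplus n x) =
  Eplus n (A LF m x) - expop_pred gplus n (A LF (m + 1) x).
Proof.
apply: (expop_plus gplus_lin (Al LF)) => j m' x'.
by rewrite gplus_op//= mulrN half_two scaleN1r opprK.
Qed.

Lemma Eminus_lin n : linear (Eminus n). Proof. exact/expop_lin/gminus_lin. Qed.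
Lemma Eplus_lin n : linear (Eplus n). Proof. exact/expop_lin/gplus_lin. Qed.

Lemma expop_pred_lin g n : (forall j, linear (g j : M -> M)) -> linear (expop_pred g n).
Proof.
move=> gl; case: n => [|n] c x y /=; first by rewrite scaler0 addr0.
exact: expop_lin.
Qed.

(* The product of E^-(z) with a field G(z) = \sum_n G n z^(-n-1). *)
Definition mulEminus (G : int -> M) (n : int) : M :=
  evsum (fun a : nat => Eminus a (G (n + a%:Z))).

Lemma mulEminus_supp G n : trunc_above G ->
  finsupp (fun a : nat => Eminus a (G (n + a%:Z))).
Proof.
move=> [n0 h]; exists `|n0 - n|%N => i ib.
by rewrite h ?int_absorb// (lin0 (Eminus_lin _)).
Qed.

Lemma mulEminus_lin (c : C) G H n : trunc_above G -> trunc_above H ->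
  mulEminus (fun n => c *: G n + H n) n = c *: mulEminus G n + mulEminus H n.
Proof.
move=> tG tH; rewrite /mulEminus -evsumZ; last exact: mulEminus_supp.
rewrite -evsumD; [|exact: (finsuppcZ c (mulEminus_supp n tG))|exact: mulEminus_supp].
by apply: eq_evsum => i; rewrite Eminus_lin.
Qed.

Lemma mulEminus_shift G n s :
  mulEminus (fun n => G (n + s)) n = mulEminus G (n + s).
Proof. by rewrite /mulEminus; apply: eq_evsum => i; congr (Eminus i (G _)); lia. Qed.

Lemma mulEminus_pred G n : trunc_above G ->
  evsum (fun a : nat => expop_pred gminus a (G (n + a%:Z))) = mulEminus G (n + 1).
Proof.
move=> [n0 h]; rewrite evsum_recl; last first.
  exists `|n0 - n|%N => i ib.
  by rewrite h ?int_absorb// (lin0 (expop_pred_lin _ gminus_lin)).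
rewrite /= add0r; apply: eq_evsum => i; congr (Eminus i (G _)); lia.
Qed.

Lemma trunc_op a m G : trunc_above G -> trunc_above (fun n => A a m (G n)).
Proof. by move=> [n0 h]; exists n0 => n /h ->; rewrite (lin0 (Al _ _)). Qed.

Lemma mulEminus_E G m n : trunc_above G -> A LE (m + 1) (mulEminus G n) =
  mulEminus (fun n => A LE (m + 1) (G n)) n - mulEminus (fun n => A LE m (G n)) (n + 1).
Proof.
move=> tG; have tG1 := trunc_op LE (m + 1) tG; have tG0 := trunc_op LE m tG.
rewrite /mulEminus (evsum_lin (Al _ _)); last exact: mulEminus_supp.
rewrite -[X in _ = _ - X](mulEminus_pred _ tG0).
have fp : finsupp (fun a : nat => expop_pred gminus a (A LE m (G (n + a%:Z)))).
  have [n0 h] := tG; exists `|n0 - n|%N => i ib.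
  by rewrite h ?int_absorb// (lin0 (Al _ _)) (lin0 (expop_pred_lin _ gminus_lin)).
rewrite -(evsumN fp) -evsumD; [|exact: (mulEminus_supp n tG1)|]; last first.
  by have [K h] := fp; exists K => i /h ->; rewrite oppr0.
by apply: eq_evsum => a; rewrite Eminus_E addrK.
Qed.

Lemma mulEminus_F G m n : trunc_above G -> mulEminus (fun n => A LF m (G n)) n =
  A LF m (mulEminus G n) - A LF (m - 1) (mulEminus G (n + 1)).
Proof.
move=> tG; rewrite -(mulEminus_pred n tG) /mulEminus.
have fp : finsupp (fun a : nat => expop_pred gminus a (G (n + a%:Z))).
  have [n0 h] := tG; exists `|n0 - n|%N => i ib.
  by rewrite h ?int_absorb// (lin0 (expop_pred_lin _ gminus_lin)).
rewrite (evsum_lin (Al _ _)); last exact: mulEminus_supp.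
rewrite (evsum_lin (Al _ _) fp).
have fp1 : finsupp (fun i : nat => A LF (m - 1) (expop_pred gminus i (G (n + i%:Z)))).
  by have [K h] := fp; exists K => i /h ->; rewrite (lin0 (Al _ _)).
rewrite -(evsumN fp1) -evsumD.
- by apply: eq_evsum => a; rewrite Eminus_F.
- by have [K h] := mulEminus_supp n tG; exists K => i /h ->; rewrite (lin0 (Al _ _)).
- by have [K h] := fp1; exists K => i /h ->; rewrite oppr0.
Qed.

(** Finitely many members, each truncated: the shape of the family of fields obtained by applying
    Y(u, z) to the coefficients E^+_b y. *)
Definition fam (F : nat -> int -> M) :=
  (exists b0, forall b n, (b0 <= b)%N -> F b n = 0) /\ (forall b, trunc_above (F b)).

Lemma fam_ext (F G : nat -> int -> M) : (forall b n, F b n = G b n) -> F = G.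
Proof. by move=> FG; apply/funext => b; apply/funext. Qed.

Definition sumfam (mu : int) (F : nat -> int -> M) (n : int) : M :=
  evsum (fun b : nat => F b (n + mu - b%:Z)).

Lemma sumfam_supp mu F n : fam F -> finsupp (fun b : nat => F b (n + mu - b%:Z)).
Proof. by move=> [[b0 h] _]; exists b0 => b bb; exact: h. Qed.

Lemma fam_unif F : fam F -> exists n0 : int, forall b n, n0 <= n -> F b n = 0.
Proof. by move=> [[b0 h] t]; exact: (trunc_unif (fun i n hi => h i n hi) t). Qed.

Lemma fam_shift F : fam F -> fam (fun b n => F b (n + 1)).
Proof.
by move=> [[b0 h] t]; split=> [|b]; [exists b0 => b n /h ->|exact: trunc_shift].
Qed.

Lemma sumfam_trunc mu F : fam F -> trunc_above (sumfam mu F).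
Proof.
move=> fF; have [[b0 h] t] := fF; have [n0 h0] := fam_unif fF.
exists (n0 - mu + b0%:Z) => n nn; rewrite /sumfam -[RHS](evsum0 M).
apply: eq_evsum => b; have [bb|bb] := leqP b0 b; first exact: h.
by apply: h0; lia.
Qed.

Lemma sumfam_lin (c : C) mu F G n : fam F -> fam G ->
  sumfam mu (fun b n => c *: F b n + G b n) n = c *: sumfam mu F n + sumfam mu G n.
Proof.
move=> fF fG; rewrite /sumfam -(evsumZ c (sumfam_supp mu n fF)).
by rewrite -(evsumD (finsuppcZ c (sumfam_supp mu n fF)) (sumfam_supp mu n fG)).
Qed.

Lemma sumfam_shift mu F n : sumfam mu (fun b n => F b (n + 1)) n = sumfam mu F (n + 1).
Proof. by rewrite /sumfam; apply: eq_evsum => b; congr (F b _); lia. Qed.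

(** The sign replaces z^mu by (-z)^mu. Then e(z1) acquires the factor z1 - z2 on either side of the
    field, instead of z2 - z1 on the right, so the twist only shifts the index [l] of the Jacobi
    identity. *)
Definition vop (mu : int) (F : nat -> int -> M) (n : int) : M :=
  (-1) ^ mu *: mulEminus (sumfam mu F) n.

Lemma vop_lin (c : C) mu F G n : fam F -> fam G ->
  vop mu (fun b n => c *: F b n + G b n) n = c *: vop mu F n + vop mu G n.
Proof.
move=> fF fG; rewrite /vop scalerA mulrC -scalerA -scalerDr; congr (_ *: _).
rewrite -(mulEminus_lin c n (sumfam_trunc mu fF) (sumfam_trunc mu fG)).
by rewrite (funext (fun j => sumfam_lin c mu j fF fG)).
Qed.

Lemma vop_shift mu F n : vop mu (fun b n => F b (n + 1)) n = vop mu F (n + 1).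
Proof.
rewrite /vop -(mulEminus_shift _ n 1).
by rewrite (funext (fun j => sumfam_shift mu F j)).
Qed.

Lemma vop_sub mu F G n : fam F -> fam G ->
  vop mu (fun b n => F b n - G b n) n = vop mu F n - vop mu G n.
Proof.
move=> fF fG.
have -> : (fun b n => F b n - G b n) = (fun b n => -1 *: G b n + F b n).
  by apply: fam_ext => b j; rewrite scaleN1r addrC.
by rewrite (vop_lin _ _ _ fG fF) scaleN1r addrC.
Qed.

Lemma vop0 mu F n : (forall b n, F b n = 0) -> vop mu F n = 0.
Proof.
move=> F0; rewrite /vop /mulEminus /sumfam.
under eq_evsum => a.
  under eq_evsum do rewrite F0.
  rewrite evsum0 (lin0 (Eminus_lin a)); over.
by rewrite evsum0 scaler0.
Qed.

Lemma vop_trunc mu F (n0 : int) (b0 : nat) : (forall b n, n0 <= n -> F b n = 0) ->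
  (forall b n, (b0 <= b)%N -> F b n = 0) ->
  forall n, n0 - mu + b0%:Z <= n -> vop mu F n = 0.
Proof.
move=> h hb n nn; rewrite /vop /mulEminus /sumfam.
under eq_evsum => a.
  under eq_evsum => b.
    rewrite (_ : F b _ = 0); first over.
    have [bb|bb] := leqP b0 b; first exact: hb.
    by apply: h; lia.
  rewrite evsum0 (lin0 (Eminus_lin a)); over.
by rewrite evsum0 scaler0.
Qed.

Lemma vop_rec mu s (D : nat -> int -> int -> int -> M) : (forall b, rec3 (D b)) ->
  (forall l m, fam (fun b n => D b l m n)) ->
  rec3 (fun l m n => vop mu (fun b n' => D b (l + s) m n') n).
Proof.
move=> Dr Df l m n; rewrite -vop_shift -(vop_sub _ _ (Df _ _) (fam_shift (Df _ _))).
have -> : (fun b n' => D b (l + 1 + s) m n') =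
    (fun b n' => D b (l + s) (m + 1) n' - D b (l + s) m (n' + 1)) => [|//].
by apply: fam_ext => b n'; rewrite -Dr (_ : l + 1 + s = l + s + 1)//; lia.
Qed.

Lemma vop_E mu F m n : fam F -> A LE (m + 1) (vop mu F n) =
  vop mu (fun b n => A LE (m + 1) (F b n) - A LE m (F b (n + 1))) n.
Proof.
move=> fF.
have fop j F' : fam F' -> fam (fun b n => A LE j (F' b n)).
  move=> [[b0 h] t]; split=> [|b]; last exact: trunc_op.
  by exists b0 => b n' /h ->; rewrite (lin0 (Al _ _)).
rewrite (vop_sub mu n (fop (m + 1) _ fF) (fop m _ (fam_shift fF))).
rewrite (vop_shift mu (fun b n => A LE m (F b n)) n) /vop (linZ (Al _ _)).
rewrite (mulEminus_E _ _ (sumfam_trunc mu fF)) scalerBr.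
have e j : (fun n => A LE j (sumfam mu F n)) = sumfam mu (fun b n => A LE j (F b n)).
  by apply/funext => i; rewrite /sumfam (evsum_lin (Al _ _))//; exact: sumfam_supp.
by rewrite !e.
Qed.

Lemma vop_F mu F m n : fam F -> vop mu (fun b n => A LF m (F b n)) n =
  A LF m (vop mu F n) - A LF (m - 1) (vop mu F (n + 1)).
Proof.
move=> fF; rewrite /vop !(linZ (Al _ _)) -scalerBr; congr (_ *: _).
rewrite -(mulEminus_F _ _ (sumfam_trunc mu fF)).
have -> : sumfam mu (fun b n => A LF m (F b n)) = (fun n => A LF m (sumfam mu F n)).
  by apply/funext => i; rewrite /sumfam (evsum_lin (Al _ _))//; exact: sumfam_supp.
by [].
Qed.

Hypothesis Eplus_trunc : forall y, exists b0, forall b, (b0 <= b)%N -> Eplus b y = 0.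

(* On vectors y of h_0-weight 2 mu this is the coefficient of z^(-n-1) in
   E^-(z) Y(u, z) E^+(z) (-z)^(h_0 / 2) y. *)
Definition Phi mu u y : int -> M := vop mu (fun b n => Y u n (Eplus b y)).

Lemma fam_Eplus (X : int -> M -> M) y : (forall n, linear (X n)) ->
  (forall x, trunc_above (fun n => X n x)) -> fam (fun b n => X n (Eplus b y)).
Proof.
move=> Xl Xt; split=> [|b]; last exact: Xt.
by have [b0 h] := Eplus_trunc y; exists b0 => b n /h ->; rewrite (lin0 (Xl n)).
Qed.

Lemma Y_op_lin u a m n : linear (fun x => Y u n (A a m x)).
Proof. by move=> c x y; rewrite Al (Yl.2 u n). Qed.

Lemma fam_Y u y : fam (fun b n => Y u n (Eplus b y)).
Proof. by apply: (fam_Eplus (X := Y u)) => [n|x]; [exact: Yl.2|exact: Yt]. Qed.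

Lemma fam_Y_op u a m y : fam (fun b n => Y u n (A a m (Eplus b y))).
Proof.
apply: (fam_Eplus (X := fun n x => Y u n (A a m x))) => [n|x]; first exact: Y_op_lin.
exact: Yt.
Qed.

Lemma sgnS (mu : int) : (-1) ^ (mu + 1) = - (-1) ^ mu :> C.
Proof. by rewrite exprzDr ?unitrN1// expr1z mulrN1. Qed.

Lemma sgnP (mu : int) : (-1) ^ (mu - 1) = - (-1) ^ mu :> C.
Proof. by rewrite -[in RHS](subrK 1 mu) sgnS opprK. Qed.

Lemma Phi_E mu u y m n : Phi (mu + 1) u (A LE m y) n =
  - (vop mu (fun b n => Y u n (A LE m (Eplus b y))) (n + 1)
     - vop mu (fun b n => Y u n (A LE (m + 1) (Eplus b y))) n).
Proof.
rewrite /Phi -(vop_shift mu) -(vop_sub _ _ (fam_shift (fam_Y_op u LE m y)) (fam_Y_op u LE (m + 1) y)).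
rewrite /vop sgnS scaleNr; congr (- (_ *: _)).
set G1 := sumfam _ _; set G2 := sumfam _ _; suff -> : G1 = G2 by [].
apply/funext => j; rewrite {}/G1 {}/G2.
have f1 := sumfam_supp (mu + 1) j (fam_Y_op u LE m y).
have fp : finsupp (fun b : nat => Y u (j + (mu + 1) - b%:Z) (A LE (m + 1) (expop_pred gplus b y))).
  have [b0 h] := Eplus_trunc y; exists b0.+1 => -[//|b] /h /= hb.
  by rewrite -/Eplus hb (lin0 (Y_op_lin _ _ _ _)).
transitivity (evsum (fun b : nat => Y u (j + (mu + 1) - b%:Z) (A LE m (Eplus b y))) -
   evsum (fun b : nat => Y u (j + (mu + 1) - b%:Z) (A LE (m + 1) (expop_pred gplus b y)))).
  rewrite -(evsumN fp) -(evsumD f1); last first.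
    by have [K h] := fp; exists K => i /h ->; rewrite oppr0.
  by apply: eq_evsum => b; rewrite Eplus_E (linB (Yl.2 u _)).
rewrite (evsum_recl fp) /= (lin0 (Y_op_lin _ _ _ _)) add0r.
have f2 := sumfam_supp mu j (fam_Y_op u LE (m + 1) y).
have -> : evsum (fun i : nat => Y u (j + (mu + 1) - i.+1%:Z) (A LE (m + 1) (Eplus i y))) =
    sumfam mu (fun b n => Y u n (A LE (m + 1) (Eplus b y))) j.
  by apply: eq_evsum => b; congr (Y u); lia.
have -> : evsum (fun b : nat => Y u (j + (mu + 1) - b%:Z) (A LE m (Eplus b y))) =
    sumfam mu (fun b n => Y u (n + 1) (A LE m (Eplus b y))) j.
  by apply: eq_evsum => b; congr (Y u); lia.
rewrite addrC -scaleN1r -(sumfam_lin _ _ _ (fam_Y_op u LE (m + 1) y) (fam_shift (fam_Y_op u LE m y))).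
by apply: eq_evsum => b; rewrite scaleN1r addrC.
Qed.

(** For f the twist divides by z1 - z2, so the factor is stated on the twisted side, whereas [Phi_E]
    has it on the untwisted one. *)
Lemma Phi_F mu u y m n : vop mu (fun b n => Y u n (A LF m (Eplus b y))) n =
  - (Phi (mu - 1) u (A LF m y) (n + 1) - Phi (mu - 1) u (A LF (m + 1) y) n).
Proof.
rewrite /Phi -(vop_shift (mu - 1)) -(vop_sub _ _ (fam_shift (fam_Y u (A LF m y))) (fam_Y u (A LF (m + 1) y))).
rewrite /vop sgnP scaleNr opprK; congr (_ *: _).
set G1 := sumfam _ _; set G2 := sumfam _ _; suff -> : G1 = G2 by [].
apply/funext => j; rewrite {}/G1 {}/G2.
have f1 := sumfam_supp mu j (fam_Y u (A LF m y)).
have fp : finsupp (fun b : nat => Y u (j + mu - b%:Z) (expop_pred gplus b (A LF (m + 1) y))).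
  have [b0 h] := Eplus_trunc (A LF (m + 1) y); exists b0.+1 => -[//|b] /h /= hb.
  by rewrite -/Eplus hb (lin0 (Yl.2 _ _)).
transitivity (evsum (fun b : nat => Y u (j + mu - b%:Z) (Eplus b (A LF m y))) -
   evsum (fun b : nat => Y u (j + mu - b%:Z) (expop_pred gplus b (A LF (m + 1) y)))).
  rewrite -(evsumN fp) -(evsumD f1); last first.
    by have [K h] := fp; exists K => i /h ->; rewrite oppr0.
  by apply: eq_evsum => b; rewrite Eplus_F (linB (Yl.2 u _)).
rewrite (evsum_recl fp) /= (lin0 (Yl.2 _ _)) add0r.
have -> : evsum (fun i : nat => Y u (j + mu - i.+1%:Z) (Eplus i (A LF (m + 1) y))) =
    sumfam (mu - 1) (fun b n => Y u n (Eplus b (A LF (m + 1) y))) j.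
  by apply: eq_evsum => b; congr (Y u); lia.
have -> : evsum (fun b : nat => Y u (j + mu - b%:Z) (Eplus b (A LF m y))) =
    sumfam (mu - 1) (fun b n => Y u (n + 1) (Eplus b (A LF m y))) j.
  by apply: eq_evsum => b; congr (Y u); lia.
rewrite addrC -scaleN1r -(sumfam_lin _ _ _ (fam_Y u (A LF (m + 1) y)) (fam_shift (fam_Y u (A LF m y)))).
by apply: eq_evsum => b; rewrite scaleN1r addrC.
Qed.

End TwistedJacobi.

(** * Sums over the integers and decomposition into h_0-weights *)

Section IntSums.
Variables (C : numFieldType) (M : lmodType C).
Implicit Type c : int -> M.

Definition isum c : M := evsum (fun i : nat => c i%:Z) + evsum (fun i : nat => c (- i.+1%:Z)).

Definition ifin c := exists B : nat, forall mu : int, (B <= absz mu)%N -> c mu = 0.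

Lemma ifin_pos c : ifin c -> finsupp (fun i : nat => c i%:Z).
Proof. by move=> [B h]; exists B => i Bi; exact: h. Qed.

Lemma ifin_neg c : ifin c -> finsupp (fun i : nat => c (- i.+1%:Z)).
Proof. by move=> [B h]; exists B => i Bi; apply: h; lia. Qed.

Lemma isum_lin (a : C) c c' : ifin c -> ifin c' ->
  isum (fun mu => a *: c mu + c' mu) = a *: isum c + isum c'.
Proof.
move=> fc fc'; rewrite /isum scalerDr addrACA -(evsumZ a (ifin_pos fc)) -(evsumZ a (ifin_neg fc)).
rewrite -(evsumD (finsuppcZ a (ifin_pos fc)) (ifin_pos fc')).
by rewrite -(evsumD (finsuppcZ a (ifin_neg fc)) (ifin_neg fc')).
Qed.

Lemma ifin_lin (a : C) c c' : ifin c -> ifin c' -> ifin (fun mu => a *: c mu + c' mu).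
Proof.
move=> [B h] [B' h']; exists (maxn B B') => mu; rewrite geq_max => /andP[? ?].
by rewrite h// h'// scaler0 addr0.
Qed.

Lemma isum1 c mu0 : (forall mu, mu != mu0 -> c mu = 0) -> isum c = c mu0.
Proof.
move=> h; rewrite /isum; case: (intP mu0) h => [|n|n] h.
- rewrite (@evsum1 _ _ _ 0%N) => [|i i0]; last by apply: h; lia.
  rewrite (_ : evsum _ = 0) ?addr0// -[RHS](evsum0 M).
  by apply: eq_evsum => i; apply: h; lia.
- rewrite (@evsum1 _ _ _ n.+1) => [|i i0]; last by apply: h; lia.
  rewrite (_ : evsum _ = 0) ?addr0// -[RHS](evsum0 M).
  by apply: eq_evsum => i; apply: h; lia.
- rewrite (_ : evsum _ = 0) ?add0r; last first.
    by rewrite -[RHS](evsum0 M); apply: eq_evsum => i; apply: h; lia.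
  by rewrite (@evsum1 _ _ _ n) => [//|i i0]; apply: h; lia.
Qed.

Lemma isum_submod (S : M -> Prop) c : submod S -> ifin c -> (forall mu, S (c mu)) -> S (isum c).
Proof.
move=> Ss fc Sc; have [K hK] := ifin_pos fc; have [L hL] := ifin_neg fc.
rewrite /isum (evsumE hK (leqnn K)) (evsumE hL (leqnn L)).
by apply: (submodD Ss); apply: submod_sum.
Qed.

End IntSums.

Section WeightDecomposition.
Variables (C : numFieldType) (k : C) (M : lmodType C) (A : letter -> int -> M -> M).
Hypothesis repA : hat_rep k A.
Let Hl := repA.1 LH 0.

Definition weight_vec (mu : int) y := A LH 0 y = (2 * mu%:~R) *: y.

Definition decomposes y c :=
  [/\ forall mu, weight_vec mu (c mu), ifin c & y = isum c].

Lemma weight_vec0 mu : weight_vec mu 0.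
Proof. by rewrite /weight_vec (lin0 Hl) scaler0. Qed.

Lemma weight_vec_lin mu (a : C) y y' : weight_vec mu y -> weight_vec mu y' ->
  weight_vec mu (a *: y + y').
Proof.
move=> wy wy'; rewrite /weight_vec Hl wy wy' scalerDr.
by congr (_ + _); rewrite !scalerA (mulrC a).
Qed.

Lemma decomposes_lin (a : C) y y' c c' : decomposes y c -> decomposes y' c' ->
  decomposes (a *: y + y') (fun mu => a *: c mu + c' mu).
Proof.
move=> [w f ->] [w' f' ->]; split; last by rewrite isum_lin.
  by move=> mu; exact: weight_vec_lin.
exact: ifin_lin.
Qed.

Definition delta_at (mu0 : int) (y : M) (mu : int) : M := if mu == mu0 then y else 0.

Lemma decomposes_weight mu0 y : weight_vec mu0 y -> decomposes y (delta_at mu0 y).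
Proof.
move=> wy; split.
- by move=> mu; rewrite /delta_at; case: eqP => [->//|_]; exact: weight_vec0.
- exists (absz mu0).+1 => mu hmu; rewrite /delta_at; case: eqP => // e.
  by rewrite e ltnn in hmu.
- rewrite (@isum1 _ _ _ mu0); first by rewrite /delta_at eqxx.
  by move=> mu /negbTE; rewrite /delta_at => ->.
Qed.

(** The component at [mu0] is an h_0-eigenvector equal to minus the sum of the others, which is
    killed by a product of h_0 - 2 mu with mu different from [mu0]. *)
Lemma decomposes0 c : decomposes 0 c -> forall mu, c mu = 0.
Proof.
move=> [w [B f] s0] mu0.
pose r mu := if mu == mu0 then 0 else c mu.
have fr : ifin r by exists B => mu /f h; rewrite /r h if_same.
have fd : ifin (delta_at mu0 (c mu0)).
  exists (absz mu0).+1 => mu hmu; rewrite /delta_at; case: eqP => // e.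
  by rewrite e ltnn in hmu.
have e : isum c = 1 *: isum (delta_at mu0 (c mu0)) + isum r.
  rewrite -isum_lin//; congr isum; apply/funext => mu.
  by rewrite /delta_at /r; case: eqP => [->|_]; rewrite ?scale1r ?scaler0 ?addr0 ?add0r.
move: e; rewrite -s0 scale1r (@isum1 _ _ _ mu0); last first.
  by move=> mu /negbTE; rewrite /delta_at => ->.
rewrite {1}/delta_at eqxx => /esym/eqP; rewrite addr_eq0 => /eqP cr.
pose Lambda (e : C) := exists2 mu : int, mu != mu0 & e = 2 * mu%:~R.
apply: (@killed_eig0 _ _ _ Hl Lambda _ _ (w mu0)).
  rewrite cr; apply: (submodN (killed_submod Hl _)).
  apply: (isum_submod (killed_submod Hl _) fr) => mu; rewrite /r.
  case: eqP => [_|/eqP ne]; first exact: (killed_submod Hl _).1.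
  by apply: (killed_eig (w mu)); exists mu.
move=> [mu ne /eqP]; rewrite -subr_eq0 -mulrBr mulf_eq0 pnatr_eq0/= subr_eq0.
by rewrite eqr_int => /eqP e; rewrite e eqxx in ne.
Qed.

Lemma decomposes_uniq y c c' : decomposes y c -> decomposes y c' -> c = c'.
Proof.
move=> d d'; have := decomposes_lin (-1) d' d; rewrite scaleN1r addNr => /decomposes0 h.
by apply/funext => mu; apply/eqP; rewrite -subr_eq0 -scaleN1r addrC h.
Qed.

Lemma weight_generated v (mu : int) y : weight_vec mu v -> generated A v y ->
  exists c, decomposes y c.
Proof.
move=> wv g.
pose P y := exists c, decomposes y c.
have Ps : submod P.
  split; first by exists (delta_at 0 0); apply: decomposes_weight; exact: weight_vec0.
  by move=> a u u' [c dc] [c' dc']; eexists; exact: decomposes_lin dc dc'.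
apply: (g P Ps) => [a n u [c [w f ->]]|]; last first.
  by exists (delta_at mu v); exact: decomposes_weight.
pose S u := P (A a n u); apply: (@isum_submod _ _ S) => //.
  split; first by rewrite /S (lin0 (repA.1 a n)); exact: Ps.1.
  by move=> b x z Sx Sz; rewrite /S repA.1; exact: Ps.2.
move=> nu; have [s hs] : exists s : int, wt a = 2 * s.
  by case: a {S}; [exists 1|exists (-1)|exists 0].
exists (delta_at (nu + s) (A a n (c nu))); apply: decomposes_weight.
rewrite /weight_vec (H0_op repA) w (linZ (repA.1 a n)) -scalerDl; congr (_ *: _).
by rewrite hs intrM intrD mulrDr.
Qed.

End WeightDecomposition.

(** * The Jacobi identity for e and f against the twisted field *)

Section TwistedJacobi2.
Variables (C : numFieldType) (k : nat) (V : voa C) (J : {linear 'M[C]_2 -> V}).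
Variables (M : lmodType C) (Y : V -> int -> M -> M).
Hypothesis hY : vmod Y.
Let A := current J Y.
Let AV := current J (@voaY C V).
Hypothesis repA : hat_rep k%:R A.
Hypothesis Eplus_trunc : forall y, exists b0, forall b, (b0 <= b)%N -> Eplus J Y b y = 0.

Let Yl := vmod_lin hY.
Let Yt := vmod_trunc hY.
Let Al := repA.1.
Let Vt := @voa_truncation C V.
Let T := Eplus J Y.
Let vop' := vop J Y.
Let Phi' := Phi J Y.

Section Letter.
Variables (x : letter) (s la mu : int) (u : V) (y : M).
Hypothesis anchor_left : forall F m n, fam F ->
  half (fun a b => A x (a + s) (vop' mu F b)) la m n =
  vop' mu (fun b n' => half (fun a c => A x a (F b c)) (la + s) m n') n.
Hypothesis anchor_right : forall m n,
  (-1) ^ la *: half (fun a b => Phi' (mu + s) u (A x b y) a) la n m =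
  vop' mu (fun b n' => (-1) ^ (la + s) *:
    half (fun a c => Y u a (A x c (T b y))) (la + s) n' m) n.

Lemma Phi0 nu u' n : Phi' nu u' 0 n = 0.
Proof.
apply: (vop0 repA) => b n'.
by rewrite (lin0 (Eplus_lin repA b)) (lin0 (Yl.2 u' n')).
Qed.

Lemma Phi_lin nu u' n : linear (fun y => Phi' nu u' y n).
Proof.
move=> c z z'; rewrite /Phi' /Phi.
rewrite -(vop_lin repA c nu n (fam_Y hY Eplus_trunc u' z) (fam_Y hY Eplus_trunc u' z')).
congr (vop J Y nu _ n); apply: fam_ext => b n'.
by rewrite (Eplus_lin repA) (Yl.2 u' n').
Qed.

Lemma Phi_lin_u nu z n : linear (fun u => Phi' nu u z n).
Proof.
move=> c u1 u2; rewrite /Phi' /Phi.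
rewrite -(vop_lin repA c nu n (fam_Y hY Eplus_trunc u1 z) (fam_Y hY Eplus_trunc u2 z)).
congr (vop J Y nu _ n); apply: fam_ext => b n'.
by rewrite (Yl.1 n').
Qed.

Lemma Phi_trunc nu u' z : trunc_above (Phi' nu u' z).
Proof.
have f := fam_Y hY Eplus_trunc u' z; have [n0 h] := fam_unif f.
have [[b0 hb] _] := f.
by exists (n0 - nu + b0%:Z) => n; exact: (vop_trunc repA h hb).
Qed.

Lemma trunc_left_Phi : trunc_snd (fun a b => A x (a + s) (Phi' mu u y b)).
Proof.
by have [n0 h] := Phi_trunc mu u y; exists n0 => a b /h ->; rewrite (lin0 (Al _ _)).
Qed.

Lemma A_trunc z : trunc_above (fun n => A x n z).
Proof. exact: Yt. Qed.

Lemma trunc_right_Phi : trunc_snd (fun a b => Phi' (mu + s) u (A x b y) a).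
Proof. by have [n0 h] := A_trunc y; exists n0 => a b /h ->; rewrite Phi0. Qed.

Lemma T0_fam (F : M -> int -> M) : (forall n, F 0 n = 0) ->
  (forall z, trunc_above (F z)) -> fam (fun b n => F (T b y) n).
Proof.
move=> F0 Ft; split=> [|b]; last exact: Ft.
by have [b0 h] := Eplus_trunc y; exists b0 => b n bb; rewrite /T h.
Qed.

Lemma lhs3_eq0 (K : int -> int -> M) l m n : (forall a b, K a b = 0) -> lhs3 K l m n = 0.
Proof.
by move=> h; rewrite /lhs3 -[RHS](evsum0 M); apply: eq_evsum => i; rewrite h scaler0.
Qed.

Lemma half_eq0 (K : int -> int -> M) l m n : (forall a b, K a b = 0) -> half K l m n = 0.
Proof.
by move=> h; rewrite /half -[RHS](evsum0 M); apply: eq_evsum => i; rewrite h scaler0.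
Qed.

Let D1 b := jac_lhs (@voaY C V) Y (J (lmat C x)) u (T b y).
Let D2 b := jac_left Y Y (J (lmat C x)) u (T b y).
Let D3 b := jac_right Y Y (J (lmat C x)) u (T b y).

Lemma D1_fam l m : fam (fun b n => D1 b l m n).
Proof.
apply: (T0_fam (F := fun z n => jac_lhs (@voaY C V) Y (J (lmat C x)) u z l m n)) => [n|z].
  by apply: lhs3_eq0 => a b; rewrite (lin0 (Yl.2 _ _)).
by apply: lhs3_trunc => [|a]; [exact: (trunc_lhs Yl Vt)|exact: Yt].
Qed.

Lemma D2_fam l m : fam (fun b n => D2 b l m n).
Proof.
apply: (T0_fam (F := fun z n => jac_left Y Y (J (lmat C x)) u z l m n)) => [n|z].
  by apply: half_eq0 => a b; rewrite !(lin0 (Yl.2 _ _)).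
have [n0 h] := half_trunc_snd l (trunc_left Yl Yt (J (lmat C x)) u z).
by exists n0 => n; exact: h.
Qed.

Lemma D3_fam l m : fam (fun b n => D3 b l m n).
Proof.
apply: (T0_fam (F := fun z n => jac_right Y Y (J (lmat C x)) u z l m n)) => [n|z].
  by rewrite /jac_right half_eq0 ?scaler0// => a b; rewrite !(lin0 (Yl.2 _ _)).
have [n0 h] := half_trunc_fst l m (trunc_right Yl Yt (J (lmat C x)) u z) (fun b => Yt u _).
by exists n0 => n /h; rewrite /jac_right => ->; rewrite scaler0.
Qed.

(** Both sides satisfy [rec3]. They vanish on a layer where all modes of the current kill [u], and
    their rows [m = 0] coincide on every layer. *)
Lemma twisted_lhs l m n : lhs3 (fun a b => Phi' mu (AV x (a + s) u) y b) l m n =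
  vop' mu (fun b n' => D1 b (l + s) m n') n.
Proof.
apply/eqP; rewrite -subr_eq0; apply/eqP.
have [a0 ha] := Vt (J (lmat C x)) u.
have hAV a : a0 <= a -> AV x a u = 0 by exact: ha.
have tK : trunc_fst (fun a b => Phi' mu (AV x (a + s) u) y b).
  exists (a0 - s) => a b aa; rewrite hAV; last by lia.
  exact: (lin0 (Phi_lin_u mu y b)).
have r1 := lhs3_rec tK.
have r2 := vop_rec repA mu s (fun b => jac_lhs_rec Yl Vt (J (lmat C x)) u (T b y)) D1_fam.
apply: (rec3_eq0 (l0 := a0 - s) (rec3B r1 r2)) => [m' n'|l'].
  rewrite /lhs3 [X in X - _](_ : _ = 0) ?sub0r; last first.
    rewrite -[RHS](evsum0 M); apply: eq_evsum => i.
    by rewrite hAV ?(lin0 (Phi_lin_u mu y _)) ?scaler0//; lia.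
  rewrite (vop0 repA) ?oppr0// => b n''.
  rewrite /jac_lhs /lhs3 -[RHS](evsum0 M); apply: eq_evsum => i.
  by rewrite ha ?(lin0 (Yl.1 _ _)) ?scaler0//; lia.
left; exists 0 => n'; rewrite lhs30 /Phi' /Phi.
apply/eqP; rewrite subr_eq0; apply/eqP; congr (vop J Y mu _ n').
by apply: fam_ext => b j; rewrite /jac_lhs lhs30.
Qed.

(** The layer [la] is the hypothesis [anchor_left], where the commutation with E^- was computed; on
    each other layer both sides vanish for large [n], uniformly in [m]. *)
Lemma twisted_left l m n : half (fun a b => A x (a + s) (Phi' mu u y b)) l m n =
  vop' mu (fun b n' => D2 b (l + s) m n') n.
Proof.
apply/eqP; rewrite -subr_eq0; apply/eqP.
have r1 := half_rec trunc_left_Phi.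
have r2 := vop_rec repA mu s (fun b => jac_left_rec Yl Yt (J (lmat C x)) u (T b y)) D2_fam.
apply: (rec3_eq0 (l0 := la) (rec3B r1 r2)) => [m' n'|l'].
  by rewrite anchor_left ?subrr//; exact: (fam_Y hY Eplus_trunc).
right; have [n1 h1] := half_trunc_snd l' trunc_left_Phi.
have [b0 hb] := Eplus_trunc y.
have [n2 h2] : exists n2 : int, forall b m n, n2 <= n -> D2 b (l' + s) m n = 0.
  have [n2 h2] := fam_unif (fam_Y hY Eplus_trunc u y).
  exists n2 => b m' n' nn; rewrite /D2 /jac_left /half -[RHS](evsum0 M).
  apply: eq_evsum => i; rewrite h2 ?(lin0 (Yl.2 _ _)) ?scaler0//; lia.
exists (Num.max n1 (n2 - mu + b0%:Z)) => m' n'; rewrite ge_max => /andP[n1n n2n].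
rewrite h1// sub0r (vop_trunc repA (n0 := n2) (b0 := b0)) ?oppr0//.
  by move=> b j; exact: h2.
move=> b j bb; rewrite /D2 /jac_left half_eq0// => a c.
by rewrite /T hb// !(lin0 (Yl.2 _ _)).
Qed.

Lemma twisted_right l m n :
  (-1) ^ l *: half (fun a b => Phi' (mu + s) u (A x b y) a) l n m =
  vop' mu (fun b n' => D3 b (l + s) m n') n.
Proof.
apply/eqP; rewrite -subr_eq0; apply/eqP.
have r1 : rec3 (fun l m n => (-1) ^ l *: half (fun a b => Phi' (mu + s) u (A x b y) a) l n m).
  move=> l' m' n'; rewrite (half_rec trunc_right_Phi).
  by rewrite exprzDr ?expr1z ?unitrN1// mulrN1 scaleNr scalerBr opprB.
have r2 := vop_rec repA mu s (fun b => jac_right_rec Yl Yt (J (lmat C x)) u (T b y)) D3_fam.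
apply: (rec3_eq0 (l0 := la) (rec3B r1 r2)) => [m' n'|l'].
  by rewrite anchor_right subrr.
left; have [m1 h1] := A_trunc y.
have [m2 h2] := fam_unif (fam_Eplus Eplus_trunc y (Al x) (fun z => A_trunc z)).
exists (Num.max m1 m2) => n'.
have mm1 : m1 <= Num.max m1 m2 by rewrite le_max lexx.
have mm2 : m2 <= Num.max m1 m2 by rewrite le_max lexx orbT.
rewrite /half [X in _ *: X - _](_ : _ = 0) ?scaler0 ?sub0r; last first.
  rewrite -[RHS](evsum0 M); apply: eq_evsum => i.
  by rewrite h1 ?Phi0 ?scaler0//; lia.
rewrite (vop0 repA) ?oppr0// => b j.
rewrite /jac_right /half (_ : evsum _ = 0) ?scaler0//.
rewrite -[RHS](evsum0 M); apply: eq_evsum => i.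
have hz := h2 b (Num.max m1 m2 + i%:Z); rewrite /A /current /hat_of in hz.
by rewrite hz ?(lin0 (Yl.2 _ _)) ?scaler0//; lia.
Qed.

Lemma vmodJ : forall u v x, jac (@voaY C V) Y Y Y u v x.
Proof. exact: vmod_jac. Qed.

(** Each of the three terms is the image under [vop] of the corresponding untwisted term with [l]
    replaced by [l + s], so the untwisted identity on every E^+_b y gives the twisted one. *)
Lemma twisted_jac l m n : lhs3 (fun a b => Phi' mu (AV x (a + s) u) y b) l m n =
  half (fun a b => A x (a + s) (Phi' mu u y b)) l m n -
  (-1) ^ l *: half (fun a b => Phi' (mu + s) u (A x b y) a) l n m.
Proof.
rewrite twisted_lhs twisted_left twisted_right.
rewrite -(vop_sub repA _ _ (D2_fam _ _) (D3_fam _ _)).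
congr (vop J Y mu _ n); apply: fam_ext => b j; exact: vmodJ.
Qed.

End Letter.

Lemma twisted_jac_E mu u y l m n :
  lhs3 (fun a b => Phi' mu (AV LE (a + 1) u) y b) l m n =
  half (fun a b => A LE (a + 1) (Phi' mu u y b)) l m n -
  (-1) ^ l *: half (fun a b => Phi' (mu + 1) u (A LE b y) a) l n m.
Proof.
(* For e the linear factor stands on the untwisted side: twisted layer 0 is compared with untwisted
   layer 1. *)
apply: (@twisted_jac LE 1 0) => [F m' n' fF|m' n'].
  rewrite half0 add0r /vop' /A (vop_E repA)//; congr (vop J Y mu _ n').
  apply: fam_ext => b j; rewrite half1//.
  by have [n0 h] := fF.2 b; exists n0 => a c /h ->; exact: (lin0 (Al LE a)).
rewrite half0 expr0z scale1r /Phi' /A (Phi_E hY repA Eplus_trunc) add0r expr1z /vop'.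
rewrite -(vop_shift J Y mu) -(vop_sub repA mu n'
  (fam_shift (fam_Y_op hY repA Eplus_trunc u LE m' y))
  (fam_Y_op hY repA Eplus_trunc u LE (m' + 1) y)) -scaleN1r.
have ft : fam (fun b n => Y u (n + 1) (A LE m' (Eplus J Y b y)) - Y u n (A LE (m' + 1) (Eplus J Y b y))).
  have f1 := fam_shift (fam_Y_op hY repA Eplus_trunc u LE m' y).
  have f2 := fam_Y_op hY repA Eplus_trunc u LE (m' + 1) y.
  split=> [|b].
    have [[b1 h1] _] := f1; have [[b2 h2] _] := f2.
    by exists (maxn b1 b2) => b j; rewrite geq_max => /andP[/h1-> /h2->]; rewrite subrr.
  have [_ /(_ b)[n1 h1]] := f1; have [_ /(_ b)[n2 h2]] := f2.
  by exists (Num.max n1 n2) => j; rewrite ge_max => /andP[/h1-> /h2->]; rewrite subrr.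
have fz : fam (fun (_ : nat) (_ : int) => 0 : M) by split=> [|b]; exists 0.
rewrite -[LHS]addr0 -[X in _ + X](@vop0 _ _ _ _ _ Y repA mu (fun _ _ => 0) n')//.
rewrite -(vop_lin repA _ _ _ ft fz); congr (vop J Y mu _ n').
apply: fam_ext => b j; rewrite addr0 half1//.
have [n0 h] := Yt (J (lmat C LE)) (T b y).
by exists n0 => a c /h hz; rewrite /A /current /hat_of hz (lin0 (Yl.2 _ _)).
Qed.

Lemma twisted_jac_F mu u y l m n :
  lhs3 (fun a b => Phi' mu (AV LF (a - 1) u) y b) l m n =
  half (fun a b => A LF (a - 1) (Phi' mu u y b)) l m n -
  (-1) ^ l *: half (fun a b => Phi' (mu - 1) u (A LF b y) a) l n m.
Proof.
(* For f it stands on the twisted side: twisted layer 1 is compared with untwisted layer 0. *)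
apply: (@twisted_jac LF (-1) 1) => [F m' n' fF|m' n'].
  rewrite half1; last first.
    have [b0 hb] := fF.1; have [n0 h] := fam_unif fF.
    exists (n0 - mu + b0%:Z) => a b nb.
    by rewrite /vop' (vop_trunc repA h hb)//; exact: (lin0 (Al LF _)).
  rewrite subrr addrK /A /vop' -(vop_F repA)//; congr (vop J Y mu _ n').
  by apply: fam_ext => b j; rewrite half0.
rewrite subrr expr0z expr1z half1; last first.
  have [m1 h1] := Yt (J (lmat C LF)) y; exists m1 => a b /h1 hz.
  by rewrite /A /current /hat_of hz Phi0.
rewrite scaleN1r /Phi' /A -(Phi_F hY repA Eplus_trunc); congr (vop J Y mu _ n').
by apply: fam_ext => b j; rewrite half0 scale1r.
Qed.

End TwistedJacobi2.

Section JacobiVectors.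
Variables (C : numFieldType) (V W M N : lmodType C).
Variables (YW : V -> int -> W -> W) (YM : V -> int -> M -> M).
Variables (YN : V -> int -> N -> N) (I : W -> int -> M -> N).
Hypotheses (YMl : mode_linear YM) (YNl : mode_linear YN) (Il : mode_linear I).
Hypotheses (YWt : mode_truncation YW) (YMt : mode_truncation YM).
Hypothesis It : mode_truncation I.

Lemma jac_submod u w : submod (fun x => jac YW YM YN I u w x).
Proof.
have fs1 x l m n := finsuppZ (binz C m) (lhs3_supp l m n (trunc_lhs Il YWt u w x)).
have fs2 x l m n := finsuppZ (fun i => (-1) ^+ i * binz C l i)
  (half_supp l m n (trunc_left YNl It u w x)).
have fs3 x l m n := finsuppZ (fun i => (-1) ^+ i * binz C l i)
  (half_supp l n m (trunc_right Il YMt u w x)).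
have e1 (c : C) x x' l m n : jac_lhs YW I u w (c *: x + x') l m n =
    c *: jac_lhs YW I u w x l m n + jac_lhs YW I u w x' l m n.
  rewrite /jac_lhs /lhs3 -(evsumZ c (fs1 x l m n)) -(evsumD (finsuppcZ c (fs1 x l m n)) (fs1 x' l m n)).
  apply: eq_evsum => i; rewrite (Il.2 _) scalerDr.
  by congr (_ + _); rewrite !scalerA mulrC.
have e2 (c : C) x x' l m n : jac_left YN I u w (c *: x + x') l m n =
    c *: jac_left YN I u w x l m n + jac_left YN I u w x' l m n.
  rewrite /jac_left /half -(evsumZ c (fs2 x l m n)) -(evsumD (finsuppcZ c (fs2 x l m n)) (fs2 x' l m n)).
  apply: eq_evsum => i; rewrite (Il.2 _) (YNl.2 u) scalerDr.
  by congr (_ + _); rewrite !scalerA mulrC.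
have e3 (c : C) x x' l m n : jac_right YM I u w (c *: x + x') l m n =
    c *: jac_right YM I u w x l m n + jac_right YM I u w x' l m n.
  rewrite /jac_right scalerA mulrC -scalerA -scalerDr /half.
  rewrite -(evsumZ c (fs3 x l m n)) -(evsumD (finsuppcZ c (fs3 x l m n)) (fs3 x' l m n)); congr (_ *: _).
  apply: eq_evsum => i; rewrite (YMl.2 u) (Il.2 w) scalerDr.
  by congr (_ + _); rewrite !scalerA mulrC.
split=> [l m n|c x x' Jx Jx' l m n]; last first.
  by rewrite e1 e2 e3 Jx Jx' scalerBr opprD addrACA.
have z : (0 : M) = 0 *: 0 + 0 by rewrite scale0r addr0.
have zero (f : M -> N) : (forall (c : C) x x', f (c *: x + x') = c *: f x + f x') -> f 0 = 0.
  by move=> fl; exact: lin0.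
rewrite (zero (fun x => jac_lhs YW I u w x l m n)); last by move=> *; exact: e1.
rewrite (zero (fun x => jac_left YN I u w x l m n)); last by move=> *; exact: e2.
by rewrite (zero (fun x => jac_right YM I u w x l m n)) ?subr0//; move=> *; exact: e3.
Qed.

End JacobiVectors.

(** * The twisted operator on all vectors and its Jacobi identity *)

Section FinalOperator.
Variables (C : numFieldType) (k : nat) (V : voa C) (J : {linear 'M[C]_2 -> V}).
Hypothesis hV : is_affine_voa k J.
Variables (M : lmodType C) (Y : V -> int -> M -> M).
Hypothesis hY : vmod Y.
Let A := current J Y.
Let AV := current J (@voaY C V).
Hypothesis repA : hat_rep k%:R A.
Hypothesis Eplus_trunc : forall y, exists b0, forall b, (b0 <= b)%N -> Eplus J Y b y = 0.
Hypothesis dec : forall y, exists c, decomposes A y c.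

Let Yl := vmod_lin hY.
Let Yt := vmod_trunc hY.
Let Al := repA.1.

Definition comp y : int -> M := sval (cid (dec y)).

Lemma compP y : decomposes A y (comp y).
Proof. exact: (svalP (cid (dec y))). Qed.

Lemma comp_lin (c : C) y y' : comp (c *: y + y') = fun mu => c *: comp y mu + comp y' mu.
Proof.
by apply: (decomposes_uniq repA (compP _)); exact: (decomposes_lin repA c (compP y) (compP y')).
Qed.

Lemma comp_weight mu y : weight_vec A mu y -> comp y = delta_at mu y.
Proof.
by move=> wy; apply: (decomposes_uniq repA (compP _)); exact: (decomposes_weight repA wy).
Qed.

(** [Phi] depends on the weight index through the power (-z)^mu, so the operator is extended
    linearly over weight components. *)
Definition Ival u n y := isum (fun mu => Phi J Y mu u (comp y mu) n).

Lemma Ival_fin u n y : ifin (fun mu => Phi J Y mu u (comp y mu) n).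
Proof.
have [_ [B h] _] := compP y; exists B => mu /h ->.
exact: (lin0 (Phi_lin hY repA Eplus_trunc mu u n)).
Qed.

Lemma Ival_lin : mode_linear Ival.
Proof.
split=> [n x c u u'|u n c x x']; rewrite /Ival.
  rewrite -(isum_lin c (Ival_fin u n x) (Ival_fin u' n x)); congr isum.
  by apply/funext => mu; exact: (Phi_lin_u hY repA Eplus_trunc).
rewrite -(isum_lin c (Ival_fin u n x) (Ival_fin u n x')) comp_lin; congr isum.
by apply/funext => mu; exact: (Phi_lin hY repA Eplus_trunc).
Qed.

Lemma Ival_weight mu u n y : weight_vec A mu y -> Ival u n y = Phi J Y mu u y n.
Proof.
move=> wy; rewrite /Ival (comp_weight wy) (@isum1 _ _ _ mu).
  by rewrite /delta_at eqxx.
move=> nu /negbTE; rewrite /delta_at => ->.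
exact: (lin0 (Phi_lin hY repA Eplus_trunc nu u n)).
Qed.

Lemma weight_span (S : M -> Prop) : submod S ->
  (forall mu y, weight_vec A mu y -> S y) -> forall y, S y.
Proof.
move=> Ss Sw y; have [w f ->] := compP y.
by apply: (isum_submod Ss f) => mu; exact: Sw (w mu).
Qed.

Lemma Ival_trunc : mode_truncation Ival.
Proof.
move=> u y; apply: (weight_span (S := fun y => trunc_above (fun n => Ival u n y))).
  split=> [|c x x' [n0 h] [n1 h1]].
    by exists 0 => n _; exact: (lin0 (Ival_lin.2 u n)).
  exists (Num.max n0 n1) => n; rewrite ge_max => /andP[/h hn /h1 h1n].
  by rewrite Ival_lin.2 hn h1n scaler0 addr0.
move=> mu x wx; have [n0 h] := Phi_trunc hY repA Eplus_trunc mu u x.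
by exists n0 => n /h; rewrite (Ival_weight _ _ wx).
Qed.

Variables (W : lmodType C) (YW : V -> int -> W -> W).
Hypothesis hW : vmod YW.
Let AW := current J YW.
Variables (phi : W -> V) (psi : M -> M) (h : int).
Hypotheses (phi_lin : linear phi) (psi_lin : linear psi).
Hypothesis phi_op : forall a n w, phi (AW a n w) = flow k%:R AV a n (phi w).
Hypothesis psi_op : forall a n y, psi (flow k%:R A a n y) = A a n (psi y).

(** [phi] and [psi] identify W and M with flowed modules; the shift by [h] takes the coefficient of
    z^(-n-1-h), as the indexing of intertwining operators prescribes. *)
Definition Iop w n y := psi (Ival (phi w) (n + h) y).

Lemma Iop_lin : mode_linear Iop.
Proof.
by split=> [n x|w n] c y y'; rewrite /Iop ?phi_lin ?Ival_lin.1 ?Ival_lin.2 psi_lin.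
Qed.

Lemma Iop_trunc : mode_truncation Iop.
Proof.
move=> w y; have [n0 hn] := Ival_trunc (phi w) y; exists (n0 - h) => n nn.
by rewrite /Iop hn ?(lin0 psi_lin)//; lia.
Qed.

Lemma psi_half H l m n : trunc_snd H ->
  half (fun a b => psi (H a b)) l m n = psi (half H l m n).
Proof.
move=> tH; rewrite /half (evsum_lin psi_lin (finsuppZ _ (half_supp _ _ _ tH))).
by apply: eq_evsum => i; rewrite (linZ psi_lin).
Qed.

Lemma psi_lhs3 K l m n : trunc_fst K ->
  lhs3 (fun a b => psi (K a b)) l m n = psi (lhs3 K l m n).
Proof.
move=> tK; rewrite /lhs3 (evsum_lin psi_lin (finsuppZ _ (lhs3_supp _ _ _ tK))).
by apply: eq_evsum => i; rewrite (linZ psi_lin).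
Qed.

Lemma weight_op a n mu y (s : int) : wt a = 2 * s -> weight_vec A mu y ->
  weight_vec A (mu + s) (A a n y).
Proof.
move=> hs wy; rewrite /weight_vec (H0_op repA) wy (linZ (Al a n)) -scalerDl.
by congr (_ *: _); rewrite hs intrM intrD mulrDr.
Qed.

Lemma Iop_jac_letter x (s : int) w y : wt x = 2 * s ->
  (forall n z, flow k%:R AV x n z = AV x (n + s) z) ->
  (forall n z, flow k%:R A x n z = A x (n + s) z) ->
  (forall mu u y l m n,
    lhs3 (fun a b => Phi J Y mu (AV x (a + s) u) y b) l m n =
    half (fun a b => A x (a + s) (Phi J Y mu u y b)) l m n -
    (-1) ^ l *: half (fun a b => Phi J Y (mu + s) u (A x b y) a) l n m) ->
  jac YW Y Y Iop (J (lmat C x)) w y.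
Proof.
move=> xs fV fM tw; move: y.
apply: weight_span => [|mu y wy l m n].
  apply: jac_submod => //; [exact: Iop_lin|exact: vmod_trunc|exact: Iop_trunc].
have Phi_tr := Phi_trunc hY repA Eplus_trunc.
have [a0 ha] := @voa_truncation C V (J (lmat C x)) (phi w).
have -> : jac_lhs YW Iop (J (lmat C x)) w y l m n =
    psi (lhs3 (fun a b => Phi J Y mu (AV x (a + s) (phi w)) y b) l m (n + h)).
  rewrite -psi_lhs3; last first.
    exists (a0 - s) => a b aa; rewrite {1}/AV /current /hat_of ha; last by lia.
    exact: (lin0 (Phi_lin_u hY repA Eplus_trunc mu y b)).
  apply: eq_evsum => i; rewrite /Iop -/(AW x _ _).
  have -> : phi (YW (J (lmat C x)) (l + i%:Z) w) = AV x (l + i%:Z + s) (phi w).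
    by rewrite -fV -phi_op.
  rewrite (Ival_weight _ _ wy); congr (_ *: psi (Phi _ _ _ _ _ _)); lia.
have -> : jac_left Y Iop (J (lmat C x)) w y l m n =
    psi (half (fun a b => A x (a + s) (Phi J Y mu (phi w) y b)) l m (n + h)).
  rewrite -psi_half; last first.
    by have [n0 hn] := Phi_tr mu (phi w) y; exists n0 => a b /hn ->; exact: (lin0 (Al x _)).
  apply: eq_evsum => i; rewrite /Iop (Ival_weight _ _ wy) -fM psi_op.
  congr (_ *: A x _ (psi (Phi _ _ _ _ _ _))); lia.
have -> : jac_right Y Iop (J (lmat C x)) w y l m n = (-1) ^ l *:
    psi (half (fun a b => Phi J Y (mu + s) (phi w) (A x b y) a) l (n + h) m).
  rewrite -psi_half; last first.
    have [n0 hn] := Yt (J (lmat C x)) y; exists n0 => a b nb.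
    rewrite /A /current /hat_of hn//.
    exact: (lin0 (Phi_lin hY repA Eplus_trunc _ _ _)).
  congr (_ *: _); apply: eq_evsum => i; rewrite /Iop -/(A x _ _).
  rewrite (Ival_weight _ _ (weight_op (m + i%:Z) xs wy)).
  congr (_ *: psi (Phi _ _ _ _ _ _)); lia.
by rewrite tw (linB psi_lin) (linZ psi_lin).
Qed.

(** The vectors satisfying the Jacobi identity include the vacuum, e and f, and are closed under
    products. This yields h = e_0 f without a separate twisted computation, then everything, since V
    is generated from the vacuum by currents. *)
Lemma Iop_jac u w y : jac YW Y Y Iop u w y.
Proof.
have hVm := voa_vmod V.
pose S u := jac_at YW Y Y Iop u.
suff : S u by exact.
have Jprod := @jac_at_prod _ _ _ _ _ (@voaY C V) YW Y Y Iop (Y (conformal_vector V) 0)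
  (vmod_lin hW) Yl Yl Iop_lin (Yl.2 _ _) (@voa_truncation C V) (vmod_trunc hW) Yt Yt Iop_trunc
  (vmod_jac hW) (vmod_jac hY) (vmod_jac hY) (fun u l x => vmod_translation hY u l x).
have SE : S (J (lmat C LE)).
  move=> w' y'; apply: (Iop_jac_letter (s := 1)) => //.
  by move=> *; exact: (twisted_jac_E hY repA Eplus_trunc).
have SF : S (J (lmat C LF)).
  move=> w' y'; apply: (Iop_jac_letter (s := -1)) => //.
  by move=> *; exact: (twisted_jac_F hY repA Eplus_trunc).
have SH : S (J (lmat C LH)).
  have -> : J (lmat C LH) = voaY (J (lmat C LE)) 0 (J (lmat C LF)).
    by have := current0_state hV LE LF; rewrite /= scale1r => <-.
  exact: (Jprod _ _ 0 SE SF).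
have SJ a : S (J (lmat C a)) by case: a.
apply: (irr_generated u (currentV_irr hV) (vac_neq0 hV) (S := S)).
- split=> [|c u1 u2 S1 S2].
    move=> w' y' l m n.
    have Sv := @jac_at_vacuum _ _ _ _ _ YW Y Y Iop Yl Iop_lin (vmod_trunc hW) Yt Iop_trunc
       (vacuum V) (vmod_vac hW) (vmod_vac hY) (vmod_vac hY).
    have := @jac_at_linear _ _ _ _ _ YW Y Y Iop (vmod_lin hW) Yl Yl Iop_lin (vmod_trunc hW) Yt Iop_trunc
      (-1) _ _ Sv Sv w' y' l m n.
    by rewrite scaleN1r addNr.
  exact: (@jac_at_linear _ _ _ _ _ YW Y Y Iop (vmod_lin hW) Yl Yl Iop_lin (vmod_trunc hW) Yt Iop_trunc).
- by move=> a n u' Su; exact: (Jprod _ _ n (SJ a) Su).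
- exact: (@jac_at_vacuum _ _ _ _ _ YW Y Y Iop Yl Iop_lin (vmod_trunc hW) Yt Iop_trunc
       (vacuum V) (vmod_vac hW) (vmod_vac hY) (vmod_vac hY)).
Qed.

End FinalOperator.

(** * The intertwining operator *)

Section HighestWeightModule.
Variables (C : numFieldType) (k : nat) (V : voa C) (J : {linear 'M[C]_2 -> V}).
Hypothesis hV : is_affine_voa k J.
Variables (M : voa_module V) (i : nat).
Hypothesis hM : is_affine_module k i J M.
Let Y := @modY C V M.
Let A := current J Y.
Let d : M -> M := Y (conformal_vector V) 1.
Let hY : vmod Y := module_vmod M.

Lemma mod_rep : hat_rep k%:R A.
Proof. by case: hM => rep _ _; exact: affine_hat rep. Qed.

Lemma mod_irr : irreducible A.
Proof. by case: hM => rep irr _; exact: affine_irr rep irr. Qed.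

Lemma mod_hw : exists v, hw_vector A i%:R v /\ v <> 0.
Proof. by case: hM => _ _ [v hv]; exists v; exact: affine_hw hv. Qed.

Lemma L0_lin : linear d. Proof. exact: (vmod_lin hY).2. Qed.

Lemma L0_op a n x : d (A a n x) = A a n (d x) - n%:~R *: A a n x.
Proof. exact: (L0_current hV hY). Qed.

Lemma L0_hw_vector v : hw_vector A i%:R v -> d v = conformal_weight C k i *: v.
Proof.
move=> hw; rewrite /d (L0_hw hV hY mod_rep hw); congr (_ *: _).
by rewrite /conformal_weight !natrM !natrD.
Qed.

Definition levels (e : C) := exists t : nat, e = conformal_weight C k i + t%:R.

Lemma mod_levels v y : hw_vector A i%:R v -> v <> 0 -> killed d levels y.
Proof.
move=> hw v0; have ks := killed_submod L0_lin levels.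
apply: (generated_low mod_rep hw (irr_generated y mod_irr v0)); first exact: ks.
- move=> a n u an ku.
  have [t tn] : exists t : nat, n = - t%:Z.
    by exists (absz n); case: an => [n0|[-> _]]; lia.
  apply: (killed_shift (mod_rep.1 a n) _ _ ku (delta := t%:R)) => [z|_ [s ->]].
    by rewrite L0_op tn mulrNz scaleNr opprK.
  by exists (s + t)%N; rewrite natrD addrA.
- apply: (killed_eig (L0_hw_vector hw)); exists 0%N; by rewrite addr0.
Qed.

Lemma L0_eig_level e y : d y = e *: y -> y <> 0 -> levels e.
Proof.
have [v [hw v0]] := mod_hw.
move=> dy y0; apply: contrapT => ne; apply: y0.
exact: (killed_eig0 L0_lin dy (mod_levels y hw v0) ne).
Qed.

(** E^+_b lowers the L_0-eigenvalue by b, while all eigenvalues on M lie in the conformal weight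
    plus the natural numbers. *)
Lemma mod_Eplus_trunc y : exists b0, forall b, (b0 <= b)%N -> Eplus J Y b y = 0.
Proof.
have Tl := Eplus_lin (Y := Y) mod_rep.
pose S y := exists b0, forall b, (b0 <= b)%N -> Eplus J Y b y = 0.
have Ss : submod S.
  split=> [|c u u' [b h] [b' h']]; first by exists 0%N => b _; rewrite (lin0 (Tl b)).
  exists (maxn b b') => j; rewrite geq_max => /andP[/h hj /h' h'j].
  by rewrite Tl hj h'j scaler0 addr0.
have [n [e [ys [-> hys]]]] := mod_graded y.
apply: (submod_sum _ Ss) => // j _; have dj : d (ys j) = e j *: ys j := hys j.
have [y0|/eqP y0] := eqVneq (ys j) 0.
  by exists 0%N => b _; rewrite y0 (lin0 (Tl b)).
have [t et] := L0_eig_level dj y0; exists t.+1 => b tb.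
have db : d (Eplus J Y b (ys j)) = (e j - b%:R) *: Eplus J Y b (ys j).
  rewrite (expop_shift (gplus_lin mod_rep) (s := -1) L0_lin) => [|m x].
    rewrite dj -[expop _ b (_ *: _)]/(Eplus J Y b _) (linZ (Tl b)).
    by rewrite mulN1r mulrNz scaleNr -scalerBl.
  rewrite /gplus (linZ L0_lin) L0_op mulN1r mulrNz scalerBr; congr (_ + _).
  by rewrite [RHS]scaleNr; congr (- _); rewrite !scalerA mulrC.
apply: contrapT => /(L0_eig_level db)[s]; rewrite et => /eqP.
rewrite -addrA (inj_eq (addrI _)) subr_eq -natrD eqr_nat => /eqP.
by move=> e'; move: tb; rewrite e' ltnNge leq_addl.
Qed.

End HighestWeightModule.

(** * Spectral flow of highest-weight modules *)

Section FlowFacts.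
Variables (C : numFieldType) (k : C) (M : lmodType C) (A : letter -> int -> M -> M).
Hypothesis repA : hat_rep k A.

Lemma flow_irr : irreducible A -> irreducible (flow k A).
Proof.
move=> irr S Ss Sc; apply: irr => // a n u Su.
case: a; first by have := Sc LE (n - 1) u Su; rewrite /= subrK.
- by have := Sc LF (n + 1) u Su; rewrite /= addrK.
- have := Sc LH n u Su; rewrite /= => h.
  by rewrite -[A LH n u](addrK ((if n == 0 then k else 0) *: u));
    apply: (submodB Ss h); exact: (submodZ _ Ss).
Qed.

Variables (d : M -> M) (p : C).
Hypothesis d_lin : linear d.
Hypothesis d_op : forall a n x, d (A a n x) = A a n (d x) - n%:~R *: A a n x.

(** Spectral flow carries L_0 to L_0 + h_0/2 + k/4; the constant [p] is k/4 in the application. *)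
Definition flow_L0 x := d x + 2^-1 *: A LH 0 x + p *: x.

Lemma flow_L0_lin : linear flow_L0.
Proof.
move=> c x y; rewrite /flow_L0 d_lin repA.1 !scalerDr !scalerA.
by rewrite (mulrC 2^-1) (mulrC p) (AC ((2*2)*2) ((1*3*5)*(2*4*6))).
Qed.

Lemma half_wt a : 2^-1 * (wt a)%:~R = (match a with LE => 1 | LF => -1 | LH => 0 end) :> C.
Proof.
by case: a; rewrite /= ?mulr0z ?mulr0// ?mulrNz ?mulrN mulVf// pnatr_eq0.
Qed.

Lemma flow_L0_A a n x : flow_L0 (A a n x) = A a n (flow_L0 x) +
  (2^-1 * (wt a)%:~R - n%:~R) *: A a n x.
Proof.
rewrite /flow_L0 d_op (H0_op repA) !(linD (repA.1 a n)) !(linZ (repA.1 a n)).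
rewrite scalerDr scalerA scalerBl.
by rewrite (AC ((2*2)*1) ((1*3*5)*(4*2))).
Qed.

Lemma flow_L0_op a n x :
  flow_L0 (flow k A a n x) = flow k A a n (flow_L0 x) - n%:~R *: flow k A a n x.
Proof.
case: a => /=.
- rewrite flow_L0_A half_wt -scaleNr; congr (_ + _ *: _).
  by rewrite intrD opprD addrCA subrr addr0.
- rewrite flow_L0_A half_wt -scaleNr; congr (_ + _ *: _).
  by rewrite intrB opprB addrA addNr add0r.
- rewrite (linD flow_L0_lin) (linZ flow_L0_lin) flow_L0_A half_wt sub0r.
  set e := (if _ then _ else _).
  have ne : n%:~R * e = 0 by rewrite /e; case: eqP => [->|_]; rewrite ?mul0r ?mulr0.
  rewrite [n%:~R *: _]scalerDr [n%:~R *: (e *: _)]scalerA ne scale0r addr0 scaleNr.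
  by rewrite addrAC.
Qed.

End FlowFacts.

Section VacuumField.
Variables (C : numFieldType) (k : nat) (V : voa C) (J : {linear 'M[C]_2 -> V}).
Variables (M : lmodType C) (Y : V -> int -> M -> M).
Hypothesis hY : vmod Y.
Let A := current J Y.
Hypothesis repA : hat_rep k%:R A.
Hypothesis Eplus_trunc : forall y, exists b0, forall b, (b0 <= b)%N -> Eplus J Y b y = 0.
Let vac := vacuum V.
Variables (D : M -> M) (s : int).
Hypothesis D_lin : linear D.
Hypothesis D_minus : forall a z,
  D (Eminus J Y a z) = Eminus J Y a (D z) + (s * a%:Z)%:~R *: Eminus J Y a z.
Hypothesis D_plus : forall b z,
  D (Eplus J Y b z) = Eplus J Y b (D z) + (- s * b%:Z)%:~R *: Eplus J Y b z.

(** Used twice: for D = L_0 with s = 1 and for D = h_0 with s = 0. With the vacuum in the middle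
    only the two exponentials contribute to the commutator. *)
Lemma D_Phi mu y N : D (Phi J Y mu vac y N) =
  Phi J Y mu vac (D y) N - (s * (N + 1 + mu))%:~R *: Phi J Y mu vac y N.
Proof.
have fy := fam_Y hY Eplus_trunc vac.
pose G y := sumfam mu (fun b n => Y vac n (Eplus J Y b y)).
have DG n : D (G y n) = - (s * (n + 1 + mu))%:~R *: G y n + G (D y) n.
  have f1 := sumfam_supp mu n (fy y); have f2 := sumfam_supp mu n (fy (D y)).
  rewrite /G /sumfam (evsum_lin D_lin f1) -(evsumZ _ f1) -(evsumD (finsuppcZ _ f1) f2).
  apply: eq_evsum => b; rewrite !(vmod_vac hY).
  case: eqP => [e|_]; last by rewrite (lin0 D_lin) scaler0 addr0.
  rewrite D_plus addrC; congr (_ *: _ + _); rewrite mulNr mulrNz.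
  by congr (- _); congr ((s * _)%:~R); move: e; lia.
have tG z : trunc_above (G z) by exact: (sumfam_trunc mu (fy z)).
rewrite /Phi /vop -/(G y) -/(G (D y)) (linZ D_lin) scalerA mulrC -scalerA -scalerBr; congr (_ *: _).
have f1 := mulEminus_supp repA N (tG y); have f2 := mulEminus_supp repA N (tG (D y)).
rewrite /mulEminus (evsum_lin D_lin f1) addrC -scaleNr -(evsumZ _ f1) -(evsumD (finsuppcZ _ f1) f2).
apply: eq_evsum => a; rewrite D_minus DG (Eminus_lin repA) addrAC -scalerDl.
congr (_ *: _ + _); rewrite -!mulrNz -intrD -!mulrN -mulrDr.
by congr ((s * _)%:~R); lia.
Qed.

End VacuumField.

Section IntertwinerExists.
Variables (C : numFieldType) (p : nat).
Let k := (4 * p)%N.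
Variables (V : voa C) (J : {linear 'M[C]_2 -> V}).
Hypothesis hV : is_affine_voa k J.
Variables (W : voa_module V) (M : voa_module V).
Hypothesis hW : is_affine_module k k J W.
Hypothesis hM : is_affine_module k (2 * p) J M.
Let YW := @modY C V W.
Let YM := @modY C V M.
Let AV := current J (@voaY C V).
Let AW := current J YW.
Let A := current J YM.
Let omega := conformal_vector V.
Let dW : W -> W := YW omega 1.
Let d : M -> M := YM omega 1.
Let hYW : vmod YW := module_vmod W.
Let hYM : vmod YM := module_vmod M.
Let repV := currentV_rep hV.
Let repW := mod_rep hW.
Let repM := mod_rep hM.
Let vac := vacuum V.

Lemma weight_top : conformal_weight C k k = p%:R.
Proof.
have K0 : (k + 2)%N%:R != 0 :> C by rewrite pnatr_eq0 addn2.
rewrite /conformal_weight natrM [X in _ / X]natrM {1}/k natrM.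
by move: ((k + 2)%N%:R) K0 => K K0; field.
Qed.

Lemma flow_vac : hw_vector (flow k%:R AV) k%:R vac.
Proof.
split.
- case=> n n0 /=; rewrite /AV /vac.
  + by rewrite (current_vac J)//; lia.
  + by rewrite (current_vac J)//; lia.
  + by rewrite (current_vac J) ?(ltW n0)// (gt_eqF n0) scale0r addr0.
- exact: (current_vac J LE (n := 1) isT).
- by have h := current_vac J LH (n := 0) isT; rewrite /flow /AV /vac h add0r eqxx.
Qed.

Lemma phi_exists w : hw_vector AW k%:R w -> w <> 0 ->
  exists phi : W -> V, [/\ linear phi,
    forall a n x, phi (AW a n x) = flow k%:R AV a n (phi x) & phi w = vac].
Proof.
move=> hw w0.
have dVl := (vmod_lin (voa_vmod V)).2 omega 1.
have dVo := L0_current hV (voa_vmod V).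
apply: (hw_morphism repW (flow_rep repV) (i := k%:R) (c := p%:R)
  (d1 := dW) (d2 := flow_L0 AV (voaY omega 1) p%:R)) => //.
- exact: L0_lin.
- exact: (flow_L0_lin repV).
- exact: (L0_op hV).
- by move=> a n x; exact: (flow_L0_op repV).
- exact: flow_vac.
- exact: (vac_neq0 hV).
- by rewrite -weight_top; exact: (L0_hw_vector hV hW hw).
- rewrite /flow_L0 /AV /vac (current_vac J LH (n := 0) isT) scaler0 addr0.
  by rewrite ((voa_creation omega).2 1 isT) add0r.
- exact: (mod_irr hW).
- exact/flow_irr/(currentV_irr hV).
Qed.

Section WithTop.
Variable v : M.
Hypotheses (hwv : hw_vector A (2 * p)%N%:R v) (v0 : v <> 0).
Let hM0 := conformal_weight C k (2 * p).
Let y0 := iter (2 * p) (A LF 0) v.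

Let dl : linear d. Proof. exact: L0_lin. Qed.
Let dop a n x : d (A a n x) = A a n (d x) - n%:~R *: A a n x.
Proof. exact: (L0_op hV). Qed.
Let dv : d v = hM0 *: v. Proof. exact: (L0_hw_vector hV hM hwv). Qed.

Lemma bottom_H : A LH 0 y0 = (- (2 * p)%N%:R) *: y0.
Proof.
rewrite /y0 /A (H_string repM hwv); congr (_ *: _).
by rewrite -addnn natrD opprD addrA subrr add0r.
Qed.

(** The flowed f_1 is f_0, so the highest-weight vector of the flowed module is the lowest-weight
    vector of the top space, and its weight becomes -2p + 4p = 2p. *)
Lemma flow_bottom : hw_vector (flow k%:R A) (2 * p)%N%:R y0.
Proof.
have pos a n : 0 < n -> A a n y0 = 0 by exact: (pos_string repM hwv).
split.
- case=> n n0 /=; [|have [->|n1] := eqVneq n 1|].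
  + by apply: pos; lia.
  + by rewrite subrr -[A LF 0 y0]/(iter (2 * p).+1 (A LF 0) v) (string_top repM hwv dl dop dv (mod_irr hM) v0).
  + by apply: pos; lia.
  + by rewrite pos// (gt_eqF n0) scale0r addr0.
- by rewrite /= pos.
- rewrite /= bottom_H -scalerDl; congr (_ *: _).
  by rewrite addrC -natrB; [congr (_%:R)|]; rewrite /k; lia.
Qed.

Lemma bottom_L0 : flow_L0 A d p%:R y0 = hM0 *: y0.
Proof.
have -> : flow_L0 A d p%:R y0 = hM0 *: y0 + 2^-1 *: (- (2 * p)%N%:R *: y0) + p%:R *: y0.
  by rewrite /flow_L0 bottom_H -(d_string repM dop dv).
rewrite scalerA -addrA -scalerDl.
by rewrite mulrN natrM mulrA mulVf ?pnatr_eq0// mul1r addNr scale0r addr0.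
Qed.

Lemma psi_exists : exists psi : M -> M, [/\ linear psi,
  forall a n x, psi (flow k%:R A a n x) = A a n (psi x), psi y0 = v
  & forall x, psi (flow_L0 A d p%:R x) = d (psi x)].
Proof.
have ynz : y0 <> 0 by exact: (string_neq0 repM hwv).
have irrF : irreducible (flow k%:R A) by exact/flow_irr/(mod_irr hM).
have [psi [pl po p0]] := hw_morphism (flow_rep repM) repM (i := (2 * p)%N%:R) (c := hM0)
  (flow_L0_lin repM p%:R dl) dl (fun a n x => flow_L0_op repM p%:R dl dop a n x) dop flow_bottom hwv
  ynz v0 bottom_L0 dv irrF (mod_irr hM).
exists psi; split=> // x.
have fl := flow_L0_lin repM p%:R dl.
apply: (irr_generated x irrF ynz (S := fun x => psi (flow_L0 A d p%:R x) = d (psi x))).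
- split=> [|c u u' hu hu']; first by rewrite (lin0 fl) (lin0 pl) (lin0 dl).
  by rewrite fl pl hu hu' pl dl.
- move=> a n u hu; rewrite (flow_L0_op repM p%:R dl dop) (linB pl) (linZ pl) !po hu.
  by rewrite dop.
- by rewrite bottom_L0 (linZ pl) p0 dv.
Qed.

End WithTop.
End IntertwinerExists.

Section GradingDefect.
Variables (C : numFieldType) (V : voa C) (J : {linear 'M[C]_2 -> V}).
Variables (W M : lmodType C) (YW : V -> int -> W -> W) (Y : V -> int -> M -> M).
Variables (I : W -> int -> M -> M) (dW : W -> W) (d : M -> M) (h : C).
Let AW := current J YW.
Let A := current J Y.
Hypotheses (Yl : mode_linear Y) (Il : mode_linear I).
Hypotheses (Yt : mode_truncation Y) (It : mode_truncation I).
Hypothesis IJ : forall a w y, jac YW Y Y I (J (lmat C a)) w y.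
Hypotheses (dW_lin : linear dW) (d_lin : linear d).
Hypothesis dW_op : forall a n x, dW (AW a n x) = AW a n (dW x) - n%:~R *: AW a n x.
Hypothesis d_op : forall a n x, d (A a n x) = A a n (d x) - n%:~R *: A a n x.

(** By the commutator formula for omega_1 this is equivalent to the L(-1)-derivative property of
    [I], but it passes easily from [w] to a_m w, so it can be checked on a generator of W. *)
Definition graded_at w := forall n y,
  d (I w n y) = I w n (d y) + I (dW w) n y - (n%:~R + 1 + h) *: I w n y.

Lemma graded_submod : submod graded_at.
Proof.
split=> [n y|c w w' hw hw' n y].
  by rewrite (lin0 dW_lin) !(lin0 (Il.1 _ _)) (lin0 d_lin) scaler0 addr0 subr0.
rewrite (Il.1 n y) (Il.1 n (d y)) dW_lin (Il.1 n y) d_lin hw hw'.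
rewrite !scalerDr scalerN !scalerA (mulrC c) opprD.
by rewrite (AC (3*3) ((1*4)*(2*5)*(3*6))).
Qed.

Lemma graded_op a m w : graded_at w -> graded_at (AW a m w).
Proof.
move=> hw n y; rewrite dW_op.
set c := - (n%:~R + 1 + h) - m%:~R : C.
rewrite (linB (Il.1 n y)) (linZ (Il.1 n y)).
have -> : I (AW a m w) n (d y) + (I (AW a m (dW w)) n y - m%:~R *: I (AW a m w) n y) -
    (n%:~R + 1 + h) *: I (AW a m w) n y =
    I (AW a m w) n (d y) + I (AW a m (dW w)) n y + c *: I (AW a m w) n y.
  by rewrite /c scalerBl scaleNr addrA -!addrA [X in _ + (_ + X)]addrC.
pose f1 w y i := ((-1) ^+ i * binz C m i) *: Y (J (lmat C a)) (m - i%:Z) (I w (n + i%:Z) y).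
pose f2 w y i := ((-1) ^+ i * binz C m i) *: I w (m + n - i%:Z) (Y (J (lmat C a)) i%:Z y).
have IE w' y' : I (AW a m w') n y' = evsum (f1 w' y') - (-1) ^ m *: evsum (f2 w' y').
  exact: (jac_iter (IJ a w' y')).
have s1 w' y' : finsupp (f1 w' y').
  have [n0 h0] := It w' y'; exists (absz (n0 - n)) => i ib.
  by rewrite /f1 h0 ?(lin0 (Yl.2 _ _)) ?scaler0//; lia.
have s2 w' y' : finsupp (f2 w' y').
  have [n0 h0] := Yt (J (lmat C a)) y'; exists (absz n0) => i ib.
  by rewrite /f2 h0 ?(lin0 (Il.2 _ _)) ?scaler0//; lia.
have d1 i : d (f1 w y i) = f1 w (d y) i + f1 (dW w) y i + c *: f1 w y i.
  rewrite /f1 (linZ d_lin) -/(A a _ _) d_op /A /current /hat_of hw.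
  rewrite (linB (Yl.2 _ _)) (linD (Yl.2 _ _)) (linZ (Yl.2 _ _)) -addrA -opprD -scalerDl.
  rewrite scalerBr scalerDr -scalerN -scaleNr; congr (_ + _).
  rewrite !scalerA; congr (_ *: _); rewrite mulrC; congr (_ * _).
  by rewrite /c !intrD !intrN; ring.
have d2 i : d (f2 w y i) = f2 w (d y) i + f2 (dW w) y i + c *: f2 w y i.
  rewrite /f2 (linZ d_lin) hw -/(A a _ _) d_op (linB (Il.2 _ _)) (linZ (Il.2 _ _)).
  rewrite /A /current /hat_of -!addrA scalerDr; congr (_ + _).
  rewrite addrC -addrA scalerDr; congr (_ + _).
  rewrite -opprD -scalerDl -scaleNr !scalerA; congr (_ *: _); rewrite mulrC; congr (_ * _).
  by rewrite /c !intrD !intrN; ring.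
rewrite !IE (linB d_lin) (linZ d_lin) (evsum_lin d_lin (s1 _ _)) (evsum_lin d_lin (s2 _ _)).
rewrite (eq_evsum d1) (eq_evsum d2).
have sc g : finsupp g -> finsupp (fun i => c *: g i : M) := @finsuppcZ _ _ c g.
have e1 := evsumD (finsuppD (s1 w (d y)) (s1 (dW w) y)) (sc _ (s1 w y)).
have e2 := evsumD (finsuppD (s2 w (d y)) (s2 (dW w) y)) (sc _ (s2 w y)).
rewrite e1 e2 (evsumD (s1 w (d y)) (s1 (dW w) y)) (evsumD (s2 w (d y)) (s2 (dW w) y)).
rewrite (evsumZ c (s1 w y)) (evsumZ c (s2 w y)) !scalerDr scalerN !scalerA (mulrC c).
by rewrite !opprD (AC (3*3) ((1*4)*(2*5)*(3*6))).
Qed.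

End GradingDefect.

Section IntertwinerConstruction.
Variables (C : numFieldType) (p : nat).
Let k := (4 * p)%N.
Variables (V : voa C) (J : {linear 'M[C]_2 -> V}).
Hypothesis hV : is_affine_voa k J.
Variables (W : voa_module V) (M : voa_module V).
Hypothesis hW : is_affine_module k k J W.
Hypothesis hM : is_affine_module k (2 * p) J M.
Let YW := @modY C V W.
Let YM := @modY C V M.
Let AW := current J YW.
Let A := current J YM.
Let omega := conformal_vector V.
Let dW : W -> W := YW omega 1.
Let d : M -> M := YM omega 1.
Let hYW : vmod YW := module_vmod W.
Let hYM : vmod YM := module_vmod M.
Let repW := mod_rep hW.
Let repM := mod_rep hM.
Let vac := vacuum V.

Lemma gminus_shift (D : M -> M) (s : int) : linear D ->
  (forall n x, D (A LH n x) = A LH n (D x) + (- s * n)%:~R *: A LH n x) ->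
  forall a z, D (Eminus J YM a z) = Eminus J YM a (D z) + (s * a%:Z)%:~R *: Eminus J YM a z.
Proof.
move=> Dl Ds; apply: (expop_shift (gminus_lin repM) Dl) => j x.
rewrite /gminus (linZ Dl) -/(A LH _ _) Ds scalerDr mulrNN; congr (_ + _).
by rewrite !scalerA mulrC.
Qed.

Lemma gplus_shift (D : M -> M) (s : int) : linear D ->
  (forall n x, D (A LH n x) = A LH n (D x) + (- s * n)%:~R *: A LH n x) ->
  forall b z, D (Eplus J YM b z) = Eplus J YM b (D z) + (- s * b%:Z)%:~R *: Eplus J YM b z.
Proof.
move=> Dl Ds; apply: (expop_shift (gplus_lin repM) Dl) => j x.
rewrite /gplus (linZ Dl) -/(A LH _ _) Ds scalerDr; congr (_ + _).
by rewrite !scalerA mulrC.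
Qed.

(** The last two clauses are what the traces require: e_{-1} w = 0 brings the quadratic Sugawara
    terms within reach, and the value on the bottom of the top space normalizes [I]. *)
Lemma intertwiner_exists w v : hw_vector AW k%:R w -> w <> 0 ->
  hw_vector A (2 * p)%N%:R v -> v <> 0 ->
  exists I : W -> int -> M -> M, [/\ is_intertwining (V := V) p%:R I,
    AW LE (-1) w = 0 &
    I w (-1) (iter (2 * p) (A LF 0) v) = (-1) ^ (- p%:Z) *: v].
Proof.
move=> hw w0 hwv v0.
have [phi [phil phio phi0]] := phi_exists hV hW hw w0.
have [psi [psil psio psi0 psid]] := psi_exists hV hM hwv v0.
have Etr := mod_Eplus_trunc hV hM.
have wv : weight_vec A p%:Z v.
  by case: hwv => _ _ h0; rewrite /weight_vec h0 natrM.
have dec y : exists c, decomposes A y c.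
  exact: (weight_generated repM wv (irr_generated y (mod_irr hM) v0)).
have dl : linear d by exact: L0_lin.
have dop a n x : d (A a n x) = A a n (d x) - n%:~R *: A a n x by exact: (L0_op hV).
have dWl : linear dW by exact: L0_lin.
have dWop a n x : dW (AW a n x) = AW a n (dW x) - n%:~R *: AW a n x by exact: (L0_op hV).
pose I := Iop dec phi psi p%:Z.
have Il : mode_linear I by exact: (Iop_lin hYM repM Etr).
have It : mode_truncation I by exact: (Iop_trunc hYM repM Etr).
have IJ u w' y : jac YW YM YM I u w' y by exact: (Iop_jac hV hYM repM Etr dec hYW).
have dww : dW w = p%:R *: w.
  by rewrite -(weight_top C p); exact: (L0_hw_vector hV hW hw).
have Phid mu y N : d (Phi J YM mu vac y N) =
    Phi J YM mu vac (d y) N - (N + 1 + mu)%:~R *: Phi J YM mu vac y N.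
  rewrite -[N + 1 + mu]mul1r; apply: (D_Phi hYM repM Etr dl).
    by apply: gminus_shift => // n x; rewrite dop mulN1r mulrNz scaleNr.
  by apply: gplus_shift => // n x; rewrite dop mulN1r mulrNz scaleNr.
have Hl := repM.1 LH 0.
have PhiH mu y N : weight_vec A mu y ->
    A LH 0 (Phi J YM mu vac y N) = (2 * mu%:~R) *: Phi J YM mu vac y N.
  move=> wy; have H0 n x : A LH 0 (A LH n x) = A LH n (A LH 0 x) + (- 0 * n)%:~R *: A LH n x.
    by rewrite oppr0 mul0r; exact: (H0_op repM LH n x).
  have := D_Phi hYM repM Etr Hl (gminus_shift Hl H0) (gplus_shift Hl H0) mu y N.
  rewrite -/(A LH 0 _) -/(A LH 0 y) => ->.
  by rewrite mul0r mulr0z scale0r subr0 wy (linZ (Phi_lin hYM repM Etr mu vac N)).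
have psid' x : d (psi x) = psi (d x + 2^-1 *: A LH 0 x + p%:R *: x).
  exact: (esym (psid x)).
(* Transport through [psi] turns L_0 into L_0 + h_0/2 + p: the term h_0/2 cancels the degree mu of
   (-z)^mu, and p cancels the index shift. *)
have base : graded_at I dW d p%:R w.
  move=> n; apply: (weight_span dec).
    split=> [|c y y' hy hy'].
      by rewrite !(lin0 (Il.2 _ n)) (lin0 dl) !(lin0 (Il.2 _ n)) scaler0 addr0 subr0.
    rewrite !(Il.2 _ n) !dl !(Il.2 _ n) hy hy' !scalerDr scalerN !scalerA (mulrC c) opprD.
    by rewrite (AC (3*3) ((1*4)*(2*5)*(3*6))).
  move=> mu y wy; have wdy : weight_vec A mu (d y).
    have wy' : A LH 0 y = (2 * mu%:~R) *: y := wy.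
    have := dop LH 0 y; rewrite mulr0z scale0r subr0 wy' (linZ dl).
    by move=> e; rewrite /weight_vec e.
  rewrite dww (linZ (Il.1 n y)) /I /Iop phi0.
  rewrite (Ival_weight hYM repM Etr dec _ _ wy) (Ival_weight hYM repM Etr dec _ _ wdy).
  rewrite psid' Phid PhiH// -!(linZ psil) -(linD psil) -(linB psil).
  congr psi; move: (Phi _ _ _ _ (d y) _) (Phi _ _ _ _ y _) => X Z.
  rewrite scalerA mulrA mulVf ?pnatr_eq0// mul1r -addrA -addrA -[RHS]addrA.
  congr (_ + _); rewrite -scalerDl -scaleNr -!scaleNr -!scalerDl; congr (_ *: _).
  by rewrite !intrD; ring.
have graded w' : graded_at I dW d p%:R w'.
  apply: (irr_generated w' (mod_irr hW) w0 (S := graded_at I dW d p%:R)) => //.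
    exact: graded_submod.
  move=> a n u gu.
  by apply: graded_op => //; [exact: vmod_lin|exact: vmod_trunc].
exists I; split.
- split=> //; last first.
    by apply: (jacobiP (vmod_lin hYM) Il (vmod_trunc hYW) (vmod_trunc hYM) It).2.
  move=> w' n x; rewrite /virL addNr.
  have := jac_comm (IJ omega w' x) 1 (n - 1).
  rewrite -/(d _) graded evsum_recl; last first.
    exists 2%N => -[//|[//|i]] _; by rewrite binz1 scale0r.
  rewrite (@evsum1 _ _ _ 0%N); last by case=> // i _; rewrite binz1 scale0r.
  rewrite binz0 binz_1 !scale1r (_ : 1 + (n - 1) - 0%:Z = n); last by lia.
  rewrite (_ : 1 + (n - 1) - 1%:Z = n - 1); last by lia.
  rewrite -/(dW _) -/(d _) => /eqP; rewrite -addrA (inj_eq (addrI _)) [X in _ == X]addrC.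
  rewrite (inj_eq (addrI _)) => /eqP <-; rewrite -scaleNr; congr (_ *: _).
  by rewrite intrB; ring.
(* The flowed e_{-1} is e_0, which kills the vacuum; [phi] is injective because W is irreducible. *)
- have wE : phi (AW LE (-1) w) = 0.
    by rewrite phio phi0; exact: (current_vac J LE (n := 0) isT).
  have := mod_irr hW (S := fun u => phi u = 0); case.
  + split; first by rewrite (lin0 phil).
    by move=> c u u' hu hu'; rewrite phil hu hu' scaler0 addr0.
  + move=> a n u hu; rewrite phio hu.
    exact: (lin0 ((flow_rep (currentV_rep hV)).1 a n)).
  + by apply.
  + by move=> /(_ w); rewrite phi0 => /(vac_neq0 hV).
- set y0 := iter _ _ _; have wy : weight_vec A (- p%:Z) y0.
    have := bottom_H hM hwv; rewrite -/A -/y0 /weight_vec => ->; congr (_ *: _).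
    by rewrite natrM mulrNz mulrN.
  rewrite /I /Iop phi0 (Ival_weight hYM repM Etr dec _ _ wy).
  suff -> : Phi J YM (- p%:Z) vac y0 (-1 + p%:Z) = (-1) ^ (- p%:Z) *: y0.
    by rewrite (linZ psil) psi0.
  (* The positive modes of h kill the top space, so only the constant terms of both exponentials
     contribute and the operator reduces to the sign. *)
  have T0 b : (0 < b)%N -> Eplus J YM b y0 = 0.
    case: b => // b _; have b1 : b.+1%:R != 0 :> C by rewrite pnatr_eq0.
    have gp j x : gplus J YM j x = - 2^-1 *: A LH j%:Z x by [].
    elim/expop_ind: b b1 => b IHb b1; apply: (scalerI b1); rewrite scaler0 expopS.
    apply: big1 => j _; have [->|bj] := posnP (b - j)%N.
      have := pos_string repM hwv LH (n := j.+1%:Z) (2 * p) isT.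
      by rewrite -/A -/y0 expop0 gp => ->; rewrite scaler0.
    have lt : ((b - j).-1 < b)%N by have := ltn_ord j; lia.
    rewrite -[expop _ (b - j) y0]/(Eplus J YM (b - j) y0).
    by rewrite -(prednK bj) (IHb _ lt) ?pnatr_eq0// gp (lin0 (repM.1 LH _ : linear (A LH _))) scaler0.
  rewrite /Phi /vop; congr (_ *: _).
  have inner n : sumfam (- p%:Z) (fun b n => YM vac n (Eplus J YM b y0)) n =
      if n - p%:Z == -1 then y0 else 0.
    rewrite /sumfam (@evsum1 _ _ _ 0%N); last first.
      by case=> // b _; rewrite T0 ?(lin0 ((vmod_lin hYM).2 _ _)).
    by rewrite subz0 (vmod_vac hYM).
  rewrite /mulEminus (@evsum1 _ _ _ 0%N).
    by rewrite inner ifT//; apply/eqP; lia.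
  move=> a a0; rewrite inner ifF ?(lin0 (Eminus_lin repM _))//.
  by apply/eqP; lia.
Qed.

End IntertwinerConstruction.

(** * Traces on finite-dimensional subspaces *)

Section Bases.
Variables (C : numFieldType) (M : lmodType C).
Implicit Type S : set M.

Definition independent m (b : 'I_m -> M) :=
  forall a : 'I_m -> C, \sum_i a i *: b i = 0 -> forall i, a i = 0.

Lemma independent_bound S d (g : 'I_d -> M) m (b : 'I_m -> M) :
  (forall v, S v -> exists a : 'I_d -> C, v = \sum_i a i *: g i) ->
  (forall i, S (b i)) -> independent b -> (m <= d)%N.
Proof.
move=> Sg Sb ind; rewrite leqNgt; apply/negP => dm.
have [c hc] := choice (fun i => Sg _ (Sb i)).
pose A : 'M[C]_(m, d) := \matrix_(i, j) c i j.
have : kermx A != 0.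
  rewrite -mxrank_eq0 mxrank_ker subn_eq0 -ltnNge.
  exact: leq_ltn_trans (rank_leq_col A) dm.
case/rowV0Pn => u /sub_kermxP uA; apply/negP; rewrite negbK; apply/eqP/rowP => i.
rewrite mxE; apply: (ind (u 0)).
under eq_bigr do rewrite hc scaler_sumr.
rewrite exchange_big big1// => j _.
under eq_bigr do rewrite scalerA.
rewrite -scaler_suml; have -> : \sum_(i0 < m) u 0 i0 * c i0 j = (u *m A) 0 j.
  by rewrite mxE; apply: eq_bigr => l _; rewrite mxE.
by rewrite uA mxE scale0r.
Qed.

Definition snoc m (b : 'I_m -> M) (v : M) (i : 'I_m.+1) : M :=
  if insub (val i) is Some j then b j else v.

Lemma sum_snoc m (b : 'I_m -> M) v (a : 'I_m.+1 -> C) :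
  \sum_i a i *: snoc b v i =
  \sum_(i < m) a (widen_ord (leqnSn m) i) *: b i + a ord_max *: v.
Proof.
rewrite big_ord_recr/=; congr (_ + _ *: _).
  by apply: eq_bigr => i _; rewrite /snoc /= valK.
by rewrite /snoc insubN//= ltnn.
Qed.

Lemma basis_exists S : submod S -> finite_dim_space S ->
  exists d (b : 'I_d -> M), basis_of_space S b.
Proof.
move=> Ss [d [g Sg]].
pose P m := `[< exists b : 'I_m -> M, (forall i, S (b i)) /\ independent b >].
have P0 : P 0%N by apply/asboolP; exists (fun=> 0); split=> [[]|a _ []].
have PB m : P m -> (m <= d)%N.
  by move=> /asboolP[b [Sb ib]]; exact: independent_bound Sg Sb ib.
case: (ex_maxnP (ex_intro _ 0%N P0) PB) => m /asboolP[b [Sb ib]] mmax.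
exists m, b; split=> // v; split=> [Sv|[a ->]]; last first.
  by apply: (submod_sum _ Ss) => i _; exact: (submodZ _ Ss).
apply: contrapT => nv; suff /mmax : P m.+1 by rewrite ltnn.
apply/asboolP; exists (snoc b v); split=> [i|a].
  by rewrite /snoc; case: insub.
rewrite sum_snoc => a0; have av : a ord_max = 0.
  apply: contrapT => /eqP an; apply: nv.
  exists (fun i => - (a ord_max)^-1 * a (widen_ord (leqnSn m) i)).
  under eq_bigr do rewrite -scalerA.
  rewrite -scaler_sumr; apply: (scalerI an).
  rewrite scalerA mulrN mulfV// scaleN1r; apply/eqP; rewrite -addr_eq0 addrC.
  exact/eqP.
rewrite av scale0r addr0 in a0.
have az := ib _ a0 => i; case: (unliftP ord_max i) => [j ->|->//].
by rewrite -(az j); congr a; apply: val_inj; rewrite /= /bump leqNgt ltn_ord.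
Qed.

End Bases.

Section Matrices.
Variables (C : numFieldType).

Definition represents (M N : lmodType C) d d' (b : 'I_d -> M) (b' : 'I_d' -> N)
  (T : M -> N) (A : 'M[C]_(d', d)) := forall j, T (b j) = \sum_i A i j *: b' i.

Lemma represents_exists (M N : lmodType C) (S : set M) (S' : set N) d d'
    (b : 'I_d -> M) (b' : 'I_d' -> N) (T : M -> N) :
  basis_of_space S b -> basis_of_space S' b' -> (forall x, S x -> S' (T x)) ->
  exists A, represents b b' T A.
Proof.
move=> [Sb ib] [Sb' _] TS.
have Sj j : S (b j).
  apply/Sb; exists (fun i => (i == j)%:R); rewrite (bigD1 j)//= eqxx scale1r.
  by rewrite big1 ?addr0// => i /negbTE ->; rewrite scale0r.
have [c hc] := choice (fun j => (Sb' _).1 (TS _ (Sj j))).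
by exists (\matrix_(i, j) c j i) => j; rewrite hc; apply: eq_bigr => i _; rewrite mxE.
Qed.

Lemma represents_comp (M N P : lmodType C) d d' d'' (b : 'I_d -> M) (b' : 'I_d' -> N)
    (b'' : 'I_d'' -> P) (T : M -> N) (T' : N -> P) A A' : linear T' ->
  represents b b' T A -> represents b' b'' T' A' ->
  represents b b'' (fun x => T' (T x)) (A' *m A).
Proof.
move=> Tl' hA hA' j; rewrite hA (lin_sum Tl').
under eq_bigr do rewrite (linZ Tl') hA' scaler_sumr.
rewrite exchange_big; apply: eq_bigr => i _.
under eq_bigr do rewrite scalerA mulrC.
by rewrite -scaler_suml mxE.
Qed.

Lemma represents_uniq (M N : lmodType C) d d' (b : 'I_d -> M) (b' : 'I_d' -> N) T A A' :
  independent b' -> represents b b' T A -> represents b b' T A' -> A = A'.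
Proof.
move=> ib hA hA'; apply/matrixP => i j; apply/eqP; rewrite -subr_eq0; apply/eqP.
apply: (ib (fun i => A i j - A' i j)).
under eq_bigr do rewrite scalerBl.
by rewrite sumrB -hA -hA' subrr.
Qed.

Lemma represents_id (M : lmodType C) d (b : 'I_d -> M) : represents b b id 1%:M.
Proof.
move=> j; rewrite (bigD1 j)//= mxE eqxx scale1r big1 ?addr0// => i /negbTE ij.
by rewrite mxE ij scale0r.
Qed.

Lemma idl (M : lmodType C) : linear (@id M). Proof. by []. Qed.

Variables (M : lmodType C) (S : set M).

(** Independence of the basis chosen by [xget]: the change-of-basis matrices P and Q are mutually
    inverse, possibly of rectangular type, and A P = P A' gives equal traces by cyclicity. *)
Lemma trace_onE d (b : 'I_d -> M) (T : M -> M) A : linear T ->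
  basis_of_space S b -> represents b b T A -> trace_on S T = \tr A.
Proof.
move=> Tl hb hA; rewrite /trace_on; case: xgetP => [t _|]; last first.
  by move=> /(_ (\tr A)) []; exists d, b, A.
move=> [d' [b' [A' [hb' hA' ->]]]].
have [P hP] := represents_exists (T := id) hb' hb (fun x Sx => Sx).
have [Q hQ] := represents_exists (T := id) hb hb' (fun x Sx => Sx).
have QP : Q *m P = 1%:M.
  exact: represents_uniq hb'.2 (represents_comp (@idl M) hP hQ) (represents_id _).
have AP : A *m P = P *m A'.
  exact: represents_uniq hb.2 (represents_comp Tl hP hA) (represents_comp (@idl M) hA' hP).
by rewrite -[A']mul1mx -QP -mulmxA -AP mulmxA mxtrace_mulC mulmxA -[A in RHS]mul1mx;
  rewrite (represents_uniq hb.2 (represents_comp (@idl M) hQ hP) (represents_id _)).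
Qed.

Hypotheses (Ss : submod S) (Sf : finite_dim_space S).

Lemma trace_on_lin (c : C) T T' : linear T -> linear T' ->
  (forall x, S x -> S (T x)) -> (forall x, S x -> S (T' x)) ->
  trace_on S (fun x => c *: T x + T' x) = c * trace_on S T + trace_on S T'.
Proof.
move=> Tl Tl' TS TS'; have [d [b hb]] := basis_exists Ss Sf.
have [A hA] := represents_exists hb hb TS; have [A' hA'] := represents_exists hb hb TS'.
rewrite (trace_onE Tl hb hA) (trace_onE Tl' hb hA').
rewrite (@trace_onE _ b _ (c *: A + A')) ?linearD ?linearZ//.
  move=> e x y; rewrite Tl Tl' !scalerDr !scalerA addrACA.
  by rewrite (mulrC c).
move=> j; rewrite hA hA' scaler_sumr -big_split/=; apply: eq_bigr => i _.
by rewrite !mxE scalerDl scalerA.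
Qed.

Lemma trace_on_ext T T' : linear T -> linear T' ->
  (forall x, S x -> S (T x)) -> (forall x, S x -> T x = T' x) ->
  trace_on S T = trace_on S T'.
Proof.
move=> Tl Tl' TS TT'; have [d [b hb]] := basis_exists Ss Sf.
have [A hA] := represents_exists hb hb TS.
rewrite (trace_onE Tl hb hA) (trace_onE (A := A) Tl' hb)// => j; rewrite -hA TT'//.
apply/hb.1; exists (fun i => (i == j)%:R); rewrite (bigD1 j)//= eqxx scale1r.
by rewrite big1 ?addr0// => i /negbTE ->; rewrite scale0r.
Qed.

Lemma trace_on0 : trace_on S (fun=> 0) = 0.
Proof.
have [d [b hb]] := basis_exists Ss Sf.
rewrite (@trace_onE _ b _ 0) ?mxtrace0//; first by move=> c x y; rewrite scaler0 addr0.
by move=> j; rewrite big1// => i _; rewrite mxE scale0r.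
Qed.

Lemma trace_on_scalar (c : C) (v : M) T : linear T -> v <> 0 ->
  (forall x, S x <-> exists a, x = a *: v) -> T v = c *: v -> trace_on S T = c.
Proof.
move=> Tl v0 Sv Tv.
have hb : basis_of_space S (fun _ : 'I_1 => v).
  split=> [x|a]; last first.
    rewrite big_ord1 => /eqP; rewrite scaler_eq0 => /orP[/eqP a0 i|/eqP//].
    by rewrite -a0; congr a; rewrite ord1.
  rewrite Sv; split=> [[a ->]|[a ->]].
    by exists (fun=> a); rewrite big_ord1.
  by rewrite big_ord1; exists (a ord0).
rewrite (@trace_onE _ _ _ c%:M Tl hb) ?mxtrace_scalar ?mulr1n// => j.
by rewrite (ord1 j) big_ord1 mxE eqxx mulr1n.
Qed.

End Matrices.

(** Cyclicity between two different spaces: the modes entering the traces move one level of the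
    module to another. *)
Lemma trace_on_comm (C : numFieldType) (M N : lmodType C) (S : set M) (S' : set N)
    (T : M -> N) (T' : N -> M) :
  submod S -> finite_dim_space S -> submod S' -> finite_dim_space S' ->
  linear T -> linear T' -> (forall x, S x -> S' (T x)) -> (forall y, S' y -> S (T' y)) ->
  trace_on S (fun x => T' (T x)) = trace_on S' (fun y => T (T' y)).
Proof.
move=> Ss Sf Ss' Sf' Tl Tl' TS TS'.
have [d [b hb]] := basis_exists Ss Sf; have [d' [b' hb']] := basis_exists Ss' Sf'.
have [A hA] := represents_exists hb hb' TS; have [A' hA'] := represents_exists hb' hb TS'.
have cl : linear (fun x => T' (T x)) by move=> c x y; rewrite Tl Tl'.
have cl' : linear (fun x => T (T' x)) by move=> c x y; rewrite Tl' Tl.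
rewrite (trace_onE cl hb (represents_comp Tl' hA hA')).
by rewrite (trace_onE cl' hb' (represents_comp Tl hA' hA)) mxtrace_mulC.
Qed.

(** * Recursions for the trace functions *)

Section GradedTraces.
Variables (C : numFieldType) (k i p : nat) (V : voa C) (J : {linear 'M[C]_2 -> V}).
Hypothesis hV : is_affine_voa k J.
Variables (W M : voa_module V).
Hypothesis hM : is_affine_module k i J M.
Variable I : W -> int -> M -> M.
Hypothesis hI : is_intertwining (V := V) p%:R I.
Let YW := @modY C V W.
Let YM := @modY C V M.
Let omega := conformal_vector V.
Let h : C := conformal_weight C k i.
Let hYW : vmod YW := module_vmod W.
Let hYM : vmod YM := module_vmod M.
Let YMl : mode_linear YM := vmod_lin hYM.
Let Il : mode_linear I. Proof. by case: hI. Qed.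

(** Levels are indexed by all integers; the negative ones are zero, which is what stops the
    recursions in the level. *)
Definition level (N : int) : set M := eigenspace_of (YM omega 1) (h + N%:~R).

Definition has_degree (c : int) : set W := eigenspace_of (YW omega 1) (p%:R + c%:~R).

Lemma jacI u w x : jac YW YM YM I u w x.
Proof.
case: hI => _ It _ IJ.
exact: ((jacobiP YMl Il (vmod_trunc hYW) (vmod_trunc hYM) It).1 IJ).
Qed.

Lemma eigenspace_submod (N : lmodType C) (T : N -> N) (e : C) :
  linear T -> submod (eigenspace_of T e).
Proof.
move=> Tl; split=> [|a u v]; first by rewrite /eigenspace_of /= (lin0 Tl) scaler0.
rewrite /eigenspace_of /= => hu hv; rewrite Tl hu hv scalerDr !scalerA.
by rewrite (mulrC a).
Qed.

Lemma level_submod N : submod (level N).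
Proof. exact/eigenspace_submod/YMl.2. Qed.

Lemma level_fin N : finite_dim_space (level N).
Proof. exact: mod_finite_dim. Qed.

Lemma degree_submod c : submod (has_degree c).
Proof. exact/eigenspace_submod/(vmod_lin hYW).2. Qed.

Lemma level_neg (N : int) x : N < 0 -> level N x -> x = 0.
Proof.
move=> N0 Sx; apply: contrapT => x0.
have [t /eqP] := L0_eig_level hV hM (Sx : YM omega 1 x = _) x0.
rewrite -/h (inj_eq (addrI _)) -[t%:R]/(t%:Z%:~R) eqr_int => /eqP e.
by move: N0; rewrite e.
Qed.

(** The index [e] is the conformal weight minus 1: it is 0 for currents and 1 for the conformal
    vector. *)
Definition homogeneous (u : V) (e : int) :=
  (forall N n x, level N x -> level (N + e - n) (YM u n x)) /\
  (forall c n w, has_degree c w -> has_degree (c + e - n) (YW u n w)).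

Lemma current_homogeneous a : homogeneous (J (lmat C a)) 0.
Proof.
split=> N n x; rewrite /level /has_degree /eigenspace_of /= => hx; rewrite addr0.
  have := L0_current hV hYM a n x; rewrite /current /hat_of -/omega hx (linZ (YMl.2 _ _)) => ->.
  by rewrite -scalerBl intrB addrA.
have := L0_current hV hYW a n x; rewrite /current /hat_of -/omega hx.
by rewrite (linZ ((vmod_lin hYW).2 _ _)) => ->; rewrite -scalerBl intrB addrA.
Qed.

Lemma L0_omega : voaY omega 1 omega = 2%:R *: omega.
Proof.
have Yl := @voa_linear C V; have := voa_virasoro 0 (-2) (vacuum V); rewrite /= -/omega.
rewrite (_ : 0 + 1 = 1 :> int)// (_ : -2 + 1 = -1 :> int)//.
rewrite (voa_creation omega).1 ((voa_creation omega).2 1)// (lin0 (Yl.2 _ _)) subr0.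
by move=> e; rewrite [LHS]e scale0r addr0.
Qed.

Lemma omega_shift (N : lmodType C) (Y : V -> int -> N -> N) n x : vmod Y ->
  Y omega 1 (Y omega n x) = Y omega n (Y omega 1 x) + (1 - n)%:~R *: Y omega n x.
Proof.
move=> hY; rewrite [LHS](jac_comm (vmod_jac hY omega omega x)); congr (_ + _).
rewrite evsum_recl; last by exists 2%N => -[//|[//|j]] _; rewrite binz1 scale0r.
rewrite (@evsum1 _ _ _ 0%N); last by case=> // j _; rewrite binz1 scale0r.
rewrite binz0 binz_1 !scale1r subz0 L0_omega (linZ ((vmod_lin hY).1 _ _)).
rewrite (vmod_derivation hY) (_ : 1 + n - 1 = n) -?scalerDl; last by lia.
by congr (_ *: _); rewrite intrD intrB; ring.
Qed.

Lemma omega_homogeneous : homogeneous omega 1.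
Proof.
split=> N n x; rewrite /level /has_degree /eigenspace_of /= => hx.
  rewrite (omega_shift n x hYM) hx (linZ (YMl.2 _ _)) -scalerDl.
  by congr (_ *: _); rewrite !intrB intrD; ring.
rewrite (omega_shift n x hYW) hx (linZ ((vmod_lin hYW).2 _ _)) -scalerDl.
by congr (_ *: _); rewrite !intrB intrD; ring.
Qed.

Lemma mode_level c w N (m : int) x : has_degree c w -> level N x ->
  level (N + c - 1 - m) (I w m x).
Proof.
rewrite /level /has_degree /eigenspace_of /= => hw hx.
have der n : I (YW omega 0 w) n x = - (n%:~R + p%:R) *: I w (n - 1) x.
  by case: hI => _ _ d _; have := d w n x; rewrite /virL addNr.
rewrite (jac_comm (jacI omega w x)) hx (linZ (Il.2 _ _)) -/(YW _ _ _).
rewrite evsum_recl; last by exists 2%N => -[//|[//|j]] _; rewrite binz1 scale0r.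
rewrite (@evsum1 _ _ _ 0%N); last by case=> // j _; rewrite binz1 scale0r.
rewrite binz0 binz_1 !scale1r subz0 -/(YW _ _ _) -/(YW _ _ _) hw der (linZ (Il.1 _ _)).
rewrite (_ : 1 + m - 1 = m) -?scalerDl; last by lia.
by congr (_ *: _); rewrite !intrB !intrD; ring.
Qed.

Lemma trace_neg (N : int) (T : M -> M) : linear T -> N < 0 -> trace_on (level N) T = 0.
Proof.
move=> Tl N0; rewrite -(trace_on0 (level_submod N) (level_fin N)).
apply: (trace_on_ext (level_submod N) (level_fin N) Tl).
- by move=> c x y; rewrite scaler0 addr0.
- by move=> x /(level_neg N0) ->; rewrite (lin0 Tl); exact: (level_submod N).1.
- by move=> x /(level_neg N0) ->; rewrite (lin0 Tl).
Qed.

Lemma lin_bigsum K (a : nat -> C) (f : nat -> M -> M) : (forall j, linear (f j)) ->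
  linear (fun x => \sum_(j < K) a j *: f j x).
Proof.
move=> fl c x y; rewrite scaler_sumr -big_split/=; apply: eq_bigr => j _.
by rewrite fl scalerDr !scalerA (mulrC c).
Qed.

Lemma trace_sum N K (a : nat -> C) (f : nat -> M -> M) : (forall j, linear (f j)) ->
  (forall j x, level N x -> level N (f j x)) ->
  trace_on (level N) (fun x => \sum_(j < K) a j *: f j x) =
  \sum_(j < K) a j * trace_on (level N) (f j).
Proof.
move=> fl fS; have Ss := level_submod N; have Sf := level_fin N.
elim: K => [|K IHK].
  rewrite big_ord0 -(trace_on0 Ss Sf); congr trace_on.
  by apply/funext => x; rewrite big_ord0.
rewrite big_ord_recr/= -IHK addrC -(trace_on_lin Ss Sf _ (fl K) (lin_bigsum _ a fl) (fS K)).
  by congr trace_on; apply/funext => x; rewrite big_ord_recr/= addrC.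
by move=> x Sx; apply: (submod_sum _ Ss) => j _; exact/(submodZ _ Ss)/fS.
Qed.

(* The trace of o(w) at level N, for w of degree c. *)
Definition Ztr (c : int) (w : W) (N : int) := trace_on (level N) (I w (c - 1)).

Lemma zero_level c w N x : has_degree c w -> level N x -> level N (I w (c - 1) x).
Proof.
by move=> hw hx; have := mode_level (c - 1) hw hx; congr level; lia.
Qed.

Lemma Ztr_lin c (a : C) w w' N : has_degree c w -> has_degree c w' ->
  Ztr c (a *: w + w') N = a * Ztr c w N + Ztr c w' N.
Proof.
move=> hw hw'; rewrite -(trace_on_lin (level_submod N) (level_fin N)).
- by congr trace_on; apply/funext => x; rewrite Il.1.
- exact: Il.2.
- exact: Il.2.
- by move=> x; exact: zero_level.
- by move=> x; exact: zero_level.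
Qed.

Lemma Ztr0 (c N : int) : Ztr c 0 N = 0.
Proof.
rewrite -(trace_on0 (level_submod N) (level_fin N)); congr trace_on.
by apply/funext => x; rewrite (lin0 (Il.1 _ _)).
Qed.

Lemma Ztr_neg c w N : N < 0 -> Ztr c w N = 0.
Proof. by move=> N0; apply: trace_neg => //; exact: Il.2. Qed.

Section OneField.
Variables (u : V) (e : int) (w : W) (c : int).
Hypotheses (hu : homogeneous u e) (hw : has_degree c w).

(** The mode of [u] raises the level by [j] and the mode of [w] lowers it back, so the product acts
    on a single level. *)
Definition twotr (N j : int) := trace_on (level N) (fun x => I w (c - 1 + j) (YM u (e - j) x)).

Let comp_lin a b : linear (fun x => I w a (YM u b x)).
Proof. by move=> s x y; rewrite YMl.2 Il.2. Qed.

Let comp_lin' a b : linear (fun x => YM u b (I w a x)).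
Proof. by move=> s x y; rewrite Il.2 YMl.2. Qed.

Lemma twotr_neg (N j : int) : N < 0 -> twotr N j = 0.
Proof. by move=> N0; apply: trace_neg => //; exact: comp_lin. Qed.

Lemma twotr_cyc (N j : int) :
  trace_on (level N) (fun x => YM u (e - j) (I w (c - 1 + j) x)) = twotr (N - j) j.
Proof.
apply: trace_on_comm; [exact: level_submod|exact: level_fin|exact: level_submod|
  exact: level_fin|exact: Il.2|exact: YMl.2| |] => x hx.
  by have := mode_level (c - 1 + j) hw hx; congr level; lia.
by have := hu.1 _ (e - j) _ hx; congr level; lia.
Qed.

(* Cyclicity moves the level by j, so the commutator formula becomes a difference equation in the level. *)
Lemma twotr_step (N j : int) K : (forall n, (K <= n)%N -> YW u n%:Z w = 0) ->
  twotr (N - j) j =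
  twotr N j + \sum_(n < K) binz C (e - j) n * Ztr (c + e - n%:Z) (YW u n%:Z w) N.
Proof.
move=> uw; rewrite -twotr_cyc.
pose f n x := I (YW u n%:Z w) (c + e - n%:Z - 1) x.
have fl n : linear (f n) by exact: Il.2.
have fS n x : level N x -> level N (f n x) by move=> hx; exact: (zero_level (hu.2 _ _ _ hw)).
have cS x : level N x -> level N (I w (c - 1 + j) (YM u (e - j) x)).
  move=> hx; have := mode_level (c - 1 + j) hw (hu.1 _ (e - j) _ hx).
  by congr level; lia.
rewrite -[RHS]/(twotr N j + \sum_(n < K) binz C (e - j) n * trace_on (level N) (f n)).
rewrite -(trace_sum _ _ fl fS) -[twotr N j]mul1r /twotr.
rewrite -(trace_on_lin (level_submod N) (level_fin N) _ (comp_lin _ _) (lin_bigsum _ _ fl) cS).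
  congr trace_on; apply/funext => x; rewrite scale1r (jac_comm (jacI u w x)); congr (_ + _).
  rewrite (@evsumE _ _ _ K K)//.
    by apply: eq_bigr => n _; rewrite /f; congr (_ *: I _ _ _); lia.
  by move=> n /uw h'; rewrite -/YW h' (lin0 (Il.1 _ _)) scaler0.
by move=> x hx; apply: (submod_sum _ (level_submod N)) => n _; exact/(submodZ _ (level_submod N))/fS.
Qed.

(** The trace of the iterate formula, the first sum being reordered by cyclicity. Past the bound [K]
    every term passes through a negative level. *)
Lemma Ztr_iter l N K : (absz N + absz e + absz l < K)%N ->
  Ztr (c + e - l) (YW u l w) N =
  \sum_(n < K) ((-1) ^+ n * binz C l n) * twotr (N - (e - l + n%:Z)) (e - l + n%:Z) -
  (-1) ^ l * \sum_(n < K) ((-1) ^+ n * binz C l n) * twotr N (e - n%:Z).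
Proof.
move=> hK; pose f n x := YM u (l - n%:Z) (I w (c + e - l - 1 + n%:Z) x).
pose g n x := I w (c + e - 1 - n%:Z) (YM u n%:Z x).
have fl n : linear (f n) by exact: comp_lin'.
have gl n : linear (g n) by exact: comp_lin.
have fS n x : level N x -> level N (f n x).
  move=> hx; have := hu.1 _ (l - n%:Z) _ (mode_level (c + e - l - 1 + n%:Z) hw hx).
  by congr level; lia.
have gS n x : level N x -> level N (g n x).
  move=> hx; have := mode_level (c + e - 1 - n%:Z) hw (hu.1 _ n%:Z _ hx).
  by congr level; lia.
have fE n : twotr (N - (e - l + n%:Z)) (e - l + n%:Z) = trace_on (level N) (f n).
  rewrite -twotr_cyc; congr trace_on; apply/funext => x; rewrite /f.
  by congr (YM _ _ (I _ _ _)); lia.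
have gE n : twotr N (e - n%:Z) = trace_on (level N) (g n).
  by congr trace_on; apply/funext => x; rewrite /g; congr (I _ _ (YM _ _ _)); lia.
under eq_bigr do rewrite fE.
under [X in _ - _ * X]eq_bigr do rewrite gE.
pose a n : C := (-1) ^+ n * binz C l n.
have fsum := trace_sum K a fl fS; have gsum := trace_sum K a gl gS.
rewrite -[RHS]/(\sum_(n < K) a n * trace_on (level N) (f n) -
  (-1) ^ l * \sum_(n < K) a n * trace_on (level N) (g n)).
rewrite -fsum -gsum [RHS]addrC -mulNr.
have lg := lin_bigsum K a gl; have lf := lin_bigsum K a fl.
apply/esym; apply: (etrans (esym (trace_on_lin (level_submod N) (level_fin N) (- (-1) ^ l) lg lf _ _))).
- by move=> x hx; apply: (submod_sum _ (level_submod N)) => n _; exact/(submodZ _ (level_submod N))/gS.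
- by move=> x hx; apply: (submod_sum _ (level_submod N)) => n _; exact/(submodZ _ (level_submod N))/fS.
apply/esym; apply: (trace_on_ext (level_submod N) (level_fin N)); first exact: Il.2.
  + move=> s x y; rewrite (lin_bigsum K a fl) (lin_bigsum K a gl) !scalerDr !scalerA.
    by rewrite addrACA (mulrC s).
  + by move=> x hx; exact: (zero_level (hu.2 _ _ _ hw)).
  move=> x hx; rewrite (jac_iter (jacI u w x)) addrC scaleNr.
  congr (- (_ *: _) + _).
    rewrite (@evsumE _ _ _ K K)//.
      by apply: eq_bigr => n _; rewrite /g; congr (_ *: I _ _ _); lia.
    move=> n Kn; rewrite -/YM (level_neg _ (hu.1 _ _ _ hx)) ?(lin0 (Il.2 _ _)) ?scaler0//.
    by lia.
  rewrite (@evsumE _ _ _ K K)// => n Kn.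
  rewrite (level_neg _ (mode_level _ hw hx)) ?(lin0 (YMl.2 _ _)) ?scaler0//.
  by lia.
Qed.

End OneField.
End GradedTraces.

Lemma descend (C : numFieldType) (f g : int -> C) (s : nat) :
  (forall N, N < 0 -> f N = 0) -> (0 < s)%N ->
  (forall N, f N = g N + f (N - s%:Z)) ->
  forall K N, N < K%:Z -> f N = \sum_(r < K) g (N - r%:Z * s%:Z).
Proof.
move=> f0 s0 fg K N NK.
have key (t : nat) : f N = \sum_(r < t) g (N - r%:Z * s%:Z) + f (N - t%:Z * s%:Z).
  elim: t => [|t ->]; first by rewrite big_ord0 mul0r subr0 add0r.
  rewrite big_ord_recr/= -addrA fg; congr (_ + (_ + f _)).
  by lia.
by rewrite (key K) (f0 (N - K%:Z * s%:Z)) ?addr0//; nia.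
Qed.

(** * Words in the current modes applied to a highest-weight vector *)

Section Words.
Variables (C : numFieldType) (k : C) (W : lmodType C) (A : letter -> int -> W -> W).
Hypothesis repA : hat_rep k A.
Variables (i : nat) (w0 : W).
Hypothesis hw0 : hw_vector A i%:R w0.

(** The degree is carried by the predicate, so that later bounds on the degree can be read off from
    the way a vector was produced. *)
Inductive gen : int -> W -> Prop :=
| gen_top : gen 0 w0
| gen_zero c : gen c 0
| gen_lin c s u v : gen c u -> gen c v -> gen c (s *: u + v)
| gen_F c u : gen c u -> gen c (A LF 0 u)
| gen_low a n c u : n < 0 -> gen c u -> gen (c - n) (A a n u).

Inductive pure : int -> W -> Prop :=
| pure_top : pure 0 w0
| pure_zero c : 0 <= c -> pure c 0
| pure_lin c s u v : pure c u -> pure c v -> pure c (s *: u + v)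
| pure_low a n c u : n < 0 -> pure c u -> pure (c - n) (A a n u).

(* Powers of f_0 come leftmost, where they do not contribute to traces. *)
Inductive shuffled : int -> W -> Prop :=
| shuf_pure c u : pure c u -> shuffled c u
| shuf_zero c : shuffled c 0
| shuf_lin c s u v : shuffled c u -> shuffled c v -> shuffled c (s *: u + v)
| shuf_F c u : shuffled c u -> shuffled c (A LF 0 u).

Lemma gen_submod c : submod (gen c).
Proof. by split=> [|s u v]; [exact: gen_zero|exact: gen_lin]. Qed.

Lemma shuffled_submod c : submod (shuffled c).
Proof. by split=> [|s u v]; [exact: shuf_zero|exact: shuf_lin]. Qed.

Lemma gen_op c u a n : gen c u -> gen (c - n) (A a n u).
Proof.
move=> g; elim: g a n => {c u} [|c|c s u v _ IHu _ IHv|c u gu IHu|b m c u m0 gu IHu] a n.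
- have [vp vE vH] := hw0; have [n0|n0|->] := ltrgtP n 0.
  + exact: gen_low gen_top.
  + by rewrite vp//; exact: gen_zero.
  + rewrite subr0; case: a; [rewrite vE; exact: gen_zero|exact: gen_F gen_top|].
    by rewrite vH; exact/(submodZ _ (gen_submod _))/gen_top.
- by rewrite (lin0 (repA.1 _ _)); exact: gen_zero.
- by rewrite repA.1; exact: gen_lin.
- rewrite repA.2 addr0; apply: (submodD (gen_submod _)).
    apply: (submodD (gen_submod _)); first exact: gen_F.
    exact: (submodZ _ (gen_submod _)).
  by case: eqP => [->|_]; [rewrite subr0; exact: (submodZ _ (gen_submod _))|rewrite scale0r; exact: gen_zero].
- rewrite repA.2; apply: (submodD (gen_submod _)).
    apply: (submodD (gen_submod _)).
      by rewrite addrAC; exact: gen_low.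
    apply: (submodZ _ (gen_submod _)).
    by rewrite -addrA -opprD [m + n]addrC; exact: IHu.
  case: eqP => [e|_]; last by rewrite scale0r; exact: gen_zero.
  apply: (submodZ _ (gen_submod _)).
  by rewrite (_ : c - m - n = c)//; lia.
Qed.

Lemma gen_neg c u : gen c u -> c < 0 -> u = 0.
Proof.
elim=> {c u} [//|//|c s u v _ IHu _ IHv c0|c u _ IHu c0|a n c u n0 _ IHu c0].
- by rewrite IHu// IHv// scaler0 addr0.
- by rewrite IHu// (lin0 (repA.1 _ _)).
- by rewrite IHu ?(lin0 (repA.1 _ _))//; lia.
Qed.

(** Commuting a mode past f_0 yields a mode of the same index n < 0 and no central term, so f_0 can
    always be moved to the left. *)
Lemma shuffled_low c u a n : n < 0 -> shuffled c u -> shuffled (c - n) (A a n u).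
Proof.
move=> n0 s; elim: s a => {c u} [c u pu|c|c s u v _ IHu _ IHv|c u su IHu] a.
- exact/shuf_pure/pure_low.
- by rewrite (lin0 (repA.1 _ _)); exact: shuf_zero.
- by rewrite repA.1; exact: shuf_lin.
- rewrite repA.2 addr0 (lt_eqF n0) scale0r addr0.
  apply: (submodD (shuffled_submod _)); first exact: shuf_F.
  exact: (submodZ _ (shuffled_submod _)).
Qed.

Lemma gen_shuffled c u : gen c u -> shuffled c u.
Proof.
elim=> {c u} [|c|c s u v _ hu _ hv|c u _ hu|a n c u n0 _ hu].
- exact/shuf_pure/pure_top.
- exact: shuf_zero.
- exact: shuf_lin.
- exact: shuf_F.
- exact: shuffled_low.
Qed.

Lemma pure_gen c u : pure c u -> gen c u.
Proof.
elim=> {c u} [|c _|c s u v _ hu _ hv|a n c u n0 _ hu].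
- exact: gen_top.
- exact: gen_zero.
- exact: gen_lin.
- exact: gen_low.
Qed.

Lemma shuffled_gen c u : shuffled c u -> gen c u.
Proof.
elim=> {c u} [c u|c|c s u v _ hu _ hv|c u _ hu].
- exact: pure_gen.
- exact: gen_zero.
- exact: gen_lin.
- exact: gen_F.
Qed.

Definition heavy (c : int) (e : C) := exists s : int, - 2 * c < s /\ e = i%:R + s%:~R.

Definition Fpow n := iter n (A LF (-1)) w0.

Lemma gen_Fpow n : gen n%:Z (Fpow n).
Proof.
elim: n => [|n IHn]; first exact: gen_top.
by rewrite (_ : n.+1%:Z = n%:Z - -1); [exact: gen_op|lia].
Qed.

Lemma Fpow_weight n : A LH 0 (Fpow n) = (i%:R + (- 2 * n%:Z)%:~R) *: Fpow n.
Proof.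
elim: n => [|n IHn]; first by case: hw0 => _ _ ->; rewrite mulr0 addr0.
rewrite /Fpow iterS -/(Fpow n) (H0_op repA) IHn (linZ (repA.1 _ _)) -scalerDl.
by congr (_ *: _); rewrite -addrA -intrD; congr (_ + _%:~R); rewrite /=; lia.
Qed.

(* Negative modes of total degree c lower the weight by at most 2c, with equality only for f_{-1}^c. *)
Lemma pure_weight c u : pure c u -> 0 <= c /\
  exists b, killed (A LH 0) (heavy c) (u - b *: Fpow (absz c)).
Proof.
have ks c' := killed_submod (repA.1 LH 0) (heavy c').
elim=> {c u} [|c c0|c s u v _ [c0 [b hb]] _ [_ [b' hb']]|a n c u n0 _ [c0 [b hb]]].
- by split=> //; exists 1; rewrite scale1r subrr; exact: (ks _).1.
- by split=> //; exists 0; rewrite scale0r subr0; exact: (ks _).1.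
- split=> //; exists (s * b + b').
  rewrite scalerDl -scalerA opprD addrACA -scalerBr.
  exact: (ks _).2.
split; first by lia.
set F := Fpow (absz c) in hb *.
have lowered y : killed (A LH 0) (heavy c) y -> killed (A LH 0) (heavy (c - n)) (A a n y).
  move=> hy; apply: (killed_shift (repA.1 a n) (fun z => H0_op repA a n z) _ hy).
  move=> _ [s [sc ->]]; exists (s + wt a); rewrite -addrA -intrD; split=> //.
  by move: sc; case: (a) => /=; lia.
have FE : A a n u = A a n (u - b *: F) + b *: A a n F.
  by rewrite (linB (repA.1 _ _)) (linZ (repA.1 _ _)) subrK.
have wF : A LH 0 (A a n F) = (i%:R + (wt a - 2 * c)%:~R) *: A a n F.
  rewrite (H0_op repA) Fpow_weight (linZ (repA.1 _ _)) -scalerDl -addrA -intrD.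
  by congr (_ *: _); congr (_ + _%:~R); lia.
have [e|ne] := eqVneq (wt a - 2 * c) (- 2 * (c - n)); last first.
  exists 0; rewrite scale0r subr0 FE; apply: (submodD (ks _)); first exact: lowered.
  apply: (submodZ _ (ks _)); apply: (killed_eig wF); exists (wt a - 2 * c); split=> //.
  by move: ne; case: (a) => /=; lia.
have en : n = -1 by move: e; case: (a) => /=; lia.
have ea : a = LF by move: e; case: (a) => //=; lia.
have := lowered _ hb; rewrite ea en => hl; exists b.
rewrite (_ : absz (c - (-1))%R = (absz c).+1); last by lia.
have -> : Fpow (absz c).+1 = A LF (-1) F by [].
by rewrite -(linZ (repA.1 _ _)) -(linB (repA.1 _ _)).
Qed.

(* Move E past the F's one at a time: [e_m, f_{-1}] = h_{m-1} and [h_{m-1}, f_{-1}] = -2 f_{m-2}. *)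
Lemma E_Fpow m n : m <= 0 -> A LE m w0 = 0 -> A LE m (Fpow n.+2) =
  n.+2%:R *: A LH (m - 1) (Fpow n.+1) + (n.+2 * n.+1)%:R *: A LF (m - 2) (Fpow n).
Proof.
move=> m0 Ew0; have Al := repA.1.
have EF u : A LE m (A LF (-1) u) = A LF (-1) (A LE m u) + A LH (m - 1) u.
  by rewrite repA.2 /= scale1r ifN ?scale0r ?addr0//; lia.
have HF u : A LF (-1) (A LH (m - 1) u) = A LH (m - 1) (A LF (-1) u) + 2 *: A LF (m - 2) u.
  rewrite (hat_comm0 _ _ _ repA)//=.
  by congr (_ + _ *: A LF _ _); lia.
have FF u : A LF (-1) (A LF (m - 2) u) = A LF (m - 2) (A LF (-1) u).
  by rewrite (hat_comm0 _ _ _ repA)//= scale0r addr0.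
elim: n => [|n IHn].
  rewrite /Fpow /= EF EF Ew0 (lin0 (Al _ _)) add0r HF.
  by rewrite [2 *: A LH _ _]scaler_nat mulr2n addrAC.
have FS j : Fpow j.+1 = A LF (-1) (Fpow j) by [].
rewrite (FS n.+2) EF IHn (linD (Al _ _)) !(linZ (Al _ _)) HF FF -!FS scalerDr.
rewrite !scalerA (AC 4%AC ((1*4)*(2*3)))/=; congr (_ + _).
  by rewrite -[X in _ + X]scale1r -scalerDl -mulrSr.
by rewrite -scalerDl -natrM -natrD; congr (_%:R *: _); lia.
Qed.

End Words.

Lemma submod_evsum (C : numFieldType) (M : lmodType C) (S : M -> Prop) (f : nat -> M) :
  submod S -> (forall n, S (f n)) -> S (evsum f).
Proof.
move=> Ss Sf; rewrite /evsum; case: xgetP => [x _ [K hK]|_]; last exact: Ss.1.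
by rewrite -(hK K)//; apply: (submod_sum _ Ss).
Qed.

(** * Linear relations between trace functions on W *)

Section TraceRelations.
Variables (C : numFieldType) (V : voa C) (J : {linear 'M[C]_2 -> V}).
Hypothesis hV : is_affine_voa 16 J.
Variables (W M : voa_module V).
Hypothesis hW : is_affine_module 16 16 J W.
Hypothesis hM : is_affine_module 16 8 J M.
Variable I : W -> int -> M -> M.
Hypothesis hI : is_intertwining (V := V) 4%:R I.
Let YW := @modY C V W.
Let AW := current J YW.
Let omega := conformal_vector V.
Let hYW : vmod YW := module_vmod W.
Let repW : hat_rep 16%:R AW := mod_rep hW.
Variable w0 : W.
Hypothesis hw0 : hw_vector AW 16%:R w0.
Hypothesis Ew0 : AW LE (-1) w0 = 0.

Let deg (c : int) : W -> Prop := has_degree (V := V) 4 c.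
Let Z : int -> W -> int -> C := Ztr 16 8 I.
Let F := Fpow AW w0.
Let Gen := gen AW w0.
Let hom a := current_homogeneous 8 4 hV W M a.

Lemma deg_op a n c u : deg c u -> deg (c - n) (AW a n u).
Proof. by move=> du; have := (hom a).2 c n u du; rewrite addr0. Qed.

Lemma deg_top : deg 0 w0.
Proof.
rewrite /deg /has_degree /eigenspace_of /= addr0.
have := L0_hw_vector hV hW hw0; rewrite -[X in conformal_weight C X 16]/(4 * 4)%N.
by rewrite -[X in conformal_weight C _ X]/(4 * 4)%N weight_top.
Qed.

Lemma gen_deg c u : Gen c u -> deg c u.
Proof.
elim=> {c u} [|c|c s u v _ hu _ hv|c u _ hu|a n c u _ _ hu].
- exact: deg_top.
- exact: (@degree_submod _ 4 _ W _).1.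
- exact: (@degree_submod _ 4 _ W _).2.
- by rewrite -[c]subr0; exact: deg_op.
- exact: deg_op.
Qed.

(** In the cyclicity equation at j = 0 the two product traces coincide, leaving only the trace
    attached to a_0 u. *)
Lemma Z_zero_mode a c u N : deg c u -> Z c (AW a 0 u) N = 0.
Proof.
move=> du; have [n0 h0] := vmod_trunc hYW (J (lmat C a)) u.
have h1 n : ((absz n0).+1 <= n)%N -> YW (J (lmat C a)) n%:Z u = 0.
  by move=> hn; apply: h0; lia.
have := twotr_step hI (hom a) du N 0 h1.
rewrite !subr0 -[LHS]addr0 => /addrI; rewrite big_ord_recl binz0 mul1r big1; last first.
  by move=> n _; rewrite lift0 binz0S mul0r.
by rewrite addr0 subz0 => e; exact: (esym e).
Qed.

Lemma Z_lin c a u u' N : deg c u -> deg c u' ->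
  Z c (a *: u + u') N = a * Z c u N + Z c u' N.
Proof. by move=> du du'; exact: (Ztr_lin _ _ hI). Qed.

(** Traces vanish on the image of h_0, so a polynomial in h_0 acts on them through its constant
    term, here a product of nonzero numbers. *)
Lemma Z_killed (Lambda : C -> Prop) c u N : deg c u -> (forall e, Lambda e -> e <> 0) ->
  killed (AW LH 0) Lambda u -> Z c u N = 0.
Proof.
move=> du L0 [s [hs su]].
have key : deg c (polyop (AW LH 0) s u) /\
    Z c (polyop (AW LH 0) s u) N = (\prod_(e <- s) (- e)) * Z c u N.
  elim: s hs {su} => [|e s IHs] hs; first by rewrite big_nil mul1r.
  have [|dp Zp] := IHs; first by move=> b bs; apply: hs; rewrite inE bs orbT.
  have dp' := deg_op LH 0 dp; rewrite subr0 in dp'.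
  rewrite /= -scaleNr addrC big_cons; split; first exact: (@degree_submod _ 4 _ W _).2.
  by rewrite Z_lin// Z_zero_mode// addr0 Zp mulrA.
have [_] := key; rewrite su /Z (Ztr0 _ _ hI) => /esym/eqP; rewrite mulf_eq0.
case/orP => [|/eqP//]; rewrite prodf_seq_eq0 => /hasP[e es].
by rewrite oppr_eq0 => /eqP e0; case: (L0 e (hs _ es)).
Qed.

(** In degree c <= 8 all weights other than that of f_{-1}^c w0 exceed 16 - 2c >= 0, hence are
    nonzero and contribute no trace. *)
Lemma shuffled_Z (c : int) u : shuffled AW w0 c u -> c <= 8 ->
  exists b, forall N, Z c u N = b * Z c (F (absz c)) N.
Proof.
move=> hu c8; have dg c' u' : shuffled AW w0 c' u' -> deg c' u'.
  by move=> /shuffled_gen; exact: gen_deg.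
elim: hu c8 => {c u} [c u pu|c|c s u v su hu sv hv|c u su hu] c8.
- have [c0 [b kb]] := pure_weight repW hw0 pu; exists b => N.
  have dF : deg c (F (absz c)).
    rewrite -[X in deg X](_ : (absz c)%:Z = c); last by lia.
    exact/gen_deg/(gen_Fpow repW hw0).
  have du := gen_deg (pure_gen pu).
  have dr : deg c (- b *: F (absz c) + u) by exact: (@degree_submod _ 4 _ W _).2.
  move: kb; rewrite addrC -scaleNr => kb.
  have L0 (e : C) : heavy 16 c e -> e <> 0.
    move=> [s [hs ->]]; rewrite -[16%:R]/(16%:Z%:~R) -intrD => /eqP.
    by rewrite intr_eq0 => /eqP; lia.
  have := Z_killed N dr L0 kb; rewrite Z_lin// mulNr => /eqP.
  by rewrite addrC subr_eq0 => /eqP.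
- by exists 0 => N; rewrite mul0r; exact: (Ztr0 _ _ hI).
- have [b hb] := hu c8; have [b' hb'] := hv c8; exists (s * b + b') => N.
  by rewrite Z_lin ?hb ?hb' ?mulrDl ?mulrA//; exact: dg.
- by exists 0 => N; rewrite mul0r; apply: Z_zero_mode; exact: dg.
Qed.

Lemma gen_Z0 (c : int) u N : Gen c u -> c <= 7 -> Z c u N = 0.
Proof.
move=> gu c7; have [c0|c0] := ltP c 0.
  by rewrite (gen_neg repW gu c0); exact: (Ztr0 _ _ hI).
have [|b ->] := shuffled_Z (gen_shuffled repW gu); first by lia.
have gF := gen_Fpow repW hw0 (absz c); rewrite (_ : (absz c)%:Z = c) in gF; last by lia.
rewrite (Z_killed (Lambda := fun e => e <> 0) N (gen_deg gF)) ?mulr0//.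
apply: (killed_eig (Fpow_weight repW hw0 _)).
rewrite -[16%:R]/(16%:Z%:~R) -intrD => /eqP; rewrite intr_eq0 => /eqP.
by lia.
Qed.

(** The factor [b] does not depend on the level [N]; this is what later allows it to be read off at
    level 0. *)
Definition good c u := deg c u /\ exists b, forall N, Z c u N = b * Z 8 (F 8) N.

Lemma good_submod c : submod (good c).
Proof.
split=> [|s u u' [du [b hb]] [du' [b' hb']]].
  split; first exact: (@degree_submod _ 4 _ W _).1.
  by exists 0 => N; rewrite mul0r; exact: (Ztr0 _ _ hI).
split; first exact: (@degree_submod _ 4 _ W _).2.
by exists (s * b + b') => N; rewrite Z_lin// hb hb' mulrDl mulrA.
Qed.

Lemma good_gen (c : int) u : Gen c u -> c <= 8 -> good c u.
Proof.
move=> gu c8; split; first exact: gen_deg.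
have [c7|c7] := leP c 7; first by exists 0 => N; rewrite mul0r; exact: gen_Z0.
have [b hb] := shuffled_Z (gen_shuffled repW gu) c8.
by exists b => N; rewrite hb (_ : c = 8)//; lia.
Qed.

Lemma good_zero_mode a c u : deg c u -> good c (AW a 0 u).
Proof.
move=> du; split; first by rewrite -[c]subr0; exact: deg_op.
by exists 0 => N; rewrite mul0r; exact: Z_zero_mode.
Qed.

Lemma Gen_op c u a n : Gen c u -> Gen (c - n) (AW a n u).
Proof. exact: (gen_op repW hw0). Qed.

(** The correction terms of the cyclicity equation are traces of a_0 u, which vanish, and of a_n u
    with n >= 1, whose degree is at most 7. So the trace is periodic in the level with period [j],
    and zero at negative levels. *)
Lemma twotr_current a c u N j : Gen c u -> c <= 8 -> j != 0 ->
  twotr 16 8 I (J (lmat C a)) 0 u c N j = 0.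
Proof.
move=> gu c8 j0; pose t N' := twotr 16 8 I (J (lmat C a)) 0 u c N' j.
rewrite -/(t N).
have tneg N' : N' < 0 -> t N' = 0 by move=> ?; exact: (twotr_neg hV hM hI).
have [n0 h0] := vmod_trunc hYW (J (lmat C a)) u.
have h1 n : (absz n0 <= n)%N -> YW (J (lmat C a)) n%:Z u = 0.
  by move=> hn; apply: h0; lia.
have step N' : t (N' - j) = t N'.
  rewrite /t (twotr_step hI (hom a) (gen_deg gu) N' j h1) big1 ?addr0//.
  move=> n _; case: (val n) => [|m].
    by rewrite ?subz0 -[Ztr _ _ _ _ _ _]/(Z c (AW a 0 u) N') Z_zero_mode ?mulr0//; exact: gen_deg.
  rewrite -[Ztr _ _ _ _ _ _]/(Z (c - m.+1%:Z) (AW a m.+1%:Z u) N') gen_Z0 ?mulr0//.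
    exact: Gen_op.
  by lia.
have jp : (0 < absz j)%N by lia.
have step' N' : t N' = 0 + t (N' - (absz j)%:Z).
  rewrite add0r; have [j1|j1] := ltP 0 j.
    by rewrite (_ : (absz j)%:Z = j) ?step//; lia.
  by rewrite -(step (N' - (absz j)%:Z)); congr t; lia.
by rewrite (descend tneg jp step' (K := (absz N).+1)) ?big1//; lia.
Qed.

(* By [twotr_current] only the term o(u) a_0 of the associativity formula survives, up to a sign depending on m. *)
Lemma Z_low_mode a c u (m N : int) : Gen c u -> c <= 8 -> 0 < m ->
  Z (c + m) (AW a (- m) u) N = - (-1) ^ (- m) * twotr 16 8 I (J (lmat C a)) 0 u c N 0.
Proof.
move=> gu c8 m0.
have K0 : (absz N + absz 0%R + absz (- m) < absz N + absz m + 1)%N by lia.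
have := Ztr_iter hV hM hI (hom a) (gen_deg gu) K0; rewrite addr0 opprK => e.
rewrite [LHS]e {e}.
rewrite big1 ?add0r => [|n _]; last first.
  by rewrite (twotr_current _ _ gu c8) ?mulr0//; lia.
rewrite mulNr; congr (- (_ * _)); rewrite addn1 big_ord_recl binz0 mulr1 mul1r subr0.
rewrite big1 ?addr0// => n _.
by rewrite (twotr_current _ _ gu c8) ?mulr0// lift0; lia.
Qed.

(** The right side of [Z_low_mode] depends on [m] only through a sign, so all modes a_{-m} u are
    controlled by a_{-1} u. *)
Lemma good_shift a c u (m : int) : Gen c u -> c <= 8 -> 0 < m ->
  good (c + 1) (AW a (-1) u) -> good (c + m) (AW a (- m) u).
Proof.
move=> gu c8 m0 [_ [b hb]]; split.
  by have := deg_op a (- m) (gen_deg gu); rewrite opprK.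
exists ((-1) ^ (- m) * - b) => N; have := hb N; rewrite !Z_low_mode//.
by rewrite exprN1 invrN1 opprK mul1r => ->; rewrite mulrN !mulNr mulrA.
Qed.

Let Al := repW.1.
Let v := F 8.
Let gF n : Gen n%:Z (F n). Proof. exact: (gen_Fpow repW hw0). Qed.
Let FS n : F n.+1 = AW LF (-1) (F n). Proof. by []. Qed.
Let E0w0 : AW LE 0 w0 = 0. Proof. by case: hw0. Qed.
Let dF n : deg n%:Z (F n). Proof. exact: gen_deg. Qed.

Lemma good_F2 : good 9 (AW LF (-2) (F 7)).
Proof. by apply: (good_shift (m := 2) (gF 7)) => //; apply: (good_gen (gF 8)). Qed.

Lemma good_F3 : good 10 (AW LF (-3) (F 7)).
Proof. by apply: (good_shift (m := 3) (gF 7)) => //; apply: (good_gen (gF 8)). Qed.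

Lemma good_cancel c (n : nat) u u' : (0 < n)%N -> good c u' -> good c (n%:R *: u + u') ->
  good c u.
Proof.
move=> n0 gu' g; have nz : n%:R != 0 :> C by rewrite pnatr_eq0 -lt0n.
have -> : u = n%:R^-1 *: (n%:R *: u + u' - u') by rewrite addrK scalerA mulVf// scale1r.
exact/(submodZ _ (good_submod _))/(submodB (good_submod _)).
Qed.

(* From the vanishing trace of e_0 f_{-1}^9 w0. *)
Lemma good_H1 : good 9 (AW LH (-1) v).
Proof.
apply: (@good_cancel _ 9 _ ((9 * 8)%:R *: AW LF (-2) (F 7))) => //.
  exact/(submodZ _ (good_submod _))/good_F2.
have := E_Fpow repW 7 (lexx 0) E0w0; rewrite -/F.
rewrite (_ : 0 - 1 = -1 :> int)// (_ : 0 - 2 = -2 :> int)// => <-.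
exact: (good_zero_mode LE (dF 9)).
Qed.

Lemma good_H2 : good 10 (AW LH (-2) v).
Proof. by apply: (good_shift (m := 2) (gF 8)) => //; exact: good_H1. Qed.

Lemma good_EF : good 10 (AW LE (-1) (F 9)).
Proof.
have e := E_Fpow repW (m := -1) 7 isT Ew0; rewrite -/F in e; rewrite e.
apply: (submodD (good_submod _)); apply: (submodZ _ (good_submod _)).
  exact: good_H2.
exact: good_F3.
Qed.

Lemma good_FE : good 10 (AW LF (-1) (AW LE (-1) v)).
Proof.
rewrite repW.2 /= scaleN1r scale0r addr0; apply: (submodB (good_submod _)).
  exact: good_EF.
exact: good_H2.
Qed.

Lemma good_FH : good 9 (AW LF (-1) (AW LH (-1) (F 7))).
Proof.
rewrite repW.2 /= scale0r addr0; apply: (submodD (good_submod _)).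
  exact: good_H1.
exact/(submodZ _ (good_submod _))/good_F2.
Qed.

Lemma good_HF : good 10 (AW LH (-1) (AW LF (-2) (F 7))).
Proof.
rewrite repW.2 /= scale0r addr0; apply: (submodD (good_submod _)).
  apply: (good_shift (m := 2) (c := 8)) => //; last exact: good_FH.
  exact: (Gen_op LH (-1) (gF 7)).
exact/(submodZ _ (good_submod _))/good_F3.
Qed.

(* From the vanishing trace of e_0 h_{-1} f_{-1}^9 w0. *)
Lemma good_HH : good 10 (AW LH (-1) (AW LH (-1) v)).
Proof.
apply: (@good_cancel _ 9 _ ((9 * 8)%:R *: AW LH (-1) (AW LF (-2) (F 7)) - 2 *: AW LE (-1) (F 9))) => //.
  apply: (submodB (good_submod _)); apply: (submodZ _ (good_submod _)).
    exact: good_HF.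
  exact: good_EF.
have e := E_Fpow repW 7 (lexx 0) E0w0; rewrite -/F in e.
rewrite (_ : 0 - 1 = -1 :> int)// (_ : 0 - 2 = -2 :> int)// in e.
have := good_zero_mode LE (c := 10) (u := AW LH (-1) (F 9)) (deg_op LH (-1) (dF 9)).
rewrite repW.2 e (linD (Al _ _)) !(linZ (Al _ _)) /= scale0r addr0 scaleNr.
by rewrite (_ : 0 + -1 = -1 :> int)// -addrA.
Qed.

Lemma good_dual0 a : good 9 (AW a (-1) (AW (dual a) 0 v)).
Proof.
case: a => /=.
- rewrite repW.2 /= scale1r scale0r addr0 (_ : -1 + 0 = -1 :> int)//.
  apply: (submodD (good_submod _)); last exact: good_H1.
  exact: (good_zero_mode LF (deg_op LE (-1) (dF 8))).
- rewrite repW.2 /= scaleN1r scale0r addr0 (_ : -1 + 0 = -1 :> int)//.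
  apply: (submodB (good_submod _)); last exact: good_H1.
  exact: (good_zero_mode LE (deg_op LF (-1) (dF 8))).
- have := Fpow_weight repW hw0 8; rewrite -/F -/v => ->.
  rewrite (_ : 16%:R + _ = 0) ?scale0r ?(lin0 (Al _ _)); first exact: (good_submod _).1.
  by rewrite -[16%:R]/(16%:Z%:~R) -intrD.
Qed.

(** By [good_shift] the first mode may be replaced by a_{-1}. For n >= 1 the resulting degree is 9 -
    n <= 8, where every word is good; n = 0 is [good_dual0]. *)
Lemma good_dual a (n : nat) : good 10 (AW a (-2 - n%:Z) (AW (dual a) n%:Z v)).
Proof.
have g := Gen_op (dual a) n%:Z (gF 8).
have := good_shift (a := a) (m := 2 + n%:Z) g; rewrite opprD.
rewrite (_ : 8%:Z - n%:Z + (2 + n%:Z) = 10); last by lia.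
apply; [by lia|by lia|].
case: n g => [|n] g; first exact: good_dual0.
apply: good_gen; last by lia.
exact: (Gen_op a (-1) g).
Qed.

Lemma good_omega : good 10 (YW omega (-1) v).
Proof.
have gs := good_submod 10.
have dd a : dual (dual a) = a by case: a.
(* The modes in each normally ordered term are either a_{-1} and its dual at -1, treated letter by
   letter, or of the form covered by [good_dual]. *)
have key a : good 10 (evsum (fun n : nat => AW a (-1 - n%:Z) (AW (dual a) (-1 + n%:Z) v)) +
    evsum (fun n : nat => AW (dual a) (-1 - 1 - n%:Z) (AW a n%:Z v))).
  apply: (submodD gs); apply: (submod_evsum gs) => n.
    case: n => [|n].
      by case: a => /=; [exact: good_EF|exact: good_FE|exact: good_HH].
    rewrite (_ : -1 - n.+1%:Z = -2 - n%:Z); last by lia.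
    rewrite (_ : -1 + n.+1%:Z = n%:Z); last by lia.
    exact: good_dual.
  by have := good_dual (dual a) n; rewrite dd.
rewrite (omega_mode hV hYW) /cas_sum; apply: (submodZ _ gs).
apply: (submodD gs); last exact: (submodZ _ gs (key LH)).
exact: (submodD gs (key LE) (key LF)).
Qed.

Lemma gen_omega c u (n : int) : Gen c u -> Gen (c + 1 - n) (YW omega n u).
Proof.
move=> gu; have gs := gen_submod AW w0 (c + 1 - n).
have key a : Gen (c + 1 - n) (evsum (fun j : nat => AW a (-1 - j%:Z) (AW (dual a) (n + j%:Z) u)) +
    evsum (fun j : nat => AW (dual a) (n - 1 - j%:Z) (AW a j%:Z u))).
  apply: (submodD gs); apply: (submod_evsum gs) => j.
    by have := Gen_op a (-1 - j%:Z) (Gen_op (dual a) (n + j%:Z) gu); congr gen; lia.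
  by have := Gen_op (dual a) (n - 1 - j%:Z) (Gen_op a j%:Z gu); congr gen; lia.
rewrite (omega_mode hV hYW) /cas_sum; apply: (submodZ _ gs).
apply: (submodD gs); last exact: (submodZ _ gs (key LH)).
exact: (submodD gs (key LE) (key LF)).
Qed.

End TraceRelations.

(** * The Virasoro recursion for the trace of v *)

Section TraceRecursion.
Variables (C : numFieldType) (V : voa C) (J : {linear 'M[C]_2 -> V}).
Hypothesis hV : is_affine_voa 16 J.
Variables (W M : voa_module V).
Hypothesis hW : is_affine_module 16 16 J W.
Hypothesis hM : is_affine_module 16 8 J M.
Variable I : W -> int -> M -> M.
Hypothesis hI : is_intertwining (V := V) 4%:R I.
Let YW := @modY C V W.
Let YM := @modY C V M.
Let AW := current J YW.
Let A := current J YM.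
Let omega := conformal_vector V.
Let hYW : vmod YW := module_vmod W.
Let hYM : vmod YM := module_vmod M.
Let Il : mode_linear I. Proof. by case: hI. Qed.
Let repW : hat_rep 16%:R AW := mod_rep hW.
Let repM : hat_rep 16%:R A := mod_rep hM.
Variable w0 : W.
Hypothesis hw0 : hw_vector AW 16%:R w0.
Hypothesis Ew0 : AW LE (-1) w0 = 0.

Let v := Fpow AW w0 8.
Let h := conformal_weight C 16 8.
Definition ztr (N : int) : C := Ztr 16 8 I 8 v N.
Let t (N j : int) : C := twotr 16 8 I omega 1 v 8 N j.
Let homo := omega_homogeneous 16 8 4 W M.

Let gv : gen AW w0 8 v. Proof. exact: (gen_Fpow repW hw0 8). Qed.
Let dv : has_degree 4 8 v. Proof. exact: (gen_deg hV M hW hw0 gv). Qed.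

Lemma ztr_neg (N : int) : N < 0 -> ztr N = 0.
Proof. exact: (Ztr_neg hV hM hI). Qed.

(** The correction terms are omega_0 v with trace -12 Z(v), omega_1 v with coefficient 1 - j and
    trace 12 Z(v), and vectors of degree at most 7 with trace 0. Here 12 is the L_0-eigenvalue of
    v. *)
Lemma twotr_omega (N j : int) : t (N - j) j = t N j - 12%:R * j%:~R * ztr N.
Proof.
have [n0 h0] := vmod_trunc hYW omega v.
have h1 n : ((absz n0).+2 <= n)%N -> YW omega n%:Z v = 0.
  by move=> hn; apply: h0; lia.
rewrite /t (twotr_step hI homo dv N j h1) -addrA -/YW; congr (_ + _).
rewrite !big_ord_recl binz0 mul1r binz_1 big1 ?addr0 => [|n _]; last first.
  rewrite !lift0 (gen_Z0 hV hW hI hw0) ?mulr0//; last by lia.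
  exact: (gen_omega hV hW hw0 _ gv).
have -> : Ztr 16 8 I (8 + 1 - 0%:Z) (YW omega 0%:Z v) N = - 12%:R * ztr N.
  have dv0 : has_degree (V := V) (W := W) 4 8 0 by exact: (@degree_submod _ 4 _ W 8).1.
  have := Ztr_lin 16 8 hI (- 12%:R) N dv dv0; rewrite addr0 (Ztr0 _ _ hI) addr0 => <-.
  rewrite /Ztr; congr trace_on; apply/funext => x; rewrite (linZ (Il.1 _ _)).
  case: hI => _ _ der _; have := der v 8 x; rewrite /virL addNr -/YW => e.
  rewrite (_ : 8 + 1 - 0%:Z - 1 = 8)// e (_ : 8 - 1 = 7 :> int)//.
  by congr (- _ *: _); rewrite -[8%:~R]/(8%:R) -natrD.
have -> : Ztr 16 8 I (8 + 1 - 1%:Z) (YW omega 1%:Z v) N = 12%:R * ztr N.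
  have dv0 : has_degree (V := V) (W := W) 4 8 0 by exact: (@degree_submod _ 4 _ W 8).1.
  have := Ztr_lin 16 8 hI (12%:R) N dv dv0; rewrite addr0 (Ztr0 _ _ hI) addr0 => <-.
  congr Ztr; rewrite -/YW; have -> : YW omega 1%:Z v = (4%:R + 8%:~R) *: v := dv.
  by congr (_ *: _); rewrite -[8%:~R]/(8%:R) -natrD.
by rewrite intrB; ring.
Qed.

Lemma twotr_omega0 N : t N 0 = (h + N%:~R) * ztr N.
Proof.
have dv0 : has_degree (V := V) (W := W) 4 8 0 by exact: (@degree_submod _ 4 _ W 8).1.
have := Ztr_lin 16 8 hI (h + N%:~R) N dv dv0; rewrite addr0 (Ztr0 _ _ hI) addr0 => <-.
apply: (trace_on_ext (level_submod 16 8 M N) (level_fin 16 8 M N)).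
- by move=> s x y; rewrite -/YM (vmod_lin hYM).2 Il.2.
- exact: Il.2.
- move=> x hx; have := mode_level hI (8 - 1 + 0) dv (homo.1 _ 1 _ hx).
  by congr level; lia.
- move=> x hx; rewrite subr0 addr0.
  have -> : modY omega 1 x = (h + N%:~R) *: x := hx.
  by rewrite (linZ (Il.2 _ _)) (linZ (Il.1 _ _)).
Qed.

Definition usum (K : nat) (N : int) (j : nat) : C :=
  j%:R * \sum_(r < K) ztr (N - r.+1%:Z * j%:Z).

Lemma twotr_pos K (N : int) (j : nat) : N < K%:Z -> (0 < j)%N ->
  t (N - j%:Z) j%:Z = 12%:R * usum K N j.
Proof.
move=> NK j0; have tneg N' : N' < 0 -> t N' j%:Z = 0 by exact: (twotr_neg hV hM hI).
have st N' : t N' j%:Z = 12%:R * j%:~R * ztr N' + t (N' - j%:Z) j%:Z.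
  by rewrite twotr_omega addrC subrK.
rewrite (descend tneg j0 st (K := K)); last by lia.
rewrite /usum mulrA mulr_sumr; apply: eq_bigr => r _.
by congr (_ * ztr _); lia.
Qed.

Lemma twotr_opp K (N : int) (j : nat) : N < K%:Z -> (0 < j)%N ->
  t N (- j%:Z) = 12%:R * usum K N j.
Proof.
move=> NK j0; have tneg N' : N' < 0 -> t N' (- j%:Z) = 0 by exact: (twotr_neg hV hM hI).
have st N' : t N' (- j%:Z) = 12%:R * j%:~R * ztr (N' - j%:Z) + t (N' - j%:Z) (- j%:Z).
  have := twotr_omega (N' - j%:Z) (- j%:Z); rewrite opprK subrK => ->.
  by rewrite mulrNz mulrN mulNr opprK addrC.
rewrite (descend (g := fun N => 12%:R * j%:~R * ztr (N - j%:Z)) tneg j0 st NK).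
rewrite /usum mulrA mulr_sumr; apply: eq_bigr => r _.
by congr (_ * ztr _); lia.
Qed.

Lemma usum0 K (N : int) (j : nat) : N < j%:Z -> usum K N j = 0.
Proof.
by move=> Nj; rewrite /usum big1 ?mulr0// => r _; apply: ztr_neg; nia.
Qed.

Lemma usum_widen K K' (N : int) : N < K%:Z -> (K <= K')%N ->
  \sum_(j < K') usum K N j.+1 = \sum_(j < K) usum K N j.+1.
Proof.
move=> NK; apply: (@sum_stab C C^o (fun j => usum K N j.+1)) => j Kj.
by apply: usum0; lia.
Qed.

(** Positive and negative indices give the same sum with factor 12, hence 24, and index 0 gives h +
    N. Index 1 occurs at level N where the positive sum would have it at level N - 1; by
    [twotr_omega] this adds 12. *)
Lemma Z_virasoro K (N : int) : N < K%:Z ->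
  Ztr 16 8 I 10 (YW omega (-1) v) N =
  (h + N%:~R + 12%:R) * ztr N + 24%:R * \sum_(j < K) usum K N j.+1.
Proof.
move=> NK; set K' := (absz N + K + 3)%N.
have K0 : (absz N + absz 1%R + absz (-1)%R < K'.+2)%N by lia.
have := Ztr_iter hV hM hI homo dv K0; rewrite (_ : 8 + 1 - -1 = 10)// => ->.
have m1 (f : nat -> C) L : \sum_(n < L) (-1) ^+ n * binz C (-1) n * f n = \sum_(n < L) f n.
  by apply: eq_bigr => n _; rewrite binzN1 mul1r.
rewrite (m1 (fun n : nat => twotr _ _ _ _ _ _ _ (N - (1 - -1 + n%:Z)) (1 - -1 + n%:Z))).
rewrite (m1 (fun n : nat => twotr _ _ _ _ _ _ _ N (1 - n%:Z))).
rewrite exprN1 invrN1 mulN1r opprK.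
(* The first half starts at index 2; the term of index 1 is added to complete the sum over all
   positive indices. *)
have S1 : \sum_(n < K'.+2) t (N - (1 - -1 + n%:Z)) (1 - -1 + n%:Z) + t (N - 1) 1 =
    12%:R * \sum_(j < K) usum K N j.+1.
  rewrite -(usum_widen (K' := K'.+3) NK); last by lia.
  rewrite mulr_sumr [RHS]big_ord_recl -(twotr_pos NK (ltn0Sn _)) addrC; congr (_ + _).
  by apply: eq_bigr => n _; rewrite -(twotr_pos NK).
have S2 : \sum_(n < K'.+2) t N (1 - n%:Z) =
    t N 1 + t N 0 + 12%:R * \sum_(j < K) usum K N j.+1.
  rewrite -(usum_widen (K' := K') NK); last by lia.
  rewrite mulr_sumr 2!big_ord_recl addrA lift0 subr0; congr (_ + _ + _).
  apply: eq_bigr => n _; rewrite -(twotr_opp NK)//.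
  by congr (twotr _ _ _ _ _ _ _ _ _); rewrite !lift0; lia.
rewrite -/(t _ _) in S1 S2 *.
have -> : \sum_(n < K'.+2) twotr 16 8 I omega 1 v 8 (N - (1 - -1 + n%:Z)) (1 - -1 + n%:Z) =
   12%:R * \sum_(j < K) usum K N j.+1 - t (N - 1) 1 by rewrite -S1 addrK.
rewrite S2 twotr_omega twotr_omega0; move: (\sum_(j < K) _) => s.
by ring.
Qed.

Section Bottom.
Variable y : M.
Hypotheses (hy : hw_vector A 8%:R y) (y_neq0 : y <> 0).
Let S (N : int) : set M := level (V := V) 16 8 N.
Let y8 := iter 8 (A LF 0) y.
Let dl : linear (YM omega 1). Proof. exact: (vmod_lin hYM).2. Qed.
Let dop a n x : YM omega 1 (A a n x) = A a n (YM omega 1 x) - n%:~R *: A a n x.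
Proof. exact: (L0_op hV). Qed.
Let dy : YM omega 1 y = h *: y. Proof. exact: (L0_hw_vector hV hM hy). Qed.
Let Al := repM.1.

(** Modulo higher L_0-eigenvalues M is spanned by the f_0-string of [y], and f_0^8 kills all of this
    string except its first vector. So f_0^8 has rank one on the top space. *)
Lemma level0_F8 x : S 0 x -> exists b, iter 8 (A LF 0) x = b *: y8.
Proof.
move=> Sx; have itl n : linear (iter n (A LF 0)).
  by elim: n => [|n IHn] s u u'; rewrite ?iterS ?IHn ?Al.
pose Q u := YM omega 1 u = h *: u /\ exists b, iter 8 (A LF 0) u = b *: y8.
pose P (e : C) := exists n : nat, e = h + n.+1%:R.
have ks := killed_submod dl P.
have [u [[du [b hb]] ku]] : exists u, Q u /\ killed (YM omega 1) P (x - u).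
  have gx := generated_low repM hy (irr_generated x (mod_irr hM) y_neq0).
  apply: (gx (fun x => exists u, Q u /\ killed (YM omega 1) P (x - u))).
  - split=> [|s u u' [r [[dr [b hb]] kr]] [r' [[dr' [b' hb']] kr']]].
      exists 0; split; last by rewrite subr0; exact: ks.1.
      split; first by rewrite (lin0 dl) scaler0.
      by exists 0; rewrite (lin0 (itl 8)) scale0r.
    exists (s *: r + r'); split; last first.
      by rewrite opprD addrACA -scalerBr; exact: ks.2.
    split; first by rewrite dl dr dr' scalerDr !scalerA (mulrC s).
    by exists (s * b + b'); rewrite itl hb hb' scalerDl scalerA.
  - move=> a n u an [r [[dr [b hb]] kr]]; case: an => [n0|[-> ->]].
      exists 0; split.
        split; first by rewrite (lin0 dl) scaler0.
        by exists 0; rewrite (lin0 (itl 8)) scale0r.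
      rewrite subr0 -[u](subrK r) (linD (Al _ _)).
      have [m nm] : exists m : nat, - n%:~R = m.+1%:R :> C.
        exists (absz n).-1; rewrite -mulrNz -[RHS]/((absz n).-1.+1%:Z%:~R).
        by congr (_%:~R); lia.
      apply: (submodD ks).
        apply: (killed_shift (Al a n) _ _ kr (delta := m.+1%:R)).
          by move=> z; rewrite dop -scaleNr nm.
        by move=> _ [l ->]; exists (l + m.+1)%N; rewrite -addrA -natrD addSn.
      apply: (killed_eig (mu := h + m.+1%:R)); last by exists m.
      by rewrite dop dr (linZ (Al _ _)) -scaleNr nm -scalerDl.
    exists (A LF 0 r); split; last first.
      rewrite -(linB (Al _ _)); apply: (killed_shift (Al LF 0) _ _ kr (delta := 0)).
        by move=> z; rewrite dop mulr0z scale0r subr0 addr0.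
      by move=> e; rewrite addr0.
    split; first by rewrite dop dr mulr0z scale0r subr0 (linZ (Al _ _)).
    exists 0; rewrite -iterSr iterS hb (linZ (Al _ _)) scale0r.
    rewrite -[A LF 0 y8]/(iter 9 (A LF 0) y).
    by rewrite (string_top repM hy dl dop dy (mod_irr hM) y_neq0) scaler0.
  - exists y; split; last by rewrite subrr; exact: ks.1.
    by split=> //; exists 1; rewrite scale1r.
have dx : YM omega 1 x = h *: x by have := Sx; rewrite /S /level /eigenspace_of /= addr0.
have xu : x - u = 0.
  apply: (killed_eig0 dl (mu := h) _ ku); first by rewrite (linB dl) dx du scalerBr.
  by move=> [n /eqP]; rewrite -subr_eq0 opprD addNKr oppr_eq0 pnatr_eq0.
by exists b; rewrite -[x](subrK u) xu add0r.
Qed.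

(** On the top level every other term of the iterate formula for f_{-1} u passes through a negative
    level. *)
Lemma mode_F_bottom (c : int) u x : has_degree 4 c u -> S 0 x ->
  I (AW LF (-1) u) c x = I u (c - 1) (A LF 0 x).
Proof.
move=> du Sx; have neg := level_neg hV hM.
rewrite (jac_iterN1 (jacI hI (J (lmat C LF)) u x)).
rewrite [X in X + _](_ : _ = 0) ?add0r.
  rewrite (@evsum1 _ _ _ 0%N) ?subz0// => j j0.
  have := (current_homogeneous 8 4 hV W M LF).1 _ j%:Z _ Sx => hj.
  by rewrite (neg _ _ _ hj) ?(lin0 (Il.2 _ _))//; lia.
rewrite -[RHS](evsum0 M); apply: eq_evsum => j.
have hj := mode_level hI (c + j%:Z) du Sx.
by rewrite -/YM (neg _ _ _ hj) ?(lin0 ((vmod_lin hYM).2 _ _))//; lia.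
Qed.

(** Repeated use of [mode_F_bottom] turns o(v) on the top space into I(w0)_(-1) f_0^8; cyclicity
    then moves the trace to the line spanned by f_0^8 y, where it is the scalar [e]. *)
Lemma ztr0 (e : C) : I w0 (-1) y8 = e *: y -> ztr 0 = e.
Proof.
move=> Iy; have itl n : linear (iter n (A LF 0)).
  by elim: n => [|n IHn] s u u'; rewrite ?iterS ?IHn ?Al.
have F0S x : S 0 x -> S 0 (A LF 0 x).
  move=> Sx; have := (current_homogeneous 8 4 hV W M LF).1 _ 0 _ Sx.
  by congr level.
have itS n x : S 0 x -> S 0 (iter n (A LF 0) x).
  by elim: n => // n IHn Sx; rewrite iterS; exact/F0S/IHn.
have bottom n x : S 0 x -> I (Fpow AW w0 n) (n%:Z - 1) x = I w0 (-1) (iter n (A LF 0) x).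
  elim: n x => [|n IHn] x Sx; first by rewrite sub0r.
  rewrite /Fpow iterS -/(Fpow AW w0 n) (_ : n.+1%:Z - 1 = n%:Z); last by lia.
  rewrite mode_F_bottom//; last first.
    exact/(gen_deg hV M hW hw0)/(gen_Fpow repW hw0).
  by rewrite IHn ?iterSr//; exact: F0S.
have S0y : S 0 y by rewrite /S /level /eigenspace_of /= addr0.
pose L : set M := [set x | exists b, x = b *: y8].
have Ls : submod L.
  split=> [|s u u' [b ->] [b' ->]]; first by exists 0; rewrite scale0r.
  by exists (s * b + b'); rewrite scalerDl scalerA.
have Lf : finite_dim_space L.
  by exists 1%N, (fun=> y8) => u [b ->]; exists (fun=> b); rewrite big_ord1.
have y80 : y8 <> 0 by exact: (string_neq0 repM hy).
have -> : ztr 0 = trace_on (S 0) (fun x => I w0 (-1) (iter 8 (A LF 0) x)).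
  apply: (trace_on_ext (level_submod 16 8 M 0) (level_fin 16 8 M 0)).
  - exact: Il.2.
  - by move=> s x x'; rewrite itl Il.2.
  - by move=> x Sx; have := zero_level hI dv Sx.
  - by move=> x Sx; exact: (bottom 8%N).
rewrite (trace_on_comm (level_submod 16 8 M 0) (level_fin 16 8 M 0) Ls Lf (itl 8) (Il.2 w0 (-1))).
- apply: (trace_on_scalar _ y80); last by rewrite Iy (linZ (itl 8)).
  + by move=> s x x'; rewrite Il.2 itl.
  + by [].
- exact: level0_F8.
- move=> _ [b ->]; rewrite (linZ (Il.2 _ _)) Iy.
  by apply: (submodZ _ (level_submod 16 8 M 0)); apply: (submodZ _ (level_submod 16 8 M 0)).
Qed.

Lemma ztr_rec : I w0 (-1) y8 = y -> ztr 0 = 1 /\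
  forall n : nat, n%:R * ztr n%:Z = - 24%:R * \sum_(j < n.+1) usum n.+1 n%:Z j.+1.
Proof.
move=> Iy; have z0 : ztr 0 = 1 by apply: ztr0; rewrite scale1r.
split=> // n.
have [_ [b hb]] := good_omega hV hW hM hI hw0 Ew0.
(* Level 0 determines the proportionality factor: since all sums vanish there and Z_0(v) = 1, it is
   h + 12. *)
have e := hb 0; rewrite -/v -/(ztr 0) -/YW -/omega z0 mulr1 (Z_virasoro (K := 1))// in e.
rewrite big_ord1 usum0// mulr0 mulr0z !addr0 z0 mulr1 in e.
have := hb n%:Z; rewrite -/v -/(ztr _) -/YW -/omega -e (Z_virasoro (K := n.+1)); last by lia.
move: (\sum_(j < n.+1) _) (ztr n%:Z) => s z e'.
have -> : n%:R * z = ((h + n%:~R + 12%:R) * z + 24%:R * s) - (24%:R * s + (h + 12%:R) * z).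
  by rewrite -[n%:R]/(n%:Z%:~R); ring.
by rewrite e'; ring.
Qed.

End Bottom.
End TraceRecursion.

Lemma eigen_independent (C : numFieldType) (M : lmodType C) (T : M -> M) (h : C)
    (N : nat) (us : nat -> M) : linear T ->
  (forall j, T (us j) = (h + j%:R) *: us j) -> \sum_(j < N) us j = 0 ->
  forall j, (j < N)%N -> us j = 0.
Proof.
move=> Tl; elim: N us => [//|N IHN] us hus s0.
have low j : (j < N)%N -> us j = 0.
  move=> jN; have jn : (j%:R - N%:R) != 0 :> C by rewrite subr_eq0 eqr_nat ltn_eqF.
  apply: (scalerI jn); rewrite scaler0.
  apply: (IHN (fun j => (j%:R - N%:R) *: us j)) => // [l|].
    by rewrite (linZ Tl) hus !scalerA mulrC.
  have := congr1 (fun x => T x - (h + N%:R) *: x) s0.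
  rewrite /= (lin0 Tl) scaler0 subr0 (lin_sum Tl) scaler_sumr -sumrB big_ord_recr/=.
  rewrite [X in _ + (X - _)]hus subrr addr0 => e; rewrite -[RHS]e.
  apply: eq_bigr => l _; rewrite hus -scalerBl; congr (_ *: _).
  by rewrite opprD addrACA subrr add0r.
move=> j; rewrite ltnS leq_eqVlt => /orP[/eqP ->|]; last exact: low.
by move: s0; rewrite big_ord_recr/= big1 ?add0r// => l _; apply: low.
Qed.

Section Components.
Variables (C : numFieldType) (V : voa C) (M : voa_module V) (h : C) (m : nat) (v : M).
Hypothesis hv : graded_piece h m v.

(** The decomposition chosen by [xget] agrees with the one concentrated in degree [m], since
    L_0-eigenvectors with distinct eigenvalues are independent. *)
Lemma homogeneous_componentE n : homogeneous_component h n v = if n == m then v else 0.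
Proof.
have Tl : linear (virL (M := M) 0) by exact: (mod_linear M).2.
pose us j : M := if j == m then v else 0.
have gus j : graded_piece h j (us j).
  rewrite /us; case: eqP => [->|_]; first exact: hv.
  by rewrite /graded_piece /eigenspace_of /= (lin0 Tl) scaler0.
have sus N : (m < N)%N -> \sum_(j < N) us j = v.
  move=> mN; rewrite (bigD1 (Ordinal mN))//= /us eqxx big1 ?addr0// => j jm.
  by rewrite ifN.
rewrite /homogeneous_component; case: xgetP => [x _|no]; last first.
  case: (no (us n)); exists m.+1, us; split=> //; last by rewrite sus.
  by move=> j mj; rewrite /us gtn_eqF.
move=> [N [vs [gvs vsN vE ->]]].
pose K := maxn (maxn N m.+1) n.+1.
have sv : \sum_(j < K) vs j = v.
  by rewrite vE (sum_stab vsN)// /K !leq_max leqnn.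
apply/eqP; rewrite -subr_eq0; apply/eqP; rewrite -/(us n).
apply: (eigen_independent (h := h) (N := K) (us := fun j => vs j - us j) Tl).
- by move=> j; rewrite (linB Tl) gvs gus scalerBr.
- by rewrite sumrB sv sus ?subrr// /K !leq_max ltnSn orbT.
- by rewrite /K !leq_max ltnSn !orbT.
Qed.

Lemma zero_modeE (N : voa_module V) (I : M -> int -> N -> N) x : mode_linear I ->
  zero_mode h I v x = I v (m%:Z - 1) x.
Proof.
move=> Il; rewrite /zero_mode -(fsbig_widen [set m]) ?fsbig_set1//.
  by rewrite homogeneous_componentE eqxx.
move=> n [_ /= nm]; rewrite homogeneous_componentE ifN ?(lin0 (Il.1 _ _))//.
exact/eqP.
Qed.

End Components.

Lemma intertwiner_traces (C : numFieldType) (V : voa C) (J : {linear 'M[C]_2 -> V})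
    (W M : voa_module V) : is_affine_voa 16 J ->
  is_affine_module 16 16 J W -> is_affine_module 16 8 J M ->
  exists (v : W) (I : W -> int -> M -> M) (z : int -> C),
  [/\ is_intertwining (conformal_weight C 16 16) I,
      forall n : nat, trace_on (graded_piece (M := M) (conformal_weight C 16 8) n)
        (zero_mode (conformal_weight C 16 16) I v) = z n%:Z,
      forall n, n < 0 -> z n = 0, z 0 = 1 &
      forall n : nat, n%:R * z n%:Z = - 24%:R * \sum_(j < n.+1)
        j.+1%:R * \sum_(r < n.+1) z (n%:Z - r.+1%:Z * j.+1%:Z)].
Proof.
move=> hV hW hM.
have [w0 [hw w00]] := mod_hw hW; have [y [hy y0]] := mod_hw hM.
have [I [hI Ew Iy]] := intertwiner_exists (p := 4) hV hW hM hw w00 hy y0.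
have hw4 : conformal_weight C 16 16 = 4%:R := weight_top C 4.
(* For p = 4 the sign left by the twist is even, so the normalization is exactly 1. *)
have Iy' : I w0 (-1) (iter 8 (current J (modY (v := M)) LF 0) y) = y.
  by rewrite [LHS]Iy -exprnN -signr_odd expr0 invr1 scale1r.
have [z0 zr] := ztr_rec hV hW hM hI hw Ew hy y0 Iy'.
exists (Fpow (current J (modY (v := W))) w0 8), I, (ztr J I w0); split=> //.
- by rewrite hw4.
- move=> n; have Il : mode_linear I by case: hI.
  rewrite /ztr /Ztr; congr trace_on; apply/funext => x.
  rewrite (zero_modeE (m := 8))//; rewrite hw4.
  have repW := mod_rep hW.
  exact: (gen_deg hV M hW hw (gen_Fpow repW hw 8)).
- by move=> n; exact: (ztr_neg hV hM hI).
Qed.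

(** * The infinite product *)

Section EulerProduct.
Variable C : numFieldType.

Definition zcoef (p : {poly C}) (n : int) : C := if n is Posz m then p`_m else 0.

Definition euler (N : nat) : {poly C} := \prod_(k < N) (1 - 'X^(k.+1)) ^+ 24.

Lemma zcoef_neg p n : n < 0 -> zcoef p n = 0. Proof. by case: n. Qed.

Lemma zcoefXnM p (k : nat) n : zcoef ('X^k * p) n = zcoef p (n - k%:Z).
Proof.
case: n => m /=; last by rewrite zcoef_neg.
rewrite coefXnM; case: ltnP => mk; first by rewrite zcoef_neg//; lia.
by rewrite (_ : m%:Z - k%:Z = (m - k)%N%:Z)//; lia.
Qed.

Lemma zcoefD p q n : zcoef (p + q) n = zcoef p n + zcoef q n.
Proof. by case: n => m /=; rewrite ?coefD ?addr0. Qed.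

Lemma zcoefZ c p n : zcoef (c *: p) n = c * zcoef p n.
Proof. by case: n => m /=; rewrite ?coefZ ?mulr0. Qed.

Lemma zcoef_sum K (F : nat -> {poly C}) n :
  zcoef (\sum_(k < K) F k) n = \sum_(k < K) zcoef (F k) n.
Proof.
elim: K => [|K IHK]; last by rewrite !big_ord_recr/= zcoefD IHK.
by rewrite !big_ord0; case: n => m //=; rewrite coef0.
Qed.

(* [Q k] is [euler N / (1 - 'X^(k.+1))]: this is the logarithmic derivative, cleared of denominators. *)
Lemma euler_deriv N : exists Q : nat -> {poly C},
  (forall k, (k < N)%N -> euler N = (1 - 'X^(k.+1)) * Q k) /\
  'X * (euler N)^`() = - 24%:R *: \sum_(k < N) k.+1%:R *: ('X^(k.+1) * Q k).
Proof.
elim: N => [|N [Q [hQ hd]]].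
  exists (fun=> 0); split=> //.
  by rewrite /euler !big_ord0 -polyC1 derivC mulr0 scaler0.
set f : {poly C} := 1 - 'X^(N.+1).
have eS : euler N.+1 = euler N * f ^+ 24 by rewrite /euler big_ord_recr.
pose Q' k := if k == N then euler N * f ^+ 23 else Q k * f ^+ 24.
exists Q'; split=> [k|].
  rewrite ltnS leq_eqVlt => /orP[/eqP ->|kN].
    by rewrite /Q' eqxx eS -/f exprS mulrCA.
  by rewrite /Q' ltn_eqF// eS [RHS]mulrA -(hQ _ kN).
have df : 'X * f^`() = - N.+1%:R *: 'X^(N.+1).
  by rewrite /f derivB -polyC1 derivC derivXn sub0r mulrN mulrnAr /= -exprS -scaler_nat scaleNr.
have -> : 'X * (euler N.+1)^`() = 'X * (euler N)^`() * f ^+ 24 +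
    24%:R *: (euler N * f ^+ 23 * ('X * f^`())).
  by rewrite eS derivM deriv_exp scaler_nat /=; ring.
have low : \sum_(k < N) k.+1%:R *: ('X^(k.+1) * Q' k) =
    (\sum_(k < N) k.+1%:R *: ('X^(k.+1) * Q k)) * f ^+ 24.
  rewrite mulr_suml; apply: eq_bigr => k _.
  by rewrite /Q' ltn_eqF// [in LHS]mulrA scalerAl.
rewrite hd df big_ord_recr/= low /Q' eqxx scalerDr; congr (_ + _).
  by rewrite scalerAl.
rewrite -scalerAr !scalerA mulrN mulNr; congr (_ *: _).
by rewrite mulrC.
Qed.

(** Unrolling Q_k = P + X^(k+1) Q_k as a geometric series in the logarithmic derivative gives the
    inner sums. The bound n <= N guarantees that every factor able to affect degree n is present. *)
Lemma zcoef_euler (N n : nat) : (n <= N)%N -> n%:R * zcoef (euler N) n%:Z =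
  - 24%:R * \sum_(j < n.+1) j.+1%:R *
    \sum_(r < n.+1) zcoef (euler N) (n%:Z - r.+1%:Z * j.+1%:Z).
Proof.
move=> nN; have [Q [hQ hd]] := euler_deriv N; set P := euler N in hQ hd *.
have low (j r : nat) : (n <= j)%N -> zcoef P (n%:Z - r.+1%:Z * j.+1%:Z) = 0.
  by move=> nj; apply: zcoef_neg; nia.
pose g (j : nat) : C^o :=
  j.+1%:R * \sum_(r < n.+1) zcoef P (n%:Z - r.+1%:Z * j.+1%:Z).
have g0 j : (n <= j)%N -> g j = 0.
  by move=> nj; rewrite /g big1 ?mulr0// => r _; exact: low.
have -> : \sum_(j < n.+1) j.+1%:R * \sum_(r < n.+1) zcoef P (n%:Z - r.+1%:Z * j.+1%:Z) =
    \sum_(j < N) g j by rewrite (sum_stab g0 nN) -(sum_stab g0 (leqnSn n)).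
have zs := zcoef_sum N (fun k => k.+1%:R *: ('X^(k.+1) * Q k)) n%:Z.
have := congr1 (fun p => zcoef p n%:Z) hd.
rewrite zcoefZ zs {zs} /= coefXM coef_deriv.
case: n nN low @g g0 => [|n] nN low g g0.
  by move=> _; rewrite mul0r big1 ?mulr0// => j _; exact: g0.
rewrite mulr_natl /= => ->; congr (_ * _); apply: eq_bigr => k _.
rewrite coefZ coefXnM; congr (_ * _).
have key m : zcoef (Q k) m = zcoef P m + zcoef (Q k) (m - k.+1%:Z).
  rewrite (hQ k)// mulrBl mul1r -scaleN1r zcoefD zcoefZ zcoefXnM mulN1r.
  by rewrite subrK.
have := descend (fun m => @zcoef_neg (Q k) m) (ltn0Sn k) key (K := n.+2) (N := n.+1%:Z - k.+1%:Z).
rewrite -[LHS]zcoefXnM /= coefXnM => ->; last by lia.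
by apply: eq_bigr => r _; congr zcoef; lia.
Qed.

Lemma euler_unique (z : int -> C) : (forall n, n < 0 -> z n = 0) -> z 0 = 1 ->
  (forall n : nat, n%:R * z n%:Z = - 24%:R * \sum_(j < n.+1)
    j.+1%:R * \sum_(r < n.+1) z (n%:Z - r.+1%:Z * j.+1%:Z)) ->
  forall N (n : nat), (n <= N)%N -> z n%:Z = (euler N)`_n.
Proof.
move=> zneg z0 zr N; elim/ltn_ind => n IHn nN.
have [->|n0] := posnP n.
  rewrite z0 -horner_coef0 /euler horner_prod big1// => k _.
  by rewrite !hornerE expr0n subr0 expr1n.
have nz : n%:R != 0 :> C by rewrite pnatr_eq0 -lt0n.
apply: (mulfI nz); rewrite zr -[(euler N)`_n]/(zcoef (euler N) n%:Z) zcoef_euler//.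
congr (_ * _); apply: eq_bigr => j _; congr (_ * _); apply: eq_bigr => r _.
set m := n%:Z - _; have mn : m < n%:Z by rewrite /m; nia.
case: (leP 0 m) => m0; last by rewrite zneg// zcoef_neg.
by rewrite (_ : m = (absz m)%:Z) ?IHn//; lia.
Qed.

End EulerProduct.

Import numFieldNormedType.Exports.
Local Open Scope complex_scope.

(** * Convergence of the series and of the product *)

Section Majorant.
Variable R : realType.
Implicit Types (p : {poly R[i]}) (q g : {poly R}).

Definition dominated p q := forall j, `|p`_j| <= (q`_j)%:C.

Definition nonneg q := forall j, 0 <= q`_j.

Lemma dominated_nonneg p q : dominated p q -> nonneg q.
Proof. by move=> d j; rewrite -ler0c; exact: le_trans (d j). Qed.

Lemma dominatedM p q p' q' : dominated p q -> dominated p' q' ->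
  dominated (p * p') (q * q').
Proof.
move=> d d' j; rewrite !coefM raddf_sum/=; apply: le_trans (ler_norm_sum _ _ _) _.
by apply: ler_sum => l _; rewrite normrM rmorphM/=; exact: ler_pM.
Qed.

Lemma dominated1 : dominated 1 1.
Proof. by move=> j; rewrite !coef1; case: eqP; rewrite ?normr1 ?normr0. Qed.

Lemma dominated_exp p q n : dominated p q -> dominated (p ^+ n) (q ^+ n).
Proof.
move=> d; elim: n => [|n IHn]; first by rewrite !expr0; exact: dominated1.
by rewrite !exprS; exact: dominatedM.
Qed.

Lemma dominated_factor k : dominated (1 - 'X^k) (1 + 'X^k).
Proof.
move=> j; rewrite coefB coefD !coef1 !coefXn; apply: le_trans (ler_normB _ _) _.
by rewrite rmorphD/=; do 2!case: eqP => _; rewrite ?normr1 ?normr0.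
Qed.

(** Dominates [euler] coefficientwise. Its coefficients are nonnegative, increase with [N] and
    stabilize, so one bound on its value at r = |q| controls all truncations. *)
Definition majorant N : {poly R} := \prod_(k < N) (1 + 'X^(k.+1)) ^+ 24.

Lemma dominated_euler N : dominated (euler _ N) (majorant N).
Proof.
elim: N => [|N IHN]; first by rewrite /euler /majorant !big_ord0; exact: dominated1.
rewrite /euler /majorant !big_ord_recr/=; apply: dominatedM => //.
exact/dominated_exp/dominated_factor.
Qed.

Lemma nonnegM q q' : nonneg q -> nonneg q' -> nonneg (q * q').
Proof. by move=> h h' j; rewrite coefM; apply: sumr_ge0 => l _; exact: mulr_ge0. Qed.

Lemma nonnegD q q' : nonneg q -> nonneg q' -> nonneg (q + q').
Proof. by move=> h h' j; rewrite coefD; exact: addr_ge0. Qed.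

Lemma nonneg1 : nonneg 1.
Proof. by move=> j; rewrite coef1. Qed.

Lemma nonnegXn k : nonneg 'X^k.
Proof. by move=> j; rewrite coefXn. Qed.

Lemma factor_expand k n : exists2 g, nonneg g & (1 + 'X^k) ^+ n = 1 + 'X^k * g.
Proof.
elim: n => [|n [g g0 e]]; first by exists 0; [move=> j; rewrite coef0|rewrite mulr0 addr0].
exists (1 + g + 'X^k * g); last by rewrite exprS e; ring.
apply: nonnegD; first by apply: nonnegD => //; exact: nonneg1.
by apply: nonnegM => //; exact: nonnegXn.
Qed.

Lemma majorantS N : exists2 g, nonneg g & majorant N.+1 = majorant N + 'X^(N.+1) * g.
Proof.
have [g g0 e] := factor_expand N.+1 24; exists (majorant N * g).
  exact/nonnegM/g0/(dominated_nonneg (dominated_euler N)).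
by rewrite /majorant big_ord_recr/= -/(majorant N) e; ring.
Qed.

Lemma majorant_incr N j : (majorant N)`_j <= (majorant N.+1)`_j.
Proof.
have [g g0 ->] := majorantS N; rewrite coefD lerDl.
by apply: nonnegM => //; exact: nonnegXn.
Qed.

Lemma majorant_homo N N' j : (N <= N')%N -> (majorant N)`_j <= (majorant N')`_j.
Proof.
move=> /subnK <-; elim: (N' - N)%N => // m IHm.
by rewrite addSn; exact: le_trans IHm (majorant_incr _ _).
Qed.

Lemma majorant_stable N j : (j <= N)%N -> (majorant N)`_j = (majorant j)`_j.
Proof.
move=> /subnK <-; elim: (N - j)%N => // m <-; rewrite addSn.
have [g _ ->] := majorantS (m + j)%N; rewrite coefD coefXnM.
by rewrite ltnS leq_addl addr0.
Qed.

Lemma majorant_le N j : (majorant N)`_j <= (majorant j)`_j.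
Proof.
have [jN|Nj] := leqP j N; first by rewrite majorant_stable.
exact/majorant_homo/ltnW.
Qed.

Lemma horner_majorant N (r : R) : 0 <= r -> r < 1 ->
  (majorant N).[r] <= expR ((1 - r)^-1) ^+ 24.
Proof.
move=> r0 r1; have r1' : 0 < 1 - r by rewrite subr_gt0.
have -> : (majorant N).[r] = (\prod_(k < N) (1 + r ^+ k.+1)) ^+ 24.
  rewrite /majorant horner_prod -prodrXl; apply: eq_bigr => k _.
  by rewrite horner_exp !hornerE.
apply: lerXn2r; rewrite ?nnegrE ?expR_ge0//.
  by apply: prodr_ge0 => k _; rewrite addr_ge0// exprn_ge0.
(* The bound 1 + x <= exp(x) turns the product into the exponential of a partial geometric sum, at
   most 1 / (1 - r). *)
apply: (@le_trans _ _ (\prod_(k < N) expR (r ^+ k.+1))).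
  apply: ler_prod => k _; rewrite addr_ge0 ?exprn_ge0//=.
  exact: expR_ge1Dx.
rewrite -expR_sum ler_expR -(ler_pM2l r1') divff ?gt_eqF//.
have := subrX1 r N; rewrite -opprB -[r - 1]opprB mulNr => /oppr_inj e.
apply: (@le_trans _ _ ((1 - r) * \sum_(k < N) r ^+ k)).
  rewrite ler_pM2l//; apply: ler_sum => k _; rewrite exprS.
  by apply: ler_piMl; [exact: exprn_ge0|exact: ltW].
by rewrite -e lerBlDr lerDl exprn_ge0.
Qed.

Lemma majorant_sum n (r : R) : 0 <= r -> r < 1 ->
  \sum_(j < n) (majorant j)`_j * r ^+ j <= expR ((1 - r)^-1) ^+ 24.
Proof.
move=> r0 r1; apply: le_trans (horner_majorant n r0 r1).
set s := size (majorant n).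
rewrite (horner_coef_wide _ (leq_maxr n s)) -(subnKC (leq_maxl n s)) big_split_ord/=.
have nn := dominated_nonneg (dominated_euler n).
apply: ler_wpDr; first by apply: sumr_ge0 => j _; rewrite mulr_ge0// exprn_ge0.
by apply: ler_sum => j _; rewrite (majorant_stable (N := n))// ltnW.
Qed.

Lemma normc_le (x : R[i]) : `|x| <= (`|complex.Re x| + `|complex.Im x|)%:C.
Proof.
rewrite normc_def lecR -(ler_pXn2r (n := 2)) ?nnegrE ?sqrtr_ge0 ?addr_ge0//.
rewrite sqr_sqrtr ?addr_ge0 ?sqr_ge0// sqrrD !real_normK ?num_real//.
by rewrite addrAC lerDl mulrn_wge0// mulr_ge0.
Qed.

Lemma Re_le (x : R[i]) (b : R) : `|x| <= b%:C -> `|complex.Re x| <= b.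
Proof.
rewrite normc_def lecR; apply: le_trans; rewrite -sqrtr_sqr ler_sqrt ?lerDl ?sqr_ge0//.
by rewrite addr_ge0// sqr_ge0.
Qed.

Lemma Im_le (x : R[i]) (b : R) : `|x| <= b%:C -> `|complex.Im x| <= b.
Proof.
rewrite normc_def lecR; apply: le_trans; rewrite -sqrtr_sqr ler_sqrt ?lerDr ?sqr_ge0//.
by rewrite addr_ge0// sqr_ge0.
Qed.

(** Absolute convergence from monotone convergence: a = (a + b) - b, where both series have
    nonnegative terms and bounded partial sums. *)
Lemma dominated_real_series (a b : nat -> R) (B : R) : (forall j, `|a j| <= b j) ->
  (forall n, \sum_(j < n) b j <= B) ->
  exists x : R, (fun n => \sum_(j < n) a j) @ \oo --> x.
Proof.
move=> ab bB; have b0 j : 0 <= b j by exact: le_trans (ab j).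
have mono (f : nat -> R) (B' : R) : (forall j, 0 <= f j) -> (forall n, \sum_(j < n) f j <= B') ->
    cvgn (fun n => \sum_(j < n) f j).
  move=> f0 fB; apply: nondecreasing_is_cvgn.
    apply/nondecreasing_seqP => n; rewrite big_ord_recr/= lerDl.
    exact: f0.
  by exists B' => _ [n _ <-].
have c1 := mono b B b0 bB.
have c2 : cvgn (fun n => \sum_(j < n) (a j + b j)).
  apply: (mono (fun j => a j + b j) (B + B)) => [j|n].
    by rewrite -lerBlDr sub0r lerNl; apply: le_trans (ab j); rewrite -normrN ler_norm.
  rewrite big_split/= lerD ?bB//; apply: le_trans (bB n); apply: ler_sum => j _.
  exact: le_trans (ler_norm _) (ab j).
exists (limn (fun n => \sum_(j < n) (a j + b j)) - limn (fun n => \sum_(j < n) b j)).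
have -> : (fun n => \sum_(j < n) a j) =
    (fun n => \sum_(j < n) (a j + b j)) - (fun n => \sum_(j < n) b j).
  by apply/funext => n; rewrite -[RHS]/(\sum_(j < n) (a j + b j) - \sum_(j < n) b j) big_split/= addrK.
exact: cvgB c2 c1.
Qed.

Lemma abs_series (a : nat -> R[i]) (b : nat -> R) (B : R) :
  (forall j, `|a j| <= (b j)%:C) -> (forall n, \sum_(j < n) b j <= B) ->
  exists (L : R[i]) (v : nat -> R), v @ \oo --> (0 : R) /\
    forall n, `|L - \sum_(j < n) a j| <= (v n)%:C.
Proof.
move=> ab bB.
have [x hx] := dominated_real_series (fun j => Re_le (ab j)) bB.
have [y hy] := dominated_real_series (fun j => Im_le (ab j)) bB.
exists (Complex x y), (fun n => `|x - \sum_(j < n) complex.Re (a j)| +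
  `|y - \sum_(j < n) complex.Im (a j)|); split.
  have lim0 (u : nat -> R) l : u @ \oo --> l -> (fun n => `|l - u n|) @ \oo --> (0 : R).
    move=> hu; rewrite -(normr0 R) -(subrr l); apply: cvg_norm.
    by apply: cvgB => //; exact: cvg_cst.
  by rewrite -[X in _ --> X](addr0 (0 : R)); apply: cvgD; exact: lim0.
move=> n; apply: le_trans (normc_le _) _; rewrite lecR.
have ReS : complex.Re (\sum_(j < n) a j) = \sum_(j < n) complex.Re (a j).
  by elim/big_rec2: _ => // j u w _ <-; case: (a j) w => ? ? [].
have ImS : complex.Im (\sum_(j < n) a j) = \sum_(j < n) complex.Im (a j).
  by elim/big_rec2: _ => // j u w _ <-; case: (a j) w => ? ? [].
by move: ReS ImS; case: (\sum_(j < n) a j) => s t /= -> ->.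
Qed.

Lemma cvg_bounded (u : nat -> R[i]^o) (L : R[i]) (v : nat -> R) :
  v @ \oo --> (0 : R) -> (forall n, `|L - u n| <= (v n)%:C) -> u @ \oo --> (L : R[i]^o).
Proof.
move=> v0 h; apply/cvgrPdist_lt => e; rewrite ltcE => /andP[/eqP/= e0 e1].
have eE : e = (complex.Re e)%:C by case: e e0 {e1} => ? ? /= ->.
move/cvgrPdist_lt: v0 => /(_ _ e1); apply: filterS => n.
rewrite sub0r normrN => vn; apply: le_lt_trans (h n) _; rewrite eE ltcR.
exact: le_lt_trans (ler_norm _) vn.
Qed.

(** The n-th truncated product has the same coefficients as the series in degrees below n, and the
    rest of it is bounded by a tail of the dominating series; so both approximate the same limit,
    with real error bounds. *)
Lemma euler_limit (z : nat -> R[i]) (q : R[i]) : `|q| < 1 ->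
  (forall N n, (n <= N)%N -> z n = (euler R[i] N)`_n) ->
  exists (L : R[i]) (v w : nat -> R), [/\ v @ \oo --> (0 : R), w @ \oo --> (0 : R),
    forall n, `|L - \sum_(j < n) z j * q ^+ j| <= (v n)%:C &
    forall n, `|L - (euler R[i] n).[q]| <= (w n)%:C].
Proof.
move=> q1 hz.
have [r [r0 r1 qr]] : exists r : R, [/\ 0 <= r, r < 1 & `|q| = r%:C].
  have := q1; have := normr_ge0 q; rewrite normc_def => h0 h1.
  by eexists; split; [| |reflexivity]; [rewrite -ler0c|rewrite -(ltcR _ 1)].
pose b j := (majorant j)`_j * r ^+ j.
have bB n : \sum_(j < n) b j <= _ := majorant_sum n r0 r1.
have b0 j : 0 <= b j.
  by rewrite mulr_ge0 ?exprn_ge0//; exact: (dominated_nonneg (dominated_euler j)).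
have Pb N j : `|(euler R[i] N)`_j * q ^+ j| <= (b j)%:C.
  rewrite normrM normrX qr /b rmorphM rmorphXn/=; apply: ler_wpM2r.
    by rewrite exprn_ge0// ler0c.
  by apply: le_trans (dominated_euler N j) _; rewrite lecR majorant_le.
have ab j : `|z j * q ^+ j| <= (b j)%:C by rewrite (hz j j)//.
have [L [v [v0 hv]]] := abs_series ab bB.
have [x hx] : exists x : R, (fun n => \sum_(j < n) b j) @ \oo --> x.
  by apply: (dominated_real_series _ bB) => j; rewrite ger0_norm.
have nd : nondecreasing_seq (fun n => \sum_(j < n) b j).
  by apply/nondecreasing_seqP => n; rewrite big_ord_recr/= lerDl.
have bx n : \sum_(j < n) b j <= x.
  rewrite -(cvg_lim (@Rhausdorff R) hx); apply: nondecreasing_cvgn_le => //.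
  by apply/cvg_ex; exists x.
exists L, v, (fun n => v n + (x - \sum_(j < n) b j)); split=> //.
  rewrite -[X in _ --> X](addr0 (0 : R)); apply: cvgD => //.
  by rewrite -[X in _ --> X](subrr x); exact: (cvgB (cvg_cst x) hx).
move=> n; rewrite rmorphD/=.
rewrite -[L](subrK (\sum_(j < n) z j * q ^+ j)) -addrA.
apply: (le_trans (ler_normD _ _)); apply: (lerD (hv n)).
set s := size (euler R[i] n).
rewrite (horner_coef_wide _ (leq_maxr n s)) -(subnKC (leq_maxl n s)) big_split_ord/=.
rewrite (eq_bigr (fun j : 'I_n => (euler R[i] n)`_j * q ^+ j)); last first.
  by move=> j _; rewrite (hz n j)// ltnW.
rewrite opprD addrA subrr sub0r normrN; apply: le_trans (ler_norm_sum _ _ _) _.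
apply: (@le_trans _ _ (\sum_(j < maxn n s - n) b (n + j)%N)%:C).
  by rewrite raddf_sum; apply: ler_sum => j _; exact: Pb.
rewrite lecR lerBrDl; apply: le_trans (bx (n + (maxn n s - n))%N).
by rewrite big_split_ord.
Qed.

End Majorant.

Section Nome.
Variable R : realType.
Implicit Types tau z : R[i].

Lemma cexpD z z' : cexp (z + z') = cexp z * cexp z'.
Proof.
case: z z' => a b [c d]; rewrite /cexp /= expRD cosD sinD rmorphM/=.
rewrite mulrACA; congr (_ * _); apply/eqP; rewrite eq_complex/=.
by rewrite eqxx/= addrC (mulrC (sin b)) eqxx.
Qed.

Lemma qpow_nat tau n : qpow tau n%:R = qpow tau 1 ^+ n.
Proof.
elim: n => [|n IHn].
  rewrite expr0 /qpow mulr0 /cexp /= expR0 cos0 sin0.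
  by apply/eqP; rewrite eq_complex/= mul1r mul0r subr0 mulr0 mul0r addr0 !eqxx.
by rewrite exprSr -IHn -cexpD -mulrDr natr1.
Qed.

Lemma qpow_norm tau : 0 < complex.Im tau -> `|qpow tau 1| < 1.
Proof.
case: tau => a b /= b0; rewrite /qpow /cexp mulr1 normrM.
rewrite !normc_def /= !expr0n /= addr0 cos2Dsin2 sqrtr1 -rmorphM/= mulr1.
rewrite -[ltRHS]/((1 : R)%:C) ltcR.
rewrite sqrtr_sqr ger0_norm ?expR_ge0// -[ltRHS]expR0 ltr_expR.
have := mulr_gt0 (pi_gt0 R) b0.
set x := (X in X < 0); have -> : x = - (2 * (pi * b)) by rewrite /x; ring.
by move: (pi * b) => y y0; lra.
Qed.

End Nome.

Theorem proposition7p34 (R : realType)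
  (V : voa R[i]) (J : {linear 'M[R[i]]_2 -> V}) (hV : is_affine_voa 16 J)
  (W : voa_module V) (hW : is_affine_module 16 16 J W)
  (M : voa_module V) (hM : is_affine_module 16 8 J M) :
  exists (v : W) (I : W -> int -> M -> M),
    is_intertwining (conformal_weight R[i] 16 16) I /\
    forall tau : R[i], 0 < complex.Im tau ->
      cvgn (series (trace_term (conformal_weight R[i] 16 16)
                               (conformal_weight R[i] 16 8) I v tau)) /\
      trace_function (conformal_weight R[i] 16 16)
                     (conformal_weight R[i] 16 8) I v tau = Delta tau.
Proof.
have [v [I [z [hI hz zneg z0 zr]]]] := intertwiner_traces hV hW hM.
exists v, I; split=> // tau tau0; set q := qpow tau 1.
have q1 : `|q| < 1 := qpow_norm tau0.
have [L [s [e [s0 e0 hs he]]]] :=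
  euler_limit q1 (fun N n => @euler_unique _ z zneg z0 zr N n).
(* The conformal weight 10/9 minus c/24 = 1/9 equals 1, which accounts for the leading factor q of
   the product. *)
have expo n : n%:R + conformal_weight R[i] 16 8 - central_charge V / 24%:R = n.+1%:R.
  rewrite (central_chargeE hV) /conformal_weight (_ : (8 * (8 + 2) = 80)%N)//.
  rewrite (_ : (4 * (16 + 2) = 72)%N)// (_ : (3 * 16 = 48)%N)// (_ : (16 + 2 = 18)%N)//.
  by rewrite -natr1; field.
have qle (x : R[i]) (y : R) : `|x| <= (y%:C)%C -> `|q * x| <= (y%:C)%C.
  by move=> hx; rewrite normrM; apply: le_trans hx; apply: ler_piMl => //; exact: ltW.
have cS : series (trace_term (conformal_weight R[i] 16 16) (conformal_weight R[i] 16 8) I v tau)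
    @ \oo --> (q * L : R[i]^o).
  apply: (cvg_bounded s0) => n.
  rewrite (_ : series _ n = q * \sum_(j < n) z j%:Z * q ^+ j); last first.
    rewrite /series /= big_mkord mulr_sumr; apply: eq_bigr => j _.
    by rewrite /trace_term hz expo qpow_nat exprS mulrCA.
  by rewrite -mulrBr; exact: qle.
have cD : Delta_partial tau @ \oo --> (q * L : R[i]^o).
  apply: (cvg_bounded e0) => n.
  rewrite (_ : Delta_partial tau n = q * (euler R[i] n).[q]); last first.
    rewrite /Delta_partial big_add1 big_mkord /euler horner_prod; congr (_ * _).
    by apply: eq_bigr => j _; rewrite horner_exp !hornerE.
  by rewrite -mulrBr; exact: qle.
split; first by apply/cvg_ex; exists (q * L).
have hd := @norm_hausdorff _ R[i]^o.
by rewrite /trace_function /Delta (cvg_lim hd cS) (cvg_lim hd cD).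
Qed.
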